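(* Let $\rho>0$ and for each $n\ge 1$ let $S^n=\{(\xi_1,\dots,\xi_{n+1})\in\mathbb{R}^{n+1}:\ \sum_{1\le l\le n+1}\xi_l=\rho,\ \xi_l\ge 0 \text{ for every } l\}$ be the regular simplex, considered as an $n$-dimensional solid compact convex subset of the $n$-dimensional Euclidean space $\{(\xi_1,\dots,\xi_{n+1})\in\mathbb{R}^{n+1}:\ \sum_{1\le l\le n+1}\xi_l=\rho\}$ (identified isometrically with $\mathbb{R}^n$). Then for every $\tau\in\mathbb{C}$, $$\lim_{n\to\infty}\mathscr{M}_{S^n}(\tau)=\sum_{0\le l<\infty}\left(\frac{\sqrt{\pi}}{2}\right)^l\frac{\tau^l}{\Gamma\left(\frac{l}{2}+1\right)\Gamma(l+1)} .$$
   Context: A compact convex set $K\subset\mathbb{R}^n$ is called solid if its interior is non-empty, equivalently $\mathrm{Vol}_n(K)>0$. Let $B$ denote the closed unit Euclidean ball of $\mathbb{R}^n$ centered at the origin. By Minkowski, for $t>0$ the function $M_K(t)=\mathrm{Vol}_n(K+tB)$ is a polynomial in $t$ of degree $n$ (the Steiner-Minkowski polynomial of $K$); it is then considered for all complex $t$. Its constant coefficient is $\mathrm{Vol}_n(K)$ and its linear coefficient is the surface area $\mathrm{Vol}_{n-1}(\partial K)$. For solid $K$ the shape factor is $\sigma_K=\mathrm{Vol}_{n-1}(\partial K)/\mathrm{Vol}_n(K)>0$. The renormalized Steiner-Minkowski polynomial $\mathscr{M}_K(\tau)$ is the polynomial in $\tau$ of degree $n$ defined by $M_K(t)=\mathrm{Vol}_n(K)\cdot\mathscr{M}_K(\sigma_K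 t)$, i.e. $\mathscr{M}_K(\tau)=M_K(\tau/\sigma_K)/\mathrm{Vol}_n(K)$. These notions are invariant under isometries of $\mathbb{R}^n$, so they apply to a convex set in any $n$-dimensional Euclidean affine space, with volume, surface area and neighborhoods taken within that space. *)

(* Defs.v *)
From HB Require Import structures.
From mathcomp Require Export all_boot all_order all_algebra.
From mathcomp Require Export complex.
From mathcomp Require Export all_classical all_reals all_analysis.
Export Order.TTheory GRing.Theory Num.Theory.
Export numFieldNormedType.Exports.

Set Implicit Arguments.
Unset Strict Implicit.
Unset Printing Implicit Defensive.

Global Open Scope classical_set_scope.
Global Open Scope ring_scope.

(* The norm [`|v|] of the library on ['rV[R]_n] is the sup norm, whence the
   separate Euclidean norm. Both induce the same topology, so [interior],
   [closure], etc. have their usual meaning in Euclidean space. *)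
Definition l2norm (R : realType) (n : nat) (v : 'rV[R]_n) : R :=
  Num.sqrt (\sum_(i < n) v 0 i ^+ 2).

Definition l2ball (R : realType) (n : nat) (t : R) : set 'rV[R]_n :=
  [set v | l2norm v <= t].

Definition box (R : realType) (n : nat) (a b : 'rV[R]_n) : set 'rV[R]_n :=
  [set x | forall i, a 0 i <= x 0 i <= b 0 i].

(* n-dimensional Lebesgue outer measure: the infimum of the total volume of a
   countable family of boxes covering [A]. The family is indexed by a subset
   of [nat], so that it may be finite or empty (this only matters for
   [n = 0], where a box always has volume 1). *)
Definition vol (R : realType) (n : nat) (A : set 'rV[R]_n) : \bar R :=
  ereal_inf [set s : \bar R |
    exists (D : set nat) (a b : nat -> 'rV[R]_n),
      [/\ forall k i, a k 0 i <= b k 0 i,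
          A `<=` \bigcup_(k in D) box (a k) (b k) &
          s = \esum_(k in D) (\prod_(i < n) (b k 0 i - a k 0 i))%:E]].

(* The diameter of the empty set is [-oo]. *)
Definition diam (R : realType) (n : nat) (C : set 'rV[R]_n) : \bar R :=
  ereal_sup [set (l2norm (x - y))%:E | x in C & y in C].

(* [diam C ^ m], with the convention [0 ^ 0 = 1] for a nonempty [C] (so that
   the 0-dimensional measure counts points) and the value [0] on [set0]. *)
Definition hausdorff_gauge (R : realType) (n m : nat) (C : set 'rV[R]_n) :
    \bar R :=
  if C == set0 then 0%E else (diam C ^+ m)%E.

Definition hausdorff_pre (R : realType) (n m : nat) (delta : R)
    (A : set 'rV[R]_n) : \bar R :=
  ereal_inf [set (\sum_(0 <= k <oo) hausdorff_gauge m (C k))%E |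
    C in [set C : nat -> set 'rV[R]_n |
      (forall k, (diam (C k) <= delta%:E)%E) /\ A `<=` \bigcup_k C k]].

(* The m-dimensional Hausdorff (outer) measure in R^n, not normalized. *)
Definition hausdorff (R : realType) (n m : nat) (A : set 'rV[R]_n) : \bar R :=
  ereal_sup [set hausdorff_pre m delta A | delta in [set delta : R | 0 < delta]].

(* The m-dimensional volume of a subset of R^n: the Hausdorff measure with its
   standard normalization, i.e. the one for which it is the Lebesgue measure
   on R^m; the constant is fixed by giving measure 1 to the unit cube of R^m. *)
Definition mvol (R : realType) (n m : nat) (A : set 'rV[R]_n) : R :=
  fine (hausdorff m A) /
  fine (hausdorff m (box (0 : 'rV[R]_m) (const_mx 1))).

Definition minkowski_sum (R : realType) (n : nat) (A B : set 'rV[R]_n) :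
    set 'rV[R]_n :=
  [set x + y | x in A & y in B].

Definition boundary (R : realType) (n : nat) (A : set 'rV[R]_n) :
    set 'rV[R]_n :=
  closure A `\` interior A.

Definition surface_area (R : realType) (n : nat) (K : set 'rV[R]_n) : R :=
  mvol n.-1 (boundary K).

Definition shape_factor (R : realType) (n : nat) (K : set 'rV[R]_n) : R :=
  surface_area K / fine (vol K).

(* Note that [t *: B], for [t > 0] and [B] the closed unit ball, is the closed
   ball of radius [t]. *)
Definition is_steiner_poly (R : realType) (n : nat) (K : set 'rV[R]_n)
    (p : {poly R}) : Prop :=
  forall t : R, 0 < t -> vol (minkowski_sum K (@l2ball R n t)) = (p.[t])%:E.

(* Such a polynomial is unique; it exists when [K] is compact and convex, by
   Minkowski's theorem. The value is [0] when there is none. *)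
Definition steiner_poly (R : realType) (n : nat) (K : set 'rV[R]_n) :
    {poly R} :=
  xget 0 [set p | is_steiner_poly K p].

(* The polynomial M_K(tau / sigma_K) / Vol_n(K) in tau. *)
Definition renorm_steiner_poly (R : realType) (n : nat) (K : set 'rV[R]_n) :
    {poly R} :=
  (fine (vol K))^-1 *: (steiner_poly K \Po ((shape_factor K)^-1 *: 'X)).

(* The field [R[i]] as a [numFieldType], since the topology of the library
   (here the one given by the complex modulus) is attached to that structure. *)
Definition complexes (R : realType) : numFieldType := R[i].

Definition horner_complex (R : realType) (p : {poly R}) (z : complexes R) :
    complexes R :=
  (map_poly (real_complex R) p).[z].

(* The hyperplane of R^(n+1) carrying the simplex. *)
Definition simplex_space (R : realType) (rho : R) (n : nat) :
    set 'rV[R]_n.+1 :=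
  [set x | \sum_(l < n.+1) x 0 l = rho].

Definition regular_simplex (R : realType) (rho : R) (n : nat) :
    set 'rV[R]_n.+1 :=
  [set x | \sum_(l < n.+1) x 0 l = rho /\ forall l, 0 <= x 0 l].

(* [phi] is an isometric identification of R^n with the subset [H] of R^N. *)
Definition isometric_chart (R : realType) (n N : nat) (H : set 'rV[R]_N)
    (phi : 'rV[R]_n -> 'rV[R]_N) : Prop :=
  (forall x y, l2norm (phi x - phi y) = l2norm (x - y)) /\ range phi = H.

Definition Gamma (R : realType) (x : R) : R :=
  (\int[@lebesgue_measure R]_(t in `]0%R, +oo[) (t `^ (x - 1) * expR (- t)))%R.

(* Main.v *)
From HB Require Import structures.
From mathcomp Require Import ring lra zify fingroup perm measurable_realfun.
Require Import Defs.

Set Implicit Arguments.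
Unset Strict Implicit.
Unset Printing Implicit Defensive.

(* A point of the hyperplane within distance t of S^n is sorted by the set I of
   the coordinates that its projection to S^n makes 0, and each such piece is a
   product of an (n-l)-dimensional simplex, l = #|I|, with the intersection of a
   ball and a polyhedral cone of R^l. The coefficient of t^l is thus
   C(n+1, l) sqrt(n+1) rho^(n-l) / (n-l)! d_(n-l,l), where d_(k,l) is the volume of
   that intersection for t = 1. The facets are regular simplices, so the
   surface area is (n+1) sqrt n rho^(n-1) / (n-1)!, and the coefficient of tau^l in the
   renormalized polynomial is

     C(n+1, l) n (n-1) ... (n-l+1) / (n sqrt (n (n+1)))^l d_(n-l,l) <= 4^l / l!.

   As k tends to infinity the cones tend to an orthant, hence d_(k,l) to the volume
   (sqrt pi / 2)^l / Gamma (l/2 + 1) of the part of the unit ball lying in an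
   orthant, and the theorem follows by dominated convergence of series. *)

(** * Lebesgue measure on row vectors *)

(** [vol] and [hausdorff] are infima over coverings, so upper bounds are easy and lower bounds are
    the obstacle. For boxes the lower bound comes from a product measure, which cannot exceed the
    total volume of any cover. For Hausdorff measure in full dimension it comes from passing to the
    complement in a cube. The isodiametric inequality is avoided: the normalization in [mvol] is the
    measure of the unit cube, a constant shown positive and finite, which then cancels. The factor
    sqrt(n+1) is a Jacobian. Isometries are affine, so any chart of the hyperplane reduces to
    forgetting one coordinate, which divides volumes by sqrt(n+1). The same fact one dimension lower
    gives the sqrt n of the facets. In these coordinates a piece is not literally a product: the
    simplex factor is translated by an amount that depends on the point of the cone, which leaves
    the volumes of the sections unchanged. The bound 4^l is the product of two crude factors 2^l:
    the volume of a cube around the ball, and l quotients each at most 2. *)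

Section box_sigma_algebra.
Variables (R : realType) (n : nat).

Definition boxes : set (set 'rV[R]_n) := [set A | exists a b, A = box a b].

Let boxes_set0 : <<s boxes >> set0.
Proof. exact: sigma_algebra0. Qed.

Let boxes_setC A : <<s boxes >> A -> <<s boxes >> (~` A).
Proof. exact: sigma_algebraC. Qed.

Let boxes_bigcup (F : (set 'rV[R]_n)^nat) : (forall i, <<s boxes >> (F i)) ->
  <<s boxes >> (\bigcup_i (F i)).
Proof. exact: sigma_algebra_bigcup. Qed.

HB.instance Definition _ := @isMeasurable.Build
  (measure_tuple_display default_measure_display) 'rV[R]_n <<s boxes >>
  boxes_set0 boxes_setC boxes_bigcup.

Lemma measurable_box (a b : 'rV[R]_n) : measurable (box a b).
Proof. by apply: sub_sigma_algebra; exists a, b. Qed.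

Lemma setI_box (a b c d : 'rV[R]_n) :
  box a b `&` box c d =
  box (\row_i Num.max (a 0 i) (c 0 i))%R (\row_i Num.min (b 0 i) (d 0 i))%R.
Proof.
apply/seteqP; split=> x /=; rewrite /box /=.
  move=> [h1 h2] i; rewrite !mxE ge_max le_min.
  by move: (h1 i) (h2 i) => /andP[-> ->] /andP[-> ->].
move=> h; split=> i; have := h i; rewrite !mxE ge_max le_min;
  by move=> /andP[/andP[ha hc] /andP[hb hd]]; rewrite ?ha ?hb ?hc ?hd.
Qed.

Lemma boxes_setI : setI_closed boxes.
Proof. by move=> _ _ [a [b ->]] [c [d ->]]; rewrite setI_box; eexists; eexists. Qed.

Lemma bigcup_box :
  \bigcup_k box (const_mx (- k%:R) : 'rV[R]_n) (const_mx k%:R) = setT.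
Proof.
apply/seteqP; split=> // x _.
have [k kx] : exists k : nat, forall i, (`|x 0 i| <= k%:R)%R.
  exists (\sum_(i < n) (Num.trunc `|x 0%R i|).+1)%N => i.
  rewrite (bigD1 i)//= natrD.
  apply: (@le_trans _ _ ((Num.trunc `|x 0 i|).+1)%:R); last by rewrite lerDl.
  by apply/ltW/truncnS_gt.
by exists k => // i; rewrite !mxE -ler_norml.
Qed.

(** The generators are compact boxes, so an open half-space has to be exhausted by them: side [i]
    stops at distance [1 / (k + 1)] before [c], the other sides grow with [k]. *)
Lemma measurable_coord (i : 'I_n) :
  measurable_fun [set: 'rV[R]_n] (fun x : 'rV[R]_n => x 0 i : R).
Proof.
apply: (measurability _ (measurable_realfun.RGenInftyO.measurableE R)) => //.
move=> _ [_ [c ->] <-]; rewrite setTI.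
rewrite [X in measurable X](_ : _ =
  \bigcup_k box (const_mx (- k%:R) : 'rV[R]_n)
      (\row_j (if j == i then c - k.+1%:R^-1 else k%:R)))%R; last first.
  apply/seteqP; split=> x /=; rewrite in_itv /=.
    move=> xc.
    have [k kx] : (\bigcup_k box (const_mx (- k%:R) : 'rV[R]_n) (const_mx k%:R)) x.
      by rewrite bigcup_box.
    move=> kxx.
    have d0 : (0 < c - x 0 i)%R by rewrite subr_gt0.
    exists (maxn k (Num.trunc (c - x 0 i)^-1)) => // j.
    have := kxx j; rewrite !mxE => /andP[h1 h2].
    apply/andP; split.
      by rewrite (le_trans _ h1)// lerN2 ler_nat leq_maxl.
    case: ifPn => [/eqP -> | _]; last first.
      by rewrite (le_trans h2)// ler_nat leq_maxl.
    rewrite lerBrDr -lerBrDl.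
    rewrite invf_ple ?posrE ?ltr0Sn//.
    apply/ltW/(lt_le_trans (truncnS_gt _)).
    by rewrite ler_nat ltnS leq_maxr.
  move=> [k _ /(_ i)]; rewrite !mxE eqxx => /andP[_] /le_lt_trans; apply.
  by rewrite ltrBlDr ltrDl invr_gt0.
by apply: bigcup_measurable => k _; exact: measurable_box.
Qed.

Lemma measurable_fun_row d (T : measurableType d) (f : T -> 'rV[R]_n) :
  (forall i, measurable_fun setT (fun x => f x 0 i : R)) ->
  measurable_fun setT f.
Proof.
move=> mf; apply: (measurability boxes) => //.
move=> _ [_ [a [b ->]] <-]; rewrite setTI.
rewrite [X in measurable X](_ : _ =
  \bigcap_(i in [set: 'I_n]) ((fun x => f x 0 i) @^-1` `[a 0 i, b 0 i]%classic)).
  apply: fin_bigcap_measurable => // i _.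
  by rewrite -[X in measurable X]setTI; exact: mf.
apply/seteqP; split=> x /= h; first by move=> i _ /=; rewrite in_itv /= h.
by move=> i; have := h i I; rewrite /= in_itv.
Qed.

End box_sigma_algebra.

Section vol_outer_measure.
Variables (R : realType) (n : nat).
Implicit Types (A : set 'rV[R]_n) (a b : 'rV[R]_n).

Definition box_vol a b : R := \prod_(i < n) (b 0 i - a 0 i).

Definition le_row a b := forall i, a 0 i <= b 0 i.

Lemma box_vol_ge0 a b : le_row a b -> 0 <= box_vol a b.
Proof. by move=> ab; apply: prodr_ge0 => i _; rewrite subr_ge0. Qed.

(** Transports covers to [nat] by [pickle]; countable subadditivity needs covers indexed by
    pairs. *)
Lemma vol_le_esum (I : countType) (D : set I) (a b : I -> 'rV[R]_n) A :
  (forall k, le_row (a k) (b k)) -> A `<=` \bigcup_(k in D) box (a k) (b k) ->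
  (vol A <= \esum_(k in D) (box_vol (a k) (b k))%:E)%E.
Proof.
move=> ab cov.
pose a' k := if unpickle k is Some i then a i else 0.
pose b' k := if unpickle k is Some i then b i else 0.
rewrite (_ : esum _ _ = \esum_(k in pickle @` D) (box_vol (a' k) (b' k))%:E)%E.
  apply: ereal_inf_lbound; exists (pickle @` D), a', b'; split => //.
    move=> k i; rewrite /a' /b'; case: unpickle => //= j; exact: ab.
  move=> x /cov [k Dk kx]; exists (pickle k); first by exists k.
  by rewrite /a' /b' pickleK.
rewrite (@reindex_esum _ _ _ D (pickle @` D) pickle).
  by apply: eq_esum => k Dk; rewrite /a' /b' pickleK.
by split=> //; move=> i j _ _; exact: (pcan_inj pickleK).
Qed.

Lemma vol_ge0 A : (0 <= vol A)%E.
Proof.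
apply: le_ereal_inf_tmp => _ [D [a [b [ab _ ->]]]].
by apply: esum_ge0 => k Dk; rewrite lee_fin box_vol_ge0.
Qed.

Lemma vol_adherent A (e : R) : 0 < e -> (vol A < +oo)%E ->
  exists (D : set nat) (a b : nat -> 'rV[R]_n),
   [/\ forall k, le_row (a k) (b k), A `<=` \bigcup_(k in D) box (a k) (b k) &
     (\esum_(k in D) (box_vol (a k) (b k))%:E <= vol A + e%:E)%E].
Proof.
move=> e0 Aoo.
have Af : vol A \is a fin_num by rewrite ge0_fin_numE// vol_ge0.
have [_ [D [a [b [ab cov ->]]]] xe] := lb_ereal_inf_adherent e0 Af.
by exists D, a, b; split=> //; exact: ltW.
Qed.

Lemma vol_set0 : vol (set0 : set 'rV[R]_n) = 0%E.
Proof.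
apply/eqP; rewrite eq_le vol_ge0 andbT.
have := @vol_le_esum nat set0 (fun=> 0) (fun=> 0) set0 (fun _ _ => lexx _) (@sub0set _ _).
by rewrite esum_set0.
Qed.

Lemma le_vol : {homo @vol R n : A B / A `<=` B >-> (A <= B)%E}.
Proof.
move=> A B AB; apply: le_ereal_inf_tmp => _ [D [a [b [ab cov ->]]]].
by apply: vol_le_esum => //; exact: subset_trans cov.
Qed.

Lemma vol_sigma_subadditive : sigma_subadditive (@vol R n).
Proof.
move=> F.
have [[k Fk]|Fk] := pselect (exists k, vol (F k) = +oo%E).
  by rewrite (eseries_pinfty _ _ Fk) ?leey// => m _;
    rewrite -ltNye (lt_le_trans _ (vol_ge0 _)).
have Foo k : (vol (F k) < +oo)%E.
  by rewrite ltey; apply/eqP => h; apply: Fk; exists k.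
apply/lee_addgt0Pr => e e0.
apply: le_trans (epsilon_trick _ _ (ltW e0)); last by move=> k; exact: vol_ge0.
have e2 k : 0 < e / (2 ^ k.+1)%:R by rewrite divr_gt0// ltr0n expn_gt0.
have /choice [D /choice [a /choice [b Dab]]] := fun k => vol_adherent (e2 k) (Foo k).
apply: le_trans (vol_le_esum (D := setT `*`` D) (a := fun p => a p.1 p.2)
   (b := fun p => b p.1 p.2) _ _) _.
- by move=> [k j] /=; have [+ _ _] := Dab k; exact.
- move=> x [k _ Fkx]; have [_ + _] := Dab k => /(_ x Fkx) [j Dj jx].
  by exists (k, j).
rewrite -(@esum_esum _ _ _ _ _ (fun k j => (box_vol (a k j) (b k j))%:E)).
  rewrite nneseries_esumT; last first.
    by move=> k; rewrite adde_ge0 ?vol_ge0// lee_fin ltW.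
  by apply: le_esum => k _; have [] := Dab k.
by move=> k j _ _; rewrite lee_fin box_vol_ge0//; have [+ _ _] := Dab k; exact.
Qed.

HB.instance Definition _ := isOuterMeasure.Build R 'rV[R]_n (@vol R n)
  vol_set0 vol_ge0 le_vol vol_sigma_subadditive.

(** A hyperplane orthogonal to an axis cuts every box of a cover into two boxes whose volumes add
    up. Applied to a half-space and its complement, this is the Carathéodory condition. *)
Lemma vol_split_coord (i : 'I_n) (c : R) (A1 A2 X : set 'rV[R]_n) :
  (forall x, A1 x -> x 0 i <= c) -> (forall x, A2 x -> c <= x 0 i) ->
  (vol (X `&` A1) + vol (X `&` A2) <= vol X)%E.
Proof.
move=> hA1 hA2.
have [->|] := eqVneq (vol X) +oo%E; first by rewrite leey.
rewrite -ltey => Xoo.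
apply/lee_addgt0Pr => e e0.
have [D [a [b [ab cov le]]]] := vol_adherent e0 Xoo.
apply: le_trans le.
(* The level [c] clamped to side [i] of the box, so that both halves are boxes, one of them flat,
   when the hyperplane misses the box. *)
pose m k := Num.max (a k 0 i) (Num.min (b k 0 i) c).
pose a' k := \row_j if j == i then m k else a k 0 j.
pose b' k := \row_j if j == i then m k else b k 0 j.
have am k : a k 0 i <= m k by rewrite le_max lexx.
have mb k : m k <= b k 0 i by rewrite ge_max ab ge_min lexx.
have ab' k : le_row (a k) (b' k).
  by move=> j; rewrite mxE; case: eqP => [->|_] //; exact: ab.
have ab'' k : le_row (a' k) (b k).
  by move=> j; rewrite mxE; case: eqP => [->|_] //; exact: ab.
have e1 : (vol (X `&` A1) <= \esum_(k in D) (box_vol (a k) (b' k))%:E)%E.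
  apply: vol_le_esum => // x [/cov [k Dk kx] A1x]; exists k => // j.
  have /andP[h1 h2] := kx j; rewrite h1 mxE; case: eqP => [ji|//]; subst j.
  by rewrite /= le_max le_min h2 hA1// orbT.
have e3 : (vol (X `&` A2) <= \esum_(k in D) (box_vol (a' k) (b k))%:E)%E.
  apply: vol_le_esum => // x [/cov [k Dk kx] A1x]; exists k => // j.
  have /andP[h1 h2] := kx j; rewrite h2 mxE; case: eqP => [ji|_]; rewrite ?h1 //; subst j.
  by rewrite andbT ge_max h1 ge_min (hA2 _ A1x) orbT.
apply: (le_trans (leeD e1 e3)).
rewrite -esumD; last 2 first.
- by move=> k _; rewrite lee_fin box_vol_ge0.
- by move=> k _; rewrite lee_fin box_vol_ge0.
apply: le_esum => k _; rewrite -EFinD lee_fin /box_vol.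
rewrite (bigD1 i)//= [X in _ + X](bigD1 i)//= [leRHS](bigD1 i)//= !mxE eqxx.
rewrite [X in _ * X + _](eq_bigr (fun j => b k 0 j - a k 0 j)); last first.
  by move=> j /negPf ji; rewrite mxE ji.
rewrite [X in _ + _ * X](eq_bigr (fun j => b k 0 j - a k 0 j)); last first.
  by move=> j /negPf ji; rewrite mxE ji.
by rewrite -mulrDl addrC addrA subrK.
Qed.

Lemma caratheodory_box a b : (@vol R n).-caratheodory (box a b).
Proof.
pose T := caratheodory_type (@vol R n).
rewrite (_ : box a b = \bigcap_(i in [set: 'I_n])
   ([set x | a 0 i <= x 0 i] `&` [set x | x 0 i <= b 0 i])); last first.
  apply/seteqP; split=> x /= h; first by move=> i _; apply/andP/h.
  by move=> i; apply/andP/h.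
apply: (@fin_bigcap_measurable _ T) => // i _; apply: measurableI.
  apply: le_caratheodory_measurable => X; rewrite addeC.
  apply: (@vol_split_coord i (a 0 i)) => x //= /negP.
  by rewrite -ltNge => /ltW.
apply: le_caratheodory_measurable => X.
apply: (@vol_split_coord i (b 0 i)) => x //= /negP.
by rewrite -ltNge => /ltW.
Qed.

Lemma measurable_caratheodory A : measurable A -> (@vol R n).-caratheodory A.
Proof.
pose T := caratheodory_type (@vol R n).
apply: smallest_sub; first exact: (sigma_algebra_measurable T).
by move=> _ [a [b ->]]; exact: caratheodory_box.
Qed.

Lemma vol_semi_sigma_additive : semi_sigma_additive (@vol R n).
Proof.
move=> F mF tF mUF.
apply: (@caratheodory_measure_sigma_additive _ _ (@vol R n)) => //.
- by move=> i; exact: measurable_caratheodory.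
- exact: measurable_caratheodory.
Qed.

HB.instance Definition _ := isMeasure.Build _ _ _ (@vol R n)
  vol_set0 vol_ge0 vol_semi_sigma_additive.

Lemma vol_box_le a b : le_row a b -> (vol (box a b) <= (box_vol a b)%:E)%E.
Proof.
move=> ab.
apply: le_trans (@vol_le_esum nat [set 0%N] (fun=> a) (fun=> b) (box a b) _ _) _ => //.
  by move=> x xab; exists 0%N.
by rewrite esum_set1// lee_fin box_vol_ge0.
Qed.

Lemma box_eq0 a b : ~ le_row a b -> box a b = set0.
Proof.
move=> h; apply/seteqP; split=> // x xab; apply: h => i.
by have /andP[] := xab i; exact: le_trans.
Qed.

Lemma vol_box_lty a b : (vol (box a b) < +oo)%E.
Proof.
have [ab|ab] := pselect (le_row a b).
  by apply: (le_lt_trans (vol_box_le ab)); rewrite ltry.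
by rewrite box_eq0// vol_set0.
Qed.

Let vol_sigma_finite : sigma_finite [set: 'rV[R]_n] (@vol R n).
Proof.
exists (fun k => box (const_mx (- k%:R)) (const_mx k%:R)).
  by rewrite bigcup_box.
by move=> k; split; [exact: measurable_box|exact: vol_box_lty].
Qed.

HB.instance Definition _ := Measure_isSigmaFinite.Build _ _ _ (@vol R n)
  vol_sigma_finite.

Lemma box_measure_unique (m1 m2 : {measure set 'rV[R]_n -> \bar R}) :
  (forall a b, le_row a b -> m1 (box a b) = m2 (box a b)) ->
  (forall a b, le_row a b -> (m1 (box a b) < +oo)%E) ->
  forall A, measurable A -> m1 A = m2 A.
Proof.
move=> m12 m1oo.
apply: (@measure_unique _ _ _ (@boxes R n)
  (fun k => box (const_mx (- k%:R)) (const_mx k%:R))) => //.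
- exact: boxes_setI.
- by move=> k; eexists; eexists.
- exact: bigcup_box.
- move=> _ [a [b ->]].
  have [ab|ab] := pselect (le_row a b); first exact: m12.
  by rewrite box_eq0// !measure0.
- by move=> k; apply: m1oo => i; rewrite !mxE ge0_cp.
Qed.

(** The source of lower bounds for [vol]: by countable subadditivity of [m], the total volume of any
    cover of [A] by boxes is at least [m A]. *)
Lemma measure_le_vol (m : {measure set 'rV[R]_n -> \bar R}) :
  (forall a b, le_row a b -> (m (box a b) <= (box_vol a b)%:E)%E) ->
  forall A, measurable A -> (m A <= vol A)%E.
Proof.
move=> mle A mA; apply: le_ereal_inf_tmp => _ [D [a [b [ab cov ->]]]].
pose F k := if k \in D then box (a k) (b k) else set0.
apply: (@le_trans _ _ (\sum_(0 <= k <oo) m (F k))%E).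
  apply: measure_sigma_subadditive => //.
    by move=> k; rewrite /F; case: ifP => // _; exact: measurable_box.
  by move=> x /cov [k Dk kx]; exists k => //; rewrite /F mem_set.
rewrite nneseries_esumT; last by move=> k; exact: measure_ge0.
rewrite [leRHS]esum_mkcond; apply: le_esum => k _; rewrite /F.
by case: ifP => _; [exact: mle|rewrite measure0].
Qed.

End vol_outer_measure.

(** * Volumes of boxes, and [vol] as a product measure *)

Section vol_product.
Variable R : realType.

Lemma box_row_mx k l (a b : 'rV[R]_(k + l)) (x : 'rV_k) (y : 'rV_l) :
  box a b (row_mx x y) <->
  box (lsubmx a) (lsubmx b) x /\ box (rsubmx a) (rsubmx b) y.
Proof.
split=> [h|[h1 h2] i].
  split=> i; rewrite !mxE.
    by have := h (lshift l i); rewrite row_mxEl.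
  by have := h (rshift k i); rewrite row_mxEr.
case: (split_ordP i) => j ->; rewrite ?row_mxEl ?row_mxEr.
  by have := h1 j; rewrite !mxE.
by have := h2 j; rewrite !mxE.
Qed.

Lemma box_vol_split k l (a b : 'rV[R]_(k + l)) :
  box_vol a b = box_vol (lsubmx a) (lsubmx b) * box_vol (rsubmx a) (rsubmx b).
Proof.
rewrite /box_vol big_split_ord; congr (_ * _); apply: eq_bigr => i _;
  by rewrite !mxE.
Qed.

Lemma measurable_fun_row_mx k l d (T : measurableType d) (f : T -> 'rV[R]_k)
    (g : T -> 'rV[R]_l) :
  measurable_fun setT f -> measurable_fun setT g ->
  measurable_fun setT (fun x => row_mx (f x) (g x)).
Proof.
move=> mf mg; apply: measurable_fun_row => i.
case: (split_ordP i) => j ->.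
  under eq_fun do rewrite row_mxEl.
  exact: (measurableT_comp (measurable_coord j) mf).
under eq_fun do rewrite row_mxEr.
exact: (measurableT_comp (measurable_coord j) mg).
Qed.

Section product.
Variables (k l : nat) (d : measure_display) (T : measurableType d).
Variables (m : {sigma_finite_measure set T -> \bar R}) (c : T -> 'rV[R]_k).
Hypothesis mc : measurable_fun setT c.
Hypothesis m_box : forall a b, le_row a b ->
  m (c @^-1` box a b) = (box_vol a b)%:E.
Hypothesis vol_box_l : forall a b : 'rV[R]_l, le_row a b ->
  vol (box a b) = (box_vol a b)%:E.

(** The first block is an abstract measure space read in ['rV_k] through [c], so that the same
    construction serves to adjoin one real coordinate ([vol_cons]) and to join two blocks
    ([vol_row_mx]). *)
Definition glue (p : T * 'rV[R]_l) : 'rV[R]_(k + l) := row_mx (c p.1) p.2.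

Lemma measurable_glue : measurable_fun setT glue.
Proof.
by apply: measurable_fun_row_mx => //; exact: measurableT_comp.
Qed.

HB.instance Definition _ := isMeasurableFun.Build _ _ _ _ glue measurable_glue.

Definition glue_measure : {measure set 'rV[R]_(k + l) -> \bar R} :=
  measure_function_pushforward__canonical__measure_function_Measure
    (m \x @vol R l)%E measurable_glue.

Lemma glue_measure_box a b : le_row a b ->
  glue_measure (box a b) = (box_vol a b)%:E.
Proof.
move=> ab; rewrite /glue_measure /= /pushforward.
rewrite (_ : glue @^-1` _ =
  (c @^-1` box (lsubmx a) (lsubmx b)) `*` box (rsubmx a) (rsubmx b)); last first.
  by apply/seteqP; split=> -[x y] /box_row_mx.
rewrite product_measure1E//.
- rewrite box_vol_split EFinM; congr (_ * _)%E; [apply: m_box|apply: vol_box_l];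
    by move=> i; rewrite !mxE; exact: ab.
- by rewrite -[X in measurable X]setTI; apply: mc => //; exact: measurable_box.
- exact: measurable_box.
Qed.

(** The box covers itself, which bounds its volume above; the product measure fed to
    [measure_le_vol] bounds it below. *)
Lemma vol_box_glue (a b : 'rV[R]_(k + l)) : le_row a b ->
  vol (box a b) = (box_vol a b)%:E.
Proof.
move=> ab; apply/eqP; rewrite eq_le vol_box_le//=.
rewrite -glue_measure_box//; apply: measure_le_vol; last exact: measurable_box.
by move=> a' b' ab'; have := glue_measure_box ab' => /= ->.
Qed.

Lemma vol_glue A : measurable A -> vol A = (m \x @vol R l)%E (glue @^-1` A).
Proof.
apply: (box_measure_unique (m1 := @vol R (k + l)) (m2 := glue_measure)) => a b ab.
  exact: etrans (vol_box_glue ab) (esym (glue_measure_box ab)).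
exact: vol_box_lty.
Qed.

End product.

Definition cons_row n (p : R * 'rV[R]_n) : 'rV[R]_n.+1 :=
  row_mx (const_mx p.1 : 'rV_1) p.2.

Lemma box_const1 (a b : 'rV[R]_1) : le_row a b ->
  lebesgue_measure ((fun x : R => const_mx x : 'rV_1) @^-1` box a b) =
  (box_vol a b)%:E.
Proof.
move=> ab; rewrite (_ : _ @^-1` _ = `[a 0 0, b 0 0]%classic); last first.
  apply/seteqP; split=> x /=; rewrite in_itv /=.
    by move=> /(_ 0); rewrite mxE.
  by move=> h i; rewrite mxE ord1.
rewrite lebesgue_measure_itv/= lte_fin /box_vol big_ord1.
have -> : ord0 = 0 :> 'I_1 by [].
have := ab 0; rewrite le_eqVlt => /orP[/eqP ->|ab']; first by rewrite ltxx subrr.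
by rewrite ab' EFinB.
Qed.

Lemma measurable_const1 : measurable_fun setT (fun x : R => const_mx x : 'rV[R]_1).
Proof.
apply: measurable_fun_row => i; under eq_fun do rewrite mxE.
exact: measurable_id.
Qed.

Lemma vol_box n (a b : 'rV[R]_n) : le_row a b -> vol (box a b) = (box_vol a b)%:E.
Proof.
elim: n a b => [|n IHn] a b ab.
  apply/eqP; rewrite eq_le vol_box_le//=.
  (* In dimension 0 the Dirac measure at the only point takes the place of the product measure. *)
  have -> : (box_vol a b)%:E = (\d_(0 : 'rV[R]_0) (box a b)).
    by rewrite /box_vol big_ord0 diracE mem_set// => -[].
  apply: measure_le_vol; last exact: measurable_box.
  move=> a' b' _; rewrite /box_vol big_ord0.
  by rewrite [leLHS](_ : _ = ((0 \in box a' b')%:R)%:E)// lee_fin lern1 leq_b1.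
exact: (@vol_box_glue 1 n _ _ (@lebesgue_measure R) _ measurable_const1
  box_const1 IHn a b).
Qed.

Lemma vol_unique n (m : {measure set 'rV[R]_n -> \bar R}) :
  (forall a b, le_row a b -> m (box a b) = (box_vol a b)%:E) ->
  forall A, measurable A -> vol A = m A.
Proof.
move=> mb; apply: box_measure_unique => a b ab.
  exact: etrans (vol_box ab) (esym (mb _ _ ab)).
exact: vol_box_lty.
Qed.

Lemma vol_cons n (A : set 'rV[R]_n.+1) : measurable A ->
  vol A = (@lebesgue_measure R \x @vol R n)%E (@cons_row n @^-1` A).
Proof.
move=> mA.
exact: (@vol_glue 1 n _ _ (@lebesgue_measure R) _ measurable_const1 box_const1
  (@vol_box n) A mA).
Qed.

Lemma vol_row_mx k l (A : set 'rV[R]_(k + l)) : measurable A ->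
  vol A = (@vol R k \x @vol R l)%E ((fun p => row_mx p.1 p.2) @^-1` A).
Proof.
move=> mA.
exact: (@vol_glue k l _ _ (@vol R k) _ (@measurable_id _ _ setT)
   (@vol_box k) (@vol_box l) A mA).
Qed.

End vol_product.

Lemma measurable_preimage_setT d1 d2 (T1 : measurableType d1) (T2 : measurableType d2)
    (f : T1 -> T2) (A : set T2) :
  measurable_fun setT f -> measurable A -> measurable [set x | A (f x)].
Proof. by move=> mf mA; rewrite -[X in measurable X]setTI; exact: mf. Qed.

(** * Volumes by sections, and the effect of linear maps *)

Section vol_sections.
Variable R : realType.

Lemma xsectionP T1 T2 (A : set (T1 * T2)) x : xsection A x = [set y | A (x, y)].
Proof. by apply/seteqP; split=> y; rewrite /xsection /= inE. Qed.

Lemma ysectionP T1 T2 (A : set (T1 * T2)) y : ysection A y = [set x | A (x, y)].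
Proof. by apply/seteqP; split=> x; rewrite /ysection /= inE. Qed.

Lemma measurable_row_mx k l :
  measurable_fun setT (fun p : 'rV[R]_k * 'rV[R]_l => row_mx p.1 p.2).
Proof. exact: measurable_fun_row_mx. Qed.

Lemma measurable_cons_row n :
  measurable_fun setT (@cons_row R n).
Proof.
apply: (@measurable_fun_row_mx R 1 n) => //.
by apply: measurable_fun_row => i; under eq_fun do rewrite mxE; exact: measurable_fst.
Qed.

Section two_blocks.
Variables (k l : nat) (A : set 'rV[R]_(k + l)).
Hypothesis mA : measurable A.

Let mB : measurable ((fun p : 'rV[R]_k * 'rV[R]_l => row_mx p.1 p.2) @^-1` A).
Proof. exact: measurable_preimage_setT (@measurable_row_mx k l) mA. Qed.

Lemma vol_section1 :
  vol A = (\int[@vol R k]_x vol [set y | A (row_mx x y)])%E.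
Proof.
rewrite vol_row_mx// /product_measure1; apply: eq_integral => x _ /=.
by rewrite xsectionP.
Qed.

Lemma vol_section2 :
  vol A = (\int[@vol R l]_y vol [set x | A (row_mx x y)])%E.
Proof.
rewrite vol_row_mx// /product_measure1.
transitivity (\int[@vol R k]_x (fubini_F (@vol R l) (EFin \o \1_((fun p :
  'rV[R]_k * 'rV[R]_l => row_mx p.1 p.2) @^-1` A)) x))%E.
  by rewrite indic_fubini_tonelli_FE.
rewrite indic_fubini_tonelli// indic_fubini_tonelli_GE//.
by apply: eq_integral => x _ /=; rewrite ysectionP.
Qed.

Lemma measurable_vol_section1 :
  measurable_fun setT (fun x => vol [set y | A (row_mx x y)]).
Proof.
have := measurable_fun_xsection (@vol R l) mB; apply: eq_measurable_fun => x _ /=.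
by rewrite xsectionP.
Qed.

Lemma measurable_vol_section2 :
  measurable_fun setT (fun y => vol [set x | A (row_mx x y)]).
Proof.
have := measurable_fun_ysection (@vol R k) mB; apply: eq_measurable_fun => x _ /=.
by rewrite ysectionP.
Qed.

End two_blocks.

Lemma vol_cons_section n (A : set 'rV[R]_n.+1) : measurable A ->
  vol A = (\int[@lebesgue_measure R]_x vol [set y | A (cons_row (x, y))])%E.
Proof.
move=> mA; rewrite vol_cons// /product_measure1; apply: eq_integral => x _ /=.
by rewrite xsectionP.
Qed.

Lemma measurable_translate n (v : 'rV[R]_n) :
  measurable_fun setT (fun x : 'rV[R]_n => x + v).
Proof.
apply: measurable_fun_row => i; under eq_fun do rewrite mxE.
by apply: measurable_funD => //; exact: measurable_coord.
Qed.

Lemma measurable_mulmx n m (B : 'M[R]_(n, m)) :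
  measurable_fun setT (fun x : 'rV[R]_n => x *m B).
Proof.
apply: measurable_fun_row => i; under eq_fun do rewrite mxE.
apply: measurable_sum => j; apply: measurable_funM => //.
exact: measurable_coord.
Qed.

Lemma vol_translate n (v : 'rV[R]_n) (A : set 'rV[R]_n) : measurable A ->
  vol [set x | A (x + v)] = vol A.
Proof.
move=> mA; apply/esym.
pose m := measure_function_pushforward__canonical__measure_function_Measure
  (@vol R n) (measurable_translate v).
apply: (@vol_unique R n m) => // a b ab; rewrite /m /= /pushforward.
rewrite (_ : _ @^-1` _ = box (a - v) (b - v)).
  rewrite vol_box; last by move=> i; rewrite !mxE lerD2r ab.
  by congr (_%:E); apply: eq_bigr => i _; rewrite !mxE; lra.
by apply/seteqP; split=> x h i; have := h i; rewrite !mxE lerBlDr lerBrDr.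
Qed.

Lemma vol_scale1 (s : R) (A : set 'rV[R]_1) : s != 0 -> measurable A ->
  vol [set x | A (s *: x)] = ((`|s|^-1)%:E * vol A)%E.
Proof.
move=> s0 mA.
have ms : measurable_fun setT (fun x : 'rV[R]_1 => s *: x).
  apply: measurable_fun_row => i; under eq_fun do rewrite mxE.
  by apply: measurable_funM => //; exact: measurable_coord.
have ns : 0 < `|s| by rewrite normr_gt0.
suff : vol A = ((`|s|)%:E * vol [set x | A (s *: x)])%E.
  by move=> ->; rewrite muleA -EFinM mulVf ?gt_eqF// mul1e.
pose m := mscale (NngNum (ltW ns))
  (measure_function_pushforward__canonical__measure_function_Measure
  (@vol R 1) ms).
apply: (@vol_unique R 1 m) => // a b ab; rewrite /m /= /mscale /= /pushforward.
have := ab ord0; rewrite /box_vol big_ord1 => ab0.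
case: (ltrgtP s 0) s0 => // s0 _.
- rewrite (_ : _ @^-1` _ = box (s^-1 *: b) (s^-1 *: a)); last first.
    apply/seteqP; split=> x h i; have := h i; rewrite !ord1 !mxE.
      by rewrite !(mulrC s^-1) ler_ndivlMr// ler_ndivrMr// !(mulrC _ s) andbC.
    by rewrite !(mulrC s^-1) ler_ndivlMr// ler_ndivrMr// !(mulrC _ s) andbC.
  rewrite vol_box; last first.
    by move=> i; rewrite !ord1 !mxE ler_nM2l// invr_lt0.
  rewrite /box_vol big_ord1 -EFinM !mxE; congr EFin.
  by rewrite ltr0_norm//; field; rewrite lt_eqF.
- rewrite (_ : _ @^-1` _ = box (s^-1 *: a) (s^-1 *: b)); last first.
    apply/seteqP; split=> x h i; have := h i; rewrite !ord1 !mxE.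
      by rewrite !(mulrC s^-1) ler_pdivlMr// ler_pdivrMr// !(mulrC _ s).
    by rewrite !(mulrC s^-1) ler_pdivlMr// ler_pdivrMr// !(mulrC _ s).
  rewrite vol_box; last first.
    by move=> i; rewrite !ord1 !mxE ler_pM2l// invr_gt0.
  rewrite /box_vol big_ord1 -EFinM !mxE; congr EFin.
  by rewrite gtr0_norm//; field; rewrite gt_eqF.
Qed.

Definition scales_vol n (B : 'M[R]_n) := forall A : set 'rV[R]_n, measurable A ->
  vol [set x | A (x *m B)] = ((`|\det B|^-1)%:E * vol A)%E.

Lemma scales_volM n (B C : 'M[R]_n) :
  scales_vol B -> scales_vol C -> scales_vol (B *m C).
Proof.
move=> hB hC A mA.
under eq_set do rewrite mulmxA.
have mA' := measurable_preimage_setT (measurable_mulmx C) mA.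
by rewrite (hB _ mA') hC// muleA -EFinM det_mulmx normrM invfM.
Qed.

Lemma scales_vol_ublock n (v : 'rV[R]_n) :
  scales_vol (block_mx (1%:M : 'M[R]_1) v 0 1%:M).
Proof.
move=> A mA; rewrite det_ublock !det1 mulr1 normr1 invr1 mul1e.
have mA' := measurable_preimage_setT
  (measurable_mulmx (block_mx (1%:M : 'M[R]_1) v 0 1%:M)) mA.
rewrite (vol_section1 mA') (vol_section1 mA).
apply: eq_integral => x _.
rewrite -[RHS](vol_translate (x *m v)); last first.
  apply: (measurable_preimage_setT _ mA).
  exact: measurable_fun_row_mx.
congr (vol _); apply/seteqP; split=> y /=;
  by rewrite mul_row_block !mulmx1 mulmx0 addr0 addrC.
Qed.

Lemma scales_vol_lblock n (u : 'cV[R]_n) :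
  scales_vol (block_mx (1%:M : 'M[R]_1) 0 u 1%:M).
Proof.
move=> A mA; rewrite det_lblock !det1 mulr1 normr1 invr1 mul1e.
have mA' := measurable_preimage_setT
  (measurable_mulmx (block_mx (1%:M : 'M[R]_1) 0 u 1%:M)) mA.
rewrite (vol_section2 mA') (vol_section2 mA).
apply: eq_integral => y _.
rewrite -[RHS](vol_translate (y *m u)); last first.
  apply: (measurable_preimage_setT _ mA).
  exact: measurable_fun_row_mx.
congr (vol _); apply/seteqP; split=> x /=;
  by rewrite mul_row_block !mulmx1 mulmx0 add0r.
Qed.

Lemma scales_vol_diag1 n (s : R) : s != 0 ->
  scales_vol (block_mx (s%:M : 'M[R]_1) 0 0 (1%:M : 'M[R]_n)).
Proof.
move=> s0 A mA; rewrite det_ublock det1 mulr1 det_scalar1.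
have mA' := measurable_preimage_setT
  (measurable_mulmx (block_mx (s%:M : 'M[R]_1) 0 0 (1%:M : 'M[R]_n))) mA.
rewrite (vol_section2 mA') (vol_section2 mA).
rewrite -ge0_integralZl ?lee_fin ?invr_ge0//; last exact: measurable_vol_section2.
apply: eq_integral => y _.
rewrite -vol_scale1//; last first.
  apply: (measurable_preimage_setT _ mA).
  exact: measurable_fun_row_mx.
congr (vol _); apply/seteqP; split=> x /=;
  by rewrite mul_row_block !mulmx0 addr0 add0r mulmx1 mul_mx_scalar.
Qed.

Lemma scales_vol_diag2 n (B : 'M[R]_n) : scales_vol B ->
  scales_vol (block_mx (1%:M : 'M[R]_1) 0 0 B).
Proof.
move=> hB A mA; rewrite det_ublock det1 mul1r.
have mA' := measurable_preimage_setT
  (measurable_mulmx (block_mx (1%:M : 'M[R]_1) 0 0 B)) mA.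
rewrite (vol_section1 mA') (vol_section1 mA).
rewrite -ge0_integralZl ?lee_fin ?invr_ge0//; last exact: measurable_vol_section1.
apply: eq_integral => x _.
rewrite -hB//; last first.
  apply: (measurable_preimage_setT _ mA).
  exact: measurable_fun_row_mx.
congr (vol _); apply/seteqP; split=> y /=;
  by rewrite mul_row_block !mulmx0 addr0 add0r mulmx1.
Qed.

(** Block Gaussian elimination. With a nonzero corner [a], the matrix is a product of two shears, a
    dilation of one coordinate and the Schur complement of [a], to which induction applies. Shears
    translate the sections and so preserve volume. *)
Lemma vol_linear n (B : 'M[R]_n) : B \in unitmx -> scales_vol B.
Proof.
elim: n B => [|n IHn] B uB.
  move=> A mA; rewrite det_mx00 normr1 invr1 mul1e; congr (vol _).
  by apply/seteqP; split=> x /=; rewrite [x]thinmx0 mul0mx.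
have pivot (a : R) (r : 'rV[R]_n) (c : 'cV[R]_n) (D : 'M[R]_n) : a != 0 ->
    block_mx a%:M r c D \in unitmx -> scales_vol (block_mx a%:M r c D : 'M[R]_(1 + n)).
  move=> a0.
  have -> : block_mx a%:M r c D = block_mx (1%:M : 'M[R]_1) 0 (a^-1 *: c) 1%:M *m
     block_mx (a%:M : 'M[R]_1) 0 0 1%:M *m
     block_mx (1%:M : 'M[R]_1) 0 0 (D - (a^-1 *: c) *m r) *m
     block_mx (1%:M : 'M[R]_1) (a^-1 *: r) 0 1%:M.
    rewrite !mulmx_block !(mulmx0, mul0mx, mulmx1, mul1mx, addr0, add0r).
    rewrite !mul_mx_scalar !mul_scalar_mx !scalerA divff// !scale1r -scalemxAr.
    by rewrite -scalemxAl [_ + (D - _)]addrC subrK.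
  rewrite unitmxE !det_mulmx unitfE !mulf_eq0 !negb_or => /andP[/andP[_ uD] _].
  apply: scales_volM; last exact: scales_vol_ublock.
  apply: scales_volM; last first.
    apply: scales_vol_diag2; apply: IHn.
    by move: uD; rewrite det_ublock det1 mul1r unitmxE unitfE.
  by apply: scales_volM; [exact: scales_vol_lblock|exact: scales_vol_diag1].
rewrite -[B](@submxK _ 1 n 1 n) in uB *.
move: uB; set a := ulsubmx _; set r := ursubmx _; set c := dlsubmx _; set D := drsubmx _.
rewrite [a]mx11_scalar; set s := a 0 0 => uB.
have [s0|s0] := eqVneq s 0; last exact: pivot.
have [j rj] : exists j, r 0 j != 0.
  apply/existsP; apply/contraT; rewrite negb_exists => /forallP h.
  have r0 : r = 0.
    by apply/rowP => j; rewrite [RHS]mxE; apply/eqP; have := h j; rewrite negbK.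
  have : \det (block_mx s%:M r c D : 'M[R]_(1 + n)) != 0 by rewrite -unitfE -unitmxE.
  by rewrite r0 (@det_lblock _ 1 n) det_scalar1 s0 mul0r eqxx.
pose u : 'cV[R]_n := delta_mx j 0.
have uu : block_mx (1%:M : 'M[R]_1) 0 u 1%:M *m block_mx (1%:M : 'M[R]_1) 0 (-
  u) 1%:M = 1%:M.
  rewrite mulmx_block !(mulmx0, mul0mx, mulmx1, mul1mx, addr0, add0r) subrr.
  by rewrite -scalar_mx_block.
rewrite -[X in scales_vol X]mulmx1 -uu mulmxA.
apply: scales_volM; last exact: scales_vol_lblock.
have uM : block_mx s%:M r c D *m block_mx (1%:M : 'M[R]_1) 0 u 1%:M \in unitmx.
  by rewrite unitmx_mul uB /= unitmxE det_lblock !det1 mulr1 unitr1.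
move: uM; rewrite mulmx_block !(mulmx0, mul0mx, mulmx1, mul1mx, addr0, add0r).
rewrite s0 raddf0 add0r [r *m u]mx11_scalar; apply: pivot.
by rewrite -colE mxE.
Qed.

Lemma vol_scale n (s : R) (A : set 'rV[R]_n) : 0 < s -> measurable A ->
  vol [set x | A (s *: x)] = ((s ^+ n)^-1%:E * vol A)%E.
Proof.
move=> s0 mA; have := @vol_linear n s%:M _ A mA.
under [X in vol X]eq_set do rewrite mul_mx_scalar.
rewrite det_scalar normrX gtr0_norm// => ->//.
by rewrite unitmxE det_scalar unitfE expf_neq0// gt_eqF.
Qed.

End vol_sections.

(** * The volumes of a simplex and of an orthant of a ball *)

Section measurable_sets.
Variables (R : realType) (d : measure_display) (T : measurableType d).

Lemma measurable_le_set (f g : T -> R) :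
  measurable_fun setT f -> measurable_fun setT g ->
  measurable [set x | f x <= g x].
Proof.
move=> mf mg; have := measurable_fun_ler mf mg measurableT (Y := [set true]) I.
by rewrite setTI.
Qed.

Lemma measurable_lt_set (f g : T -> R) :
  measurable_fun setT f -> measurable_fun setT g ->
  measurable [set x | f x < g x].
Proof.
move=> mf mg; have := measurable_fun_ltr mf mg measurableT (Y := [set true]) I.
by rewrite setTI.
Qed.

Lemma measurable_forall n (P : 'I_n -> set T) :
  (forall i, measurable (P i)) -> measurable [set x | forall i, P i x].
Proof.
move=> mP; rewrite (_ : [set x | _] = \bigcap_(i in [set: 'I_n]) P i).
  exact: fin_bigcap_measurable.
by apply/seteqP; split=> x h i //; exact: h.
Qed.

End measurable_sets.

Section measurable_coords.
Variables (R : realType) (n : nat).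

Lemma measurable_sum_coord :
  measurable_fun setT (fun x : 'rV[R]_n => \sum_i x 0 i).
Proof. by apply: measurable_sum => i; exact: measurable_coord. Qed.

Lemma measurable_sumsq_coord :
  measurable_fun setT (fun x : 'rV[R]_n => \sum_i x 0 i ^+ 2).
Proof.
by apply: measurable_sum => i; apply: measurable_funX; exact: measurable_coord.
Qed.

Lemma measurable_ge0_coord :
  measurable [set x : 'rV[R]_n | forall i, 0 <= x 0 i].
Proof.
apply: measurable_forall => i; apply: measurable_le_set => //.
exact: measurable_coord.
Qed.

Lemma measurable_gt0_coord :
  measurable [set x : 'rV[R]_n | forall i, 0 < x 0 i].
Proof.
apply: measurable_forall => i; apply: measurable_lt_set => //.
exact: measurable_coord.
Qed.

End measurable_coords.

Section cons_row_coords.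
Variable R : realType.

Lemma cons_row0 n (x : R) (y : 'rV[R]_n) : cons_row (x, y) 0 ord0 = x.
Proof.
rewrite /cons_row /= (_ : ord0 = lshift n (ord0 : 'I_1)); last exact/val_inj.
exact: etrans (row_mxEl (const_mx x : 'rV_1) y 0 ord0) (mxE _ _ _ _).
Qed.

Lemma cons_rowS n (x : R) (y : 'rV[R]_n) i : cons_row (x, y) 0 (lift ord0 i) = y 0 i.
Proof.
rewrite /cons_row /= (_ : lift ord0 i = rshift 1 i); last exact/val_inj.
exact: (row_mxEr (const_mx x : 'rV_1) y 0 i).
Qed.

Lemma forall_ordS n (P : 'I_n.+1 -> Prop) :
  (forall i, P i) <-> P ord0 /\ forall i, P (lift ord0 i).
Proof.
split=> [h|[h0 h] i]; first by split.
by case: (unliftP ord0 i) => [j|] ->.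
Qed.

Lemma integral_cons n (g : 'rV[R]_n.+1 -> \bar R) :
  measurable_fun setT g -> (forall x, 0 <= g x)%E ->
  (\int[@vol R n.+1]_u g u =
   \int[@lebesgue_measure R]_x \int[@vol R n]_y g (cons_row (x, y)))%E.
Proof.
move=> mg g0.
pose m := measure_function_pushforward__canonical__measure_function_Measure
  (@lebesgue_measure R \x @vol R n)%E (@measurable_cons_row R n).
rewrite (@eq_measure_integral _ _ _ _ m).
  rewrite ge0_integral_pushforward//; last exact: measurable_cons_row.
  rewrite preimage_setT fubini_tonelli1//=.
    apply: measurableT_comp => //; exact: measurable_cons_row.
by move=> A mA _; exact: vol_cons.
Qed.

Lemma vol0_setT : vol [set: 'rV[R]_0] = 1%E.
Proof.
rewrite (_ : setT = box 0 0); last by apply/seteqP; split=> // x _ [].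
by rewrite vol_box// ?/box_vol ?big_ord0// => -[].
Qed.

Lemma integral_prod_coord n (h : R -> R) (c : R) :
  measurable_fun setT h -> (forall x, 0 <= h x) ->
  (\int[@lebesgue_measure R]_x (h x)%:E = c%:E)%E ->
  (\int[@vol R n]_u (\prod_i h (u 0%R i))%:E = (c ^+ n)%:E)%E.
Proof.
move=> mh h0 hc; elim: n => [|n IHn].
  under eq_integral do rewrite big_ord0.
  by rewrite integral_cst// mul1e; exact: vol0_setT.
rewrite integral_cons; last 2 first.
- apply/measurable_EFinP; apply: measurable_prod => i _.
  by apply: measurableT_comp => //; exact: measurable_coord.
- by move=> u; rewrite lee_fin prodr_ge0.
have mp : measurable_fun setT (fun y : 'rV[R]_n => (\prod_i h (y 0 i))%:E).
  apply/measurable_EFinP; apply: measurable_prod => i _.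
  by apply: measurableT_comp => //; exact: measurable_coord.
transitivity (\int[@lebesgue_measure R]_x ((h x)%:E * (c ^+ n)%:E))%E.
  apply: eq_integral => x _.
  rewrite -IHn -ge0_integralZl ?lee_fin//; last first.
    by move=> y _; rewrite lee_fin prodr_ge0.
  apply: eq_integral => y _; rewrite big_ord_recl cons_row0 EFinM.
  congr (_ * _%:E)%E; apply: eq_bigr => i _.
  exact: (congr1 h (cons_rowS x y i)).
rewrite ge0_integralZr ?hc ?lee_fin ?exprn_ge0//.
- by rewrite exprS EFinM.
- exact/measurable_EFinP.
- by move=> x _; rewrite lee_fin.
by rewrite -lee_fin -hc; apply: integral_ge0 => x _; rewrite lee_fin.
Qed.

End cons_row_coords.

Section fundamental_theorem.
Variable R : realType.

Lemma derivable_continuous (f : R -> R) :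
  (forall x, derivable f x (1 : R)) -> continuous f.
Proof.
by move=> df x; apply/differentiable_continuous; exact/derivable1_diffP.
Qed.

Lemma integral_derive (f F : R -> R) (a b : R) : a < b ->
  (forall x, is_derive x (1 : R) F (f x)) -> (forall x, derivable f x (1 : R)) ->
  (\int[@lebesgue_measure R]_(x in `[a, b]) (f x)%:E = (F b - F a)%:E)%E.
Proof.
move=> ab dF df.
have cF : continuous F by apply: derivable_continuous => x; exact: ex_derive.
rewrite (@continuous_FTC2 _ _ F)//.
- by apply: continuous_subspaceT; exact: derivable_continuous.
- split; first by move=> x _; exact: ex_derive.
  + by apply: cvg_at_right_filter; exact: cF.
  + by apply: cvg_at_left_filter; exact: cF.
- by move=> x _; rewrite derive1E; exact: derive_val.
Qed.

Lemma integral_derive_tail (f F : R -> R) (a l : R) :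
  (forall x, is_derive x (1 : R) F (f x)) -> (forall x, derivable f x (1 : R)) ->
  (forall x, 0 <= f x) -> F x @[x --> +oo] --> l ->
  (\int[@lebesgue_measure R]_(x in `[a, +oo[) (f x)%:E = (l - F a)%:E)%E.
Proof.
move=> dF df f0 Fl.
have cF : continuous F by apply: derivable_continuous => x; exact: ex_derive.
rewrite (@ge0_continuous_FTC2y _ _ F _ l)//.
- by apply: continuous_subspaceT; exact: derivable_continuous.
- by apply: cvg_at_right_filter; exact: cF.
- by move=> x _; rewrite derive1E; exact: derive_val.
Qed.

End fundamental_theorem.

Section simplex_volume.
Variable R : realType.

(** For [r = rho], the image of the regular simplex when one coordinate is forgotten. *)
Definition corner_simplex n (r : R) : set 'rV[R]_n :=
  [set p | (forall i, 0 <= p 0 i) /\ \sum_i p 0 i <= r].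

Lemma measurable_corner_simplex n r : measurable (@corner_simplex n r).
Proof.
apply: measurableI; first exact: measurable_ge0_coord.
by apply: measurable_le_set => //; exact: measurable_sum_coord.
Qed.

Lemma corner_simplex_section n (r x : R) : 
  [set y | corner_simplex r (@cons_row R n (x, y))] =
  if 0 <= x <= r then corner_simplex (r - x) else set0.
Proof.
apply/seteqP; split=> [y /=|y].
  rewrite /corner_simplex /= forall_ordS cons_row0 big_ord_recl cons_row0.
  under eq_bigr do rewrite cons_rowS.
  move=> [[x0 y0] le].
  have y0' i : 0 <= y 0 i by have := y0 i; rewrite cons_rowS.
  rewrite x0 (le_trans _ le) ?lerDl ?sumr_ge0//=.
  by split=> //; rewrite lerBrDl.
case: ifPn => // /andP[x0 xr] [y0 yr] /=.
rewrite /corner_simplex /= forall_ordS cons_row0 big_ord_recl cons_row0.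
under eq_bigr do rewrite cons_rowS.
by split; [split=> // i; rewrite cons_rowS|rewrite -lerBrDl].
Qed.

Lemma integral_simplex_section n (r : R) : 0 <= r ->
  (\int[@lebesgue_measure R]_(x in `[0%R, r]) ((r - x) ^+ n / n`!%:R)%:E =
   (r ^+ n.+1 / n.+1`!%:R)%:E)%E.
Proof.
rewrite le_eqVlt => /orP[/eqP <-|r0].
  by rewrite set_itv1 integral_set1 expr0n /= mul0r.
have dF (x : R) : is_derive x 1 (- (((cst r - id) ^+ n.+1 : R -> R) *
    cst (n.+1`!%:R)^-1 : R -> R)) ((r - x) ^+ n / n`!%:R).
  apply: is_derive_eq.
  rewrite scaler0 add0r sub0r /= /cst /= scalerN scalerN opprK.
  rewrite /GRing.scale /= mulr1 factS natrM invfM fctE /=; field.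
  by rewrite -[1]/1%:R -natrD !pnatr_eq0 -!lt0n fact_gt0.
have FE x : (- (((cst r - id) ^+ n.+1 : R -> R) * cst (n.+1`!%:R)^-1 : R -> R)) x =
    - ((r - x) ^+ n.+1 / n.+1`!%:R).
  by rewrite -[LHS]/(- ((((cst r - id) ^+ n.+1 : R -> R) x) * _)) exprfctE.
rewrite (integral_derive _ dF)//.
  by rewrite !FE subrr expr0n /= mul0r oppr0 add0r opprK addr0.
move=> x; rewrite (_ : (fun x0 => _) =
  (((cst r - id) ^+ n : R -> R) * cst (n`!%:R)^-1 : R -> R)); last first.
  by apply/funext => y; rewrite -[RHS]/((((cst r - id) ^+ n : R -> R) y) * _) exprfctE.
exact: ex_derive.
Qed.

Lemma vol_corner_simplex n (r : R) : 0 <= r ->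
  vol (@corner_simplex n r) = (r ^+ n / n`!%:R)%:E.
Proof.
elim: n r => [|n IHn] r r0.
  rewrite expr0 fact0 divr1 -vol0_setT; congr vol.
  by apply/seteqP; split=> // x _; split; [case|rewrite big_ord0].
rewrite vol_cons_section; last exact: measurable_corner_simplex.
rewrite -integral_simplex_section// [RHS]integral_mkcond.
apply: eq_integral => x _; rewrite corner_simplex_section patchE.
rewrite mem_setE in_itv /=; case: ifPn => [/andP[x0 xr]|_].
  by rewrite IHn// subr_ge0.
exact: measure0.
Qed.

End simplex_volume.

Section layer_cake.
Variable R : realType.

Lemma integral_expRN_tail (a : R) :
  (\int[@lebesgue_measure R]_(s in `[a, +oo[) (expR (- s))%:E = (expR (- a))%:E)%E.
Proof.
have dF (x : R) : is_derive x 1 (fun s : R => - expR (- s)) (expR (- x)).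
  by apply: is_derive_eq; rewrite mulrN1 opprK.
rewrite (integral_derive_tail (l := 0) _ dF).
- by rewrite sub0r opprK.
- by move=> x; exact: ex_derive.
- by move=> x; exact: expR_ge0.
- by rewrite -oppr0; apply: cvgN; exact: cvgr_expR.
Qed.

(* Tonelli for [exp (- s)] on the region [{(u, s) | u in O, g u <= s}]. *)
Lemma layer_cake_Gamma n (O : set 'rV[R]_n) (g : 'rV[R]_n -> R) (V al c : R) :
  measurable O -> measurable_fun setT g -> (forall u, O u -> 0 <= g u) ->
  (forall s, 0 <= s -> vol (O `&` [set u | g u <= s]) = (V * s `^ al)%:E) ->
  0 < c ->
  (\int[@vol R n]_(u in O) (expR (- g u))%:E = c%:E)%E ->
  V * Gamma (al + 1) = c.
Proof.
move=> mO mg g0 hV c0 hc.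
pose f (p : 'rV[R]_n * R) : \bar R :=
  (\1_[set p | O p.1 /\ g p.1 <= p.2] p * expR (- p.2))%:E.
have mS : measurable [set p : 'rV[R]_n * R | O p.1 /\ g p.1 <= p.2].
  apply: measurableI; first exact: measurable_preimage_setT measurable_fst mO.
  apply: measurable_le_set => //.
  exact: (measurableT_comp mg measurable_fst).
have f0 p : (0 <= f p)%E by rewrite lee_fin mulr_ge0// expR_ge0.
have mf : measurable_fun setT f.
  apply/measurable_EFinP; apply: measurable_funM; first exact: measurable_indic.
  apply: measurableT_comp; first exact: measurable_expR.
  by apply: measurableT_comp => //; exact: measurable_snd.
have L u : (\int[@lebesgue_measure R]_s f (u, s) = (\1_O u * expR (- g u))%:E)%E.
  rewrite EFinM -integral_expRN_tail [in RHS]integral_mkcond -ge0_integralZl//;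
    last 2 first.
  - apply/(measurable_restrictT _ _).1 => //; apply/measurable_EFinP.
    apply: measurableT_comp; first exact: measurable_expR.
    exact: measurable_funTS.
  - by move=> s _; apply: erestrict_ge0 => t _; rewrite lee_fin expR_ge0.
  apply: eq_integral => s _; rewrite /f patchE !indicE mem_setE in_itv /= andbT.
  rewrite EFinM; case: ifPn => gs; have [Ou|Ou] := pselect (O u).
  - by rewrite !mem_set.
  - by rewrite !memNset// => -[].
  - by rewrite memNset ?mul0e ?mule0// => -[]; rewrite (negPf gs).
  - by rewrite memNset ?mul0e ?mule0// => -[].
have M s : measurable (O `&` [set u | g u <= s]).
  by apply: measurableI => //; exact: measurable_le_set.
have h : (c%:E = \int[@lebesgue_measure R]_s ((expR (- s))%:E * vol (O `&` [set
  u | (g u <= s)%R])))%E.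
  transitivity (\int[@vol R n]_u \int[@lebesgue_measure R]_s f (u, s))%E.
    rewrite -hc integral_mkcond; apply: eq_integral => u _.
    by rewrite L patchE indicE; case: ifP => _; rewrite ?mul1r ?mul0r.
  rewrite fubini_tonelli//; apply: eq_integral => s _.
  have := @integral_indic _ _ _ (@vol R n) setT measurableT _ (M s).
  rewrite setIT => <-; rewrite -ge0_integralZl ?lee_fin ?expR_ge0//; last first.
    by apply/measurable_EFinP; exact: measurable_indic.
  apply: eq_integral => u _; rewrite /f -EFinM mulrC !indicE; congr (_ * _)%:E.
pose I := (\int[@lebesgue_measure R]_(s in `]0%R, +oo[) (s `^ al * expR (- s))%:E)%E.
have V0 : 0 <= V.
  have := hV 1 ler01; rewrite powR1 mulr1 => e.
  by rewrite -lee_fin -e; exact: vol_ge0.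
have hI : (c%:E = V%:E * I)%E.
  have mpe : measurable_fun setT (fun s : R => (s `^ al * expR (- s))%:E).
    apply/measurable_EFinP; apply: measurable_funM; first exact: measurable_powR.
    by apply: measurableT_comp => //; exact: measurable_expR.
  rewrite h /I integral_itv_obnd_cbnd; last exact: measurable_funTS.
  rewrite -ge0_integralZl//; last 2 first.
  - exact: measurable_funTS.
  - by move=> s _; rewrite lee_fin mulr_ge0 ?powR_ge0 ?expR_ge0.
  rewrite [RHS]integral_mkcond; apply: eq_integral => s _.
  rewrite patchE mem_setE in_itv /= andbT; case: ifPn => s0.
    by rewrite hV// -!EFinM; congr EFin; ring.
  rewrite (_ : _ `&` _ = set0) ?measure0 ?mule0//.
  apply/seteqP; split=> // u [/g0 gu /= gs]; move: s0.
  by rewrite (le_trans gu gs).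
have -> : Gamma (al + 1) = fine I.
  rewrite /Gamma /Rintegral /I; congr fine; apply: eq_integral => s _.
  by rewrite addrK.
have I0 : (0 <= I)%E.
  apply: integral_ge0 => s _; rewrite lee_fin mulr_ge0 ?powR_ge0 ?expR_ge0//.
have VI : V != 0.
  by apply/eqP => v0; move: hI; rewrite v0 mul0e => -[] c00; rewrite c00 ltxx in c0.
(* [Gamma] is the [fine] of [I], which would be 0 if [I] were infinite; this is excluded by
   [V * I = c] with [V] nonzero. *)
have If : I \is a fin_num.
  rewrite ge0_fin_numE//; case: I hI I0 => [r _ _||//]; first by rewrite ltry.
  by rewrite gt0_muley// lte_fin lt_neqAle eq_sym VI.
by apply: EFin_inj; rewrite EFinM fineK// hI.
Qed.

End layer_cake.

Section orthant_ball.
Variable R : realType.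

Lemma integral_orthant n (J : set R) (f : R -> R) (c : R) :
  measurable J -> measurable_fun setT f -> (forall x, 0 <= f x) ->
  (\int[@lebesgue_measure R]_(x in J) (f x)%:E = c%:E)%E ->
  (\int[@vol R n]_(u in [set u | forall i, J (u 0%R i)]) (\prod_i f (u 0%R i))%:E =
   (c ^+ n)%:E)%E.
Proof.
move=> mJ mf f0 fc; rewrite integral_mkcond.
rewrite -(@integral_prod_coord R n (fun x => \1_J x * f x)).
- apply: eq_integral => u _; rewrite patchE big_split/=.
  case: ifPn => [|/negP]; rewrite inE /= => uJ.
    by rewrite [X in (X * _)%:E]big1 ?mul1r// => i _; rewrite indicE mem_set.
  have /existsNP[i ui] := uJ.
  by rewrite (bigD1 i)//= indicE memNset// !mul0r.
- by apply: measurable_funM => //; exact: measurable_indic.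
- by move=> x; rewrite mulr_ge0.
rewrite -fc [RHS]integral_mkcond; apply: eq_integral => x _.
by rewrite patchE indicE; case: ifP => _; rewrite ?mul1r ?mul0r.
Qed.

Lemma integral_expRN0 :
  (\int[@lebesgue_measure R]_(x in `[0%R, +oo[) (expR (- x))%:E = 1%:E)%E.
Proof. by rewrite integral_expRN_tail oppr0 expR0. Qed.

Lemma powR_half_nat (s : R) n : 0 <= s -> s `^ (n%:R / 2) = Num.sqrt s ^+ n.
Proof. by move=> s0; rewrite mulrC powRrM powR_mulrn ?powR_ge0// powR12_sqrt. Qed.

(** The layer cake formula for the sum of the coordinates on the orthant: the sublevel sets are
    corner simplices, of volume [s ^ n / n!], and the integral of the exponential factors into
    integrals equal to 1. *)
Lemma Gamma_nat n : Gamma (n%:R + 1) = n`!%:R :> R.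
Proof.
have f0 : n`!%:R != 0 :> R by rewrite pnatr_eq0 -lt0n fact_gt0.
pose O := [set u : 'rV[R]_n | forall i, `[0, +oo[%classic (u 0 i)].
have OE : O = [set u : 'rV[R]_n | forall i, 0 <= u 0 i].
  by apply/seteqP; split=> u h i; have := h i; rewrite /= in_itv /= andbT.
have := @layer_cake_Gamma R n O (fun u => \sum_i u 0 i) (n`!%:R^-1) n%:R 1.
move=> h; apply: (mulfI (invr_neq0 f0)); rewrite h ?mulVf//; rewrite ?OE.
- exact: measurable_ge0_coord.
- exact: measurable_sum_coord.
- by move=> u u0; apply: sumr_ge0.
- move=> s s0; rewrite powR_mulrn// mulrC -vol_corner_simplex//.
- rewrite -(expr1n _ n) -(integral_orthant n _ _ _ integral_expRN0)// -?OE.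
  + apply: eq_integral => u _; congr EFin.
    by rewrite -sumrN expR_sum.
  + by apply: measurableT_comp => //; exact: measurable_expR.
Qed.

(** [s] is the square of the radius: the volume is then proportional to the power [n / 2] of [s],
    which the layer cake formula turns into [Gamma (n / 2 + 1)]. *)
Definition orthant_ball n (s : R) : set 'rV[R]_n :=
  [set u | (forall i, 0 < u 0 i) /\ \sum_i u 0 i ^+ 2 <= s].

Lemma measurable_orthant_ball n s : measurable (@orthant_ball n s).
Proof.
apply: measurableI; first exact: measurable_gt0_coord.
by apply: measurable_le_set => //; exact: measurable_sumsq_coord.
Qed.

Lemma vol_orthant_ball_lty n : (vol (@orthant_ball n 1) < +oo)%E.
Proof.
apply: le_lt_trans (@vol_box_lty R n 0 (const_mx 1)).
apply: le_vol => u [u0 u1] i; rewrite !mxE; apply/andP; split; first exact: ltW.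
rewrite -(@ler_pXn2r _ 2)// ?nnegrE ?(ltW (u0 i))// expr1n.
by apply: le_trans u1; rewrite (bigD1 i)//= lerDl sumr_ge0// => j _; rewrite sqr_ge0.
Qed.

Lemma vol_orthant_ball_scale n (s : R) : 0 < s ->
  vol (@orthant_ball n s) = ((Num.sqrt s ^+ n)%:E * vol (@orthant_ball n 1))%E.
Proof.
move=> s0; have q0 : 0 < Num.sqrt s by rewrite sqrtr_gt0.
have := @vol_scale R n (Num.sqrt s)^-1 (@orthant_ball n 1).
rewrite exprVn invrK => <-; [|by rewrite invr_gt0|exact: measurable_orthant_ball].
congr vol; apply/seteqP; split=> u [u0 us]; split=> [i|].
- by rewrite mxE mulr_gt0// invr_gt0.
- under eq_bigr do rewrite mxE exprMn.
  by rewrite -mulr_sumr exprVn sqr_sqrtr ?(ltW s0)// mulrC ler_pdivrMr ?mul1r.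
- by have := u0 i; rewrite mxE pmulr_rgt0// invr_gt0.
- move: us; under eq_bigr do rewrite mxE exprMn.
  by rewrite -mulr_sumr exprVn sqr_sqrtr ?(ltW s0)// mulrC ler_pdivrMr// mul1r.
Qed.

(** The Gaussian integral over the orthant computed twice: as a product of half-line integrals
    [sqrt pi / 2], and by layers, which are orthants of balls. *)
Lemma Gamma_orthant_ball n :
  fine (vol (@orthant_ball n 1)) * Gamma (n%:R / 2 + 1) = (Num.sqrt pi / 2) ^+ n.
Proof.
pose O := [set u : 'rV[R]_n | forall i, `]0, +oo[%classic (u 0 i)].
have OE : O = [set u : 'rV[R]_n | forall i, 0 < u 0 i].
  by apply/seteqP; split=> u h i; have := h i; rewrite /= in_itv /= andbT.
have ballE s : O `&` [set u | \sum_i u 0 i ^+ 2 <= s] = orthant_ball s by rewrite OE.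
have mO : measurable O by rewrite OE; exact: measurable_gt0_coord.
have fin : vol (@orthant_ball n 1) \is a fin_num.
  by rewrite ge0_fin_numE ?vol_orthant_ball_lty// vol_ge0.
apply: (@layer_cake_Gamma R n O (fun u => \sum_i u 0 i ^+ 2)) => //.
- exact: measurable_sumsq_coord.
- by move=> u _; apply: sumr_ge0 => i _; exact: sqr_ge0.
(* The case [s = 0] is apart: in dimension 0 the set is a point and the power of [s] is 1; in
   positive dimension the set is empty, the orthant being open. *)
- move=> s; rewrite ballE le_eqVlt => /orP[/eqP <-|s0]; last first.
    by rewrite powR_half_nat ?ltW// vol_orthant_ball_scale// EFinM fineK// muleC.
  case: n @O OE ballE mO fin => [|n] O OE ballE mO fin.
    rewrite mul0r powRr0 mulr1 fineK//; congr vol.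
    by apply/seteqP; split=> u _; split=> [[]//|]; rewrite big_ord0.
  rewrite powR0 ?mulr0; last by rewrite mulf_neq0// ?invr_neq0// pnatr_eq0.
  rewrite (_ : orthant_ball 0 = set0) ?vol_set0//.
  apply/seteqP; split=> // u [u0]; rewrite leNgt => /negP; apply.
  by rewrite big_ord_recl ltr_pwDl ?exprn_gt0// sumr_ge0// => i _; exact: sqr_ge0.
- by rewrite exprn_gt0// divr_gt0// sqrtr_gt0 pi_gt0.
have g : (\int[@lebesgue_measure R]_(x in `]0%R, +oo[) (gauss_fun x)%:E =
  (Num.sqrt pi / 2)%:E)%E.
  rewrite -integral0y_gauss integral_itv_obnd_cbnd//.
  by apply: measurable_funTS; apply/measurable_EFinP; exact: measurable_gauss_fun.
rewrite -(integral_orthant n _ _ _ g)//.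
- by apply: eq_integral => u _; congr EFin; rewrite -sumrN expR_sum.
- exact: measurable_gauss_fun.
- by move=> x; exact: gauss_fun_ge0.
Qed.

Lemma vol_orthant_ball n :
  vol (@orthant_ball n 1) = ((Num.sqrt pi / 2) ^+ n / Gamma (n%:R / 2 + 1))%:E.
Proof.
have h := Gamma_orthant_ball n.
have c0 : 0 < (Num.sqrt pi / 2) ^+ n :> R by rewrite exprn_gt0// divr_gt0//
  sqrtr_gt0 pi_gt0.
rewrite -h mulfK ?fineK ?ge0_fin_numE ?vol_orthant_ball_lty ?vol_ge0//.
by apply/eqP => g0; move: c0; rewrite -h g0 mulr0 ltxx.
Qed.

End orthant_ball.

(** * Isometric charts of the hyperplane *)

Section euclidean.
Variable R : realType.

Definition dot n (u v : 'rV[R]_n) : R := (u *m v^T) 0 0.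

Lemma dotE n (u v : 'rV[R]_n) : dot u v = \sum_i u 0 i * v 0 i.
Proof. by rewrite /dot mxE; apply: eq_bigr => i _; rewrite mxE. Qed.

Lemma dotC n (u v : 'rV[R]_n) : dot u v = dot v u.
Proof. by rewrite !dotE; apply: eq_bigr => i _; rewrite mulrC. Qed.

Lemma dotDl n (u v w : 'rV[R]_n) : dot (u + v) w = dot u w + dot v w.
Proof. by rewrite /dot mulmxDl mxE. Qed.

Lemma dotNl n (u w : 'rV[R]_n) : dot (- u) w = - dot u w.
Proof. by rewrite /dot mulNmx mxE. Qed.

Lemma dotDr n (u v w : 'rV[R]_n) : dot w (u + v) = dot w u + dot w v.
Proof. by rewrite dotC dotDl !(dotC w). Qed.

Lemma dotNr n (u w : 'rV[R]_n) : dot w (- u) = - dot w u.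
Proof. by rewrite dotC dotNl (dotC w). Qed.

Lemma sqr_l2norm n (u : 'rV[R]_n) : l2norm u ^+ 2 = dot u u.
Proof.
rewrite /l2norm sqr_sqrtr ?sumr_ge0// => [|i _]; last exact: sqr_ge0.
by rewrite dotE; apply: eq_bigr => i _; rewrite expr2.
Qed.

Lemma l2norm_ge0 n (u : 'rV[R]_n) : 0 <= l2norm u.
Proof. exact: sqrtr_ge0. Qed.

Lemma dot_eq0 n (u : 'rV[R]_n) : dot u u = 0 -> u = 0.
Proof.
rewrite dotE => /eqP; rewrite psumr_eq0; last by move=> i _; rewrite -expr2 sqr_ge0.
move=> /allP h; apply/rowP => i; rewrite mxE.
have := h i; rewrite mem_index_enum => /(_ isT) /=.
by rewrite mulf_eq0 orbb => /eqP.
Qed.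

(** By polarization [g = f - f 0] preserves inner products. The rows of [A] are the images under [g]
    of the basis vectors, and [g x - x *m A] has norm 0 because the inner products among [g x] and
    [x *m A] all equal [dot x x]. *)
Lemma isometry_affine n N (f : 'rV[R]_n -> 'rV[R]_N) :
  (forall x y, l2norm (f x - f y) = l2norm (x - y)) ->
  exists2 A : 'M[R]_(n, N), A *m A^T = 1%:M & forall x, f x = f 0 + x *m A.
Proof.
move=> iso.
have [g gE] : exists g, forall x, g x = f x - f 0 by exists (fun x => f x - f 0).
have gB x y : g x - g y = f x - f y by rewrite !gE opprB addrA subrK.
have gg x y : dot (g x - g y) (g x - g y) = dot (x - y) (x - y).
  by rewrite gB -!sqr_l2norm iso.
have g0 : g 0 = 0 by rewrite gE subrr.
have gn x : dot (g x) (g x) = dot x x.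
  by have := gg x 0; rewrite g0 !subr0.
have gd x y : dot (g x) (g y) = dot x y.
  have := gg x y; rewrite !dotDl !dotDr !dotNl !dotNr !gn (dotC (g y)) (dotC y).
  by move=> h; lra.
pose A := \matrix_(i < n, j < N) g (delta_mx 0 i) 0 j.
have rowA i : row i A = g (delta_mx 0 i) by apply/rowP => j; rewrite !mxE.
have AA : A *m A^T = 1%:M.
  apply/matrixP => i j; rewrite [RHS]mxE.
  transitivity (dot (g (delta_mx 0 i)) (g (delta_mx 0 j))).
    by rewrite dotE mxE; apply: eq_bigr => k _; rewrite !mxE.
  rewrite gd dotE (bigD1 i)//= big1 => [|k /negPf ki]; rewrite !mxE !eqxx /=.
    by rewrite mul1r addr0 eq_sym.
  by rewrite ki mul0r.
exists A => // x.
suff : g x = x *m A by move=> <-; rewrite gE addrCA subrr addr0.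
apply/eqP; rewrite -subr_eq0; apply/eqP; apply: dot_eq0.
have xA : dot (x *m A) (x *m A) = dot x x.
  by rewrite /dot trmx_mul mulmxA -(mulmxA x) AA mulmx1.
have xgA : dot (g x) (x *m A) = dot x x.
  rewrite /dot trmx_mul mulmxA.
  have -> : g x *m A^T = x; last by [].
  apply/rowP => i; transitivity (dot (g x) (g (delta_mx 0 i))).
    by rewrite dotE mxE; apply: eq_bigr => k _; rewrite !mxE.
  rewrite gd dotE (bigD1 i)//= big1 => [|k /negPf ki]; rewrite !mxE ?eqxx ?ki /=.
    by rewrite mulr1 addr0.
  by rewrite mulr0.
rewrite !dotDl !dotDr !dotNl !dotNr xA (dotC (x *m A)) xgA gn; lra.
Qed.

(** One block matrix factored into triangular ones in two ways. *)
Lemma det_rank1 n (u : 'cV[R]_n) (v : 'rV[R]_n) :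
  \det (1%:M + u *m v) = 1 + (v *m u) 0 0.
Proof.
have h1 : block_mx (1%:M : 'M[R]_1) (- v) u 1%:M =
    block_mx 1%:M 0 u 1%:M *m block_mx 1%:M (- v) 0 (1%:M + u *m v).
  rewrite mulmx_block !(mulmx0, mul0mx, mulmx1, mul1mx, addr0, add0r).
  by rewrite mulmxN addrCA addNr addr0.
have h2 : block_mx (1%:M : 'M[R]_1) (- v) u 1%:M =
    block_mx (1%:M + v *m u) (- v) 0 1%:M *m block_mx 1%:M 0 u 1%:M.
  rewrite mulmx_block !(mulmx0, mul0mx, mulmx1, mul1mx, addr0, add0r).
  by rewrite mulNmx addrK.
have : \det (block_mx (1%:M : 'M[R]_1) (- v) u 1%:M) = \det (block_mx (1%:M :
  'M[R]_1) (- v) u 1%:M) by [].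
rewrite {1}h1 h2 !det_mulmx !det_lblock !det_ublock !det1 !mulr1 !mul1r => ->.
by rewrite det_mx11 !mxE eqxx.
Qed.

End euclidean.

Section chart_volume.
Variables (R : realType) (rho : R).

(** The hyperplane as a graph over its last [n] coordinates, a fixed parametrization to which every
    chart is compared. *)
Definition hyper_lift n (y : 'rV[R]_n) : 'rV[R]_n.+1 :=
  cons_row (rho - \sum_i y 0 i, y).

Lemma hyper_liftE n (z : 'rV[R]_n.+1) : \sum_i z 0 i = rho ->
  z = hyper_lift (\row_i z 0 (lift ord0 i)).
Proof.
move=> hz; rewrite /hyper_lift; apply/rowP => i; case: (unliftP ord0 i) => [j|] ->.
  by rewrite cons_rowS mxE.
rewrite cons_row0 -hz big_ord_recl.
by under [X in _ - X]eq_bigr do rewrite mxE; rewrite addrK.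
Qed.

Lemma measurable_hyper_lift n : measurable_fun setT (@hyper_lift n).
Proof.
apply: (@measurable_fun_row_mx R 1 n); last exact: measurable_id.
apply: measurable_fun_row => i; under eq_fun do rewrite mxE.
by apply: measurable_funB => //; exact: measurable_sum_coord.
Qed.

Section chart.
Variables (n : nat) (phi : 'rV[R]_n -> 'rV[R]_n.+1).
Hypothesis phiP : isometric_chart (@simplex_space R rho n) phi.

Lemma chart_sum x : \sum_i phi x 0 i = rho.
Proof.
have [_ rg] := phiP; suff : @simplex_space R rho n (phi x) by [].
by rewrite -rg; exists x.
Qed.

Lemma chart_surj (z : 'rV[R]_n.+1) : \sum_i z 0 i = rho -> exists x, phi x = z.
Proof.
have [_ rg] := phiP => hz; have : @simplex_space R rho n z by [].
by rewrite -rg => -[x _ <-]; exists x.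
Qed.

Lemma measurable_chart : measurable_fun setT phi.
Proof.
have [A _ hA] := isometry_affine phiP.1.
rewrite (_ : phi = (fun z => z + phi 0) \o (fun x => x *m A)).
  apply: measurableT_comp; first exact: measurable_translate.
  exact: measurable_mulmx.
by apply/funext => x; rewrite [LHS]hA addrC.
Qed.

(** Let [A] be the linear part of the chart and [B] its last [n] columns. The rows of [A] sum to 0,
    so its first column is [- B *m o] with [o] the column of ones, and [A *m A^T = 1] reads
    [B (1 + o o^T) B^T = 1]. By [det_rank1] the middle factor has determinant [n + 1]. *)
Lemma chart_tail : exists v : 'rV[R]_n, exists2 B : 'M[R]_n,
  \det B ^+ 2 = n.+1%:R^-1 & forall x, phi x = hyper_lift (x *m B + v).
Proof.
have [A AA hA] := isometry_affine phiP.1.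
pose a : 'cV[R]_n := @lsubmx R n 1 n A.
pose B : 'M[R]_n := @rsubmx R n 1 n A.
have AE : A = row_mx a B by rewrite hsubmxK.
pose o : 'cV[R]_n := const_mx 1.
have sumA i : \sum_j A i j = 0.
  have := chart_sum (delta_mx 0 i); rewrite hA.
  under eq_bigr do rewrite mxE; rewrite big_split /= chart_sum.
  rewrite -rowE; under eq_bigr do rewrite mxE.
  by move=> /(canRL (addKr _)); rewrite addNr.
have aE : a = - (B *m o).
  apply/colP => i; rewrite !mxE; apply/eqP; rewrite -subr_eq0 opprK.
  apply/eqP; rewrite -[RHS](sumA i) [RHS]big_ord_recl; congr (_ + _).
    by congr (A i _); exact/val_inj.
  by apply: eq_bigr => j _; rewrite !mxE mulr1; congr (A i _); exact/val_inj.
have BB : B *m (1%:M + o *m o^T) *m B^T = 1%:M.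
  rewrite -[RHS]AA [in RHS]AE (@tr_row_mx _ n 1 n) (@mul_row_col _ n 1 n n) aE.
  rewrite linearN /= mulNmx mulmxN opprK.
  by rewrite trmx_mul mulmxDr mulmx1 mulmxDl !mulmxA addrC.
exists (\row_i phi 0 0 (lift ord0 i)), B.
  have := congr1 (fun M => \det M) BB.
  rewrite /= !det_mulmx det_tr det1 det_rank1 mxE.
  under eq_bigr do rewrite !mxE mulr1.
  rewrite sumr_const card_ord nat1r => h.
  have n0 : n.+1%:R != 0 :> R by rewrite pnatr_eq0.
  by apply: (mulIf n0); rewrite mulVf// -[RHS]h; ring.
move=> x; rewrite [LHS]hyper_liftE ?chart_sum//; congr hyper_lift.
apply/rowP => i; rewrite mxE hA !mxE addrC; congr (_ + _).
by apply: eq_bigr => j _; rewrite mxE; congr (_ * A j _); exact/val_inj.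
Qed.

Lemma vol_chart (E : set 'rV[R]_n.+1) : measurable E ->
  vol (phi @^-1` E) =
  ((Num.sqrt n.+1%:R)%:E * vol (@hyper_lift n @^-1` E))%E.
Proof.
move=> mE; have [v [B detB phiE]] := chart_tail.
have mE' : measurable (@hyper_lift n @^-1` E).
  exact: measurable_preimage_setT (@measurable_hyper_lift n) mE.
have mE'' : measurable [set y | (@hyper_lift n @^-1` E) (y + v)].
  exact: measurable_preimage_setT (@measurable_translate R n v) mE'.
have uB : B \in unitmx.
  rewrite unitmxE unitfE; apply/eqP => d0; move: detB.
  by rewrite d0 expr0n /= => /esym/eqP; rewrite invr_eq0 pnatr_eq0.
have := vol_linear uB mE''; rewrite vol_translate// => h.
transitivity (vol [set x | [set y | (@hyper_lift n @^-1` E) (y + v)] (x *m B)]).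
  by congr vol; apply/seteqP; split=> x /=; rewrite phiE.
rewrite h; congr (_%:E * _)%E.
apply/eqP; rewrite -(@eqrXn2 _ 2)// ?invr_ge0//.
by rewrite sqr_sqrtr// exprVn -normrX detB normfV invrK normr_nat.
Qed.

End chart.

(** Permuting the coordinates gives another chart; since [vol_chart] holds for every chart, each set
    of truncated coordinates can be moved to a standard position. *)
Lemma chart_perm n (phi : 'rV[R]_n -> 'rV[R]_n.+1) (s : 'S_n.+1) :
  isometric_chart (@simplex_space R rho n) phi ->
  isometric_chart (@simplex_space R rho n) (fun x => col_perm s (phi x)).
Proof.
move=> phiP; split.
  move=> x y; rewrite -phiP.1 /l2norm; congr Num.sqrt.
  rewrite [RHS](reindex_inj (@perm_inj _ s)); apply: eq_bigr => i _.
  by rewrite !mxE.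
apply/seteqP; split=> [_ [x _ <-]|z hz].
  rewrite /simplex_space /= -(chart_sum phiP x).
  rewrite [RHS](reindex_inj (@perm_inj _ s)); apply: eq_bigr => i _.
  by rewrite !mxE.
have [|x xz] := chart_surj phiP (z := col_perm s^-1 z).
  rewrite -hz [RHS](reindex_inj (@perm_inj _ s^-1%g)); apply: eq_bigr => i _.
  by rewrite !mxE.
by exists x => //; rewrite xz; apply/rowP => i; rewrite !mxE permK.
Qed.

End chart_volume.

(** * The neighborhoods of the simplex *)

Lemma measure_finite_union d (T : measurableType d) (R : realType)
    (mu : {measure set T -> \bar R}) (I : finType) (P : pred I) (F : I -> set T) :
  (forall i, measurable (F i)) ->
  (forall i j x, P i -> P j -> F i x -> F j x -> i = j) ->
  mu [set x | exists2 i, P i & F i x] = (\sum_(i | P i) mu (F i))%E.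
Proof.
move=> mF tF.
suff h (s : seq I) : uniq s -> all P s ->
    measurable [set x | exists2 i, i \in s & F i x] /\
    mu [set x | exists2 i, i \in s & F i x] = (\sum_(i <- s) mu (F i))%E.
  rewrite -big_filter -(h _ _ _).2 ?filter_uniq ?index_enum_uniq ?filter_all//.
  congr (mu _); apply/seteqP; split=> x [i Pi Fx]; exists i => //.
    by rewrite mem_filter Pi mem_index_enum.
  by move: Pi; rewrite mem_filter => /andP[].
elim: s => [_ _|a s IHs /= /andP[as_ us] /andP[Pa Ps]].
  rewrite big_nil (_ : [set x | _] = set0); first by split;
    [exact: measurable0|rewrite measure0].
  by apply/seteqP; split=> // x [].
have [ms es] := IHs us Ps.
have E : [set x | exists2 i, i \in a :: s & F i x] =
    F a `|` [set x | exists2 i, i \in s & F i x].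
  apply/seteqP; split=> [x [j] | x [Fx|[i si Fx]]].
  - by rewrite in_cons => /orP[/eqP ->|si] Fx; [left|right; exists j].
  - by exists a => //; rewrite mem_head.
  - by exists i => //; rewrite in_cons si orbT.
rewrite E big_cons -es; split; first exact: measurableU.
rewrite measureU//; apply/seteqP; split=> // x [Fax [i si Fx]].
by move: as_; rewrite (tF a i x) ?si// (allP Ps).
Qed.

Lemma perm_onto_set m (I J : {set 'I_m}) : #|I| = #|J| ->
  exists s : 'S_m, forall i, (s i \in J) = (i \in I).
Proof.
move=> IJ.
pose L (A : {set 'I_m}) := enum A ++ enum (~: A)%SET.
have memL A x : x \in L A by rewrite mem_cat !mem_enum inE orbN.
have sizeL A : size (L A) = m by rewrite size_cat -!cardE cardsC card_ord.
have uniqL A : uniq (L A).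
  rewrite cat_uniq !enum_uniq andbT; apply/hasPn => x.
  by rewrite !mem_enum inE.
(* [L A] lists [A] and then its complement. Matching the two lists position by position sends [I] to
   [J], the cardinals being equal. *)
pose f x := nth x (L J) (index x (L I)).
have indexL A x : (index x (L A) < m)%N by rewrite -[X in (_ < X)%N](sizeL A) index_mem.
have f_inj : injective f.
  move=> x y; rewrite /f (set_nth_default x y) ?sizeL// => /eqP.
  rewrite nth_uniq ?sizeL// => /eqP e.
  by rewrite -(nth_index x (memL I x)) e nth_index.
exists (perm f_inj) => x; rewrite permE /f nth_cat index_cat -cardE mem_enum.
have [xI|xI] := boolP (x \in I).
  have h : (index x (enum I) < #|J|)%N by rewrite -IJ cardE index_mem mem_enum.
  by rewrite h -mem_enum mem_nth// -cardE.
rewrite -cardE IJ ltnNge leq_addr /= addKn; apply/negbTE.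
have h : (index x (enum (~: I)%SET) < size (enum (~: J)%SET))%N.
  have : (#|~: J| = #|~: I|)%SET by have := cardsC I; have := cardsC J; lia.
  by rewrite -cardE => ->; rewrite cardE index_mem mem_enum inE.
by have := mem_nth x h; rewrite mem_enum inE.
Qed.

Section projection.
Variables (R : realType) (n : nat) (rho : R).
Hypothesis rho_gt0 : 0 < rho.
Implicit Types (x : 'rV[R]_n.+1) (I : {set 'I_n.+1}).

(* The nearest point of the simplex to [x] is [(x - lam)^+], for the [lam]
   that puts it on the hyperplane. *)
Definition excess x (lam : R) := \sum_i Num.max (x 0 i - lam) 0.

Definition level I x : R := - (\sum_(i in I) x 0 i) / (n.+1 - #|I|)%:R.

(* On the hyperplane: the [x] at distance at most [t] from the simplex for which
   [(x - lam)^+] truncates exactly the coordinates in [I]; then [lam = level I x]. *)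
Definition normal_piece (t : R) I : set 'rV[R]_n.+1 :=
  [set x : 'rV[R]_n.+1 | [/\ forall i, i \in I -> x 0 i < level I x,
             forall i, i \notin I -> level I x <= x 0 i &
             \sum_(i in I) x 0 i ^+ 2 + (n.+1 - #|I|)%:R * level I x ^+ 2 <= t ^+ 2]].

Lemma card_proper I : I != [set: 'I_n.+1]%SET -> (#|I| < n.+1)%N.
Proof.
move=> h; rewrite -[X in (_ < X)%N]card_ord -cardsT proper_card//.
by rewrite properT.
Qed.

Lemma card_compl_neq0 I : I != [set: 'I_n.+1]%SET -> (n.+1 - #|I|)%:R != 0 :> R.
Proof. by move=> /card_proper h; rewrite pnatr_eq0 -lt0n subn_gt0. Qed.

Lemma sum_notin_const I (c : R) : \sum_(i | i \notin I) c = (n.+1 - #|I|)%:R * c.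
Proof.
rewrite sumr_const mulr_natl; congr (_ *+ _).
have h : (#|I| + #|[predC I]| = n.+1)%N by rewrite cardC card_ord.
by rewrite [LHS](_ : _ = #|[predC I]|); [lia|exact: eq_card].
Qed.

Lemma level_eq I x : I != [set: 'I_n.+1]%SET ->
  (n.+1 - #|I|)%:R * level I x = - \sum_(i in I) x 0 i.
Proof. by move=> /card_compl_neq0 h; rewrite /level mulrC divfK. Qed.

Lemma excess_level I x : I != [set: 'I_n.+1]%SET -> \sum_i x 0 i = rho ->
  (forall i, i \in I -> x 0 i < level I x) ->
  (forall i, i \notin I -> level I x <= x 0 i) ->
  excess x (level I x) = rho.
Proof.
move=> IT hx h1 h2; rewrite /excess (bigID (mem I))/= big1 ?add0r; last first.
  by move=> i /h1 hi; rewrite max_r// subr_le0 ltW.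
rewrite (eq_bigr (fun i => x 0 i - level I x)); last first.
  by move=> i /h2 hi; rewrite max_l// subr_ge0.
rewrite sumrB sum_notin_const level_eq// opprK -hx [RHS](bigID (mem I))/=.
by rewrite addrC.
Qed.

(** The excess decreases in [lam], and strictly so where it is positive: [rho > 0] provides a
    coordinate above the larger of the two values. *)
Lemma excess_inj x a b : excess x a = rho -> excess x b = rho -> a = b.
Proof.
wlog ab : a b / a < b.
  move=> h ha hb; case: (ltgtP a b) => // ab; first exact: h.
  by apply/esym/h.
move=> ha hb; exfalso.
suff : excess x b < excess x a by rewrite ha hb ltxx.
have [i xi] : exists i, b < x 0 i.
  apply/existsP; apply/contraT; rewrite negb_exists => /forallP h.
  have : excess x b = 0.
    by rewrite /excess big1// => i _; rewrite max_r// subr_le0 leNgt h.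
  by rewrite hb => /eqP; rewrite gt_eqF.
rewrite /excess (bigD1 i)//= [ltRHS](bigD1 i)//= ltr_leD//.
  by rewrite !max_l ?subr_ge0 1?ltW// ?ltrD2l ?ltrN2// (lt_trans ab).
apply: ler_sum => j _; rewrite ge_max !le_max lexx orbT andbT; apply/orP; left.
by rewrite lerD2l lerN2 ltW.
Qed.

(** Both levels make the excess equal to [rho], hence agree, and each index set consists of the
    coordinates below the common level. *)
Lemma normal_piece_disjoint t I J x :
  I != [set: 'I_n.+1]%SET -> J != [set: 'I_n.+1]%SET -> \sum_i x 0 i = rho ->
  normal_piece t I x -> normal_piece t J x -> I = J.
Proof.
move=> IT JT hx [I1 I2 _] [J1 J2 _].
have e : level I x = level J x.
  by apply: (@excess_inj x); apply: excess_level.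
apply/setP => i; apply/idP/idP => h.
  by apply/contraT => /J2; rewrite -e leNgt I1.
by apply/contraT => /I2; rewrite e leNgt J1.
Qed.

Lemma excess_exists x : \sum_i x 0 i = rho -> exists lam, excess x lam = rho.
Proof.
move=> hx.
pose M := \sum_i `|x 0 i|.
have M0 : 0 <= M by apply: sumr_ge0.
have xM i : x 0 i <= M.
  by apply: le_trans (ler_norm _) _; rewrite /M (bigD1 i)//= lerDl sumr_ge0.
(* At 0 the excess is at least the sum of the coordinates, which is [rho]; at [M], an upper bound of
   all coordinates, it vanishes. *)
have [|||lam _ <-] := @IVT R (excess x) 0 M rho; last by exists lam.
- exact: M0.
- apply: continuous_subspaceT => lam; rewrite /excess.
  apply: (@continuous_big _ _ +%R) => [|i _]; first exact: add_continuous.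
  move=> mu; apply: (@continuous_max _ _ (fun l : R => x 0 i - l) (cst 0)).
    by apply: cvgB; [exact: cvg_cst|exact: cvg_id].
  exact: cvg_cst.
- have -> : excess x M = 0.
    by rewrite /excess big1// => i _; rewrite max_r// subr_le0.
  have h : rho <= excess x 0.
    by rewrite -hx; apply: ler_sum => i _; rewrite subr0 le_max lexx.
  rewrite min_r ?max_l ?(le_trans (ltW rho_gt0) h)//.
  by rewrite ltW.
Qed.

(** The variational inequality of the projection. The entries of [x - p] equal [lam] where [p] is
    positive and are at most [lam] where it is 0, hence the inner product of [x - p] and [p - k] is
    at least [lam] times the sum of the entries of [p - k], which is 0. *)
Lemma sqr_dist_ge x lam (p k : 'rV[R]_n.+1) :
  (forall i, p 0 i = Num.max (x 0 i - lam) 0) -> \sum_i p 0 i = rho ->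
  \sum_i k 0 i = rho -> (forall i, 0 <= k 0 i) ->
  \sum_i (x 0 i - p 0 i) ^+ 2 <= \sum_i (x 0 i - k 0 i) ^+ 2.
Proof.
move=> pE hp hk k0.
have cross : 0 <= \sum_i (x 0 i - p 0 i) * (p 0 i - k 0 i).
  apply: (@le_trans _ _ (\sum_i lam * (p 0 i - k 0 i))).
    by rewrite -mulr_sumr sumrB hp hk subrr mulr0.
  apply: ler_sum => i _; rewrite pE.
  have [h|h] := leP (x 0 i - lam) 0.
    rewrite subr0 sub0r !mulrN lerN2 ler_wpM2r//; lra.
  by rewrite opprB addrCA subrr addr0.
rewrite -subr_ge0 -sumrB.
rewrite (eq_bigr (fun i => (p 0 i - k 0 i) ^+ 2 + 2 * ((x 0 i - p 0 i) * (p 0 i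
  - k 0 i)))).
  by rewrite big_split/= -mulr_sumr addr_ge0 ?mulr_ge0// sumr_ge0// => i _;
    exact: sqr_ge0.
by move=> i _; ring.
Qed.

Lemma sqr_dist_piece I x lam : (forall i, i \in I -> x 0 i < lam) ->
  (forall i, i \notin I -> lam <= x 0 i) ->
  \sum_i (x 0 i - Num.max (x 0 i - lam) 0) ^+ 2 =
  \sum_(i in I) x 0 i ^+ 2 + (n.+1 - #|I|)%:R * lam ^+ 2.
Proof.
move=> h1 h2; rewrite (bigID (mem I))/= -sum_notin_const; congr (_ + _).
  by apply: eq_bigr => i /h1 hi; rewrite max_r ?subr0// subr_le0 ltW.
apply: eq_bigr => i /h2 hi; rewrite max_l ?subr_ge0//; congr (_ ^+ 2); ring.
Qed.

(** The distance to the simplex is attained at the truncation [(x - lam)^+], and the quadratic form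
    of [normal_piece] is the square of that distance ([sqr_dist_piece]). The full index set is
    excluded because truncating every coordinate would leave the sum 0 instead of [rho]. *)
Lemma neighborhood_decomposition t x : 0 < t -> \sum_i x 0 i = rho ->
  (exists2 k, regular_simplex rho k & l2norm (x - k) <= t) <->
  exists2 I, I != [set: 'I_n.+1]%SET & normal_piece t I x.
Proof.
move=> t0 hx.
have l2P (k : 'rV[R]_n.+1) : (l2norm (x - k) <= t) = (\sum_i (x 0 i - k 0 i) ^+
  2 <= t ^+ 2).
  rewrite -(@ler_pXn2r _ 2)// ?nnegrE ?l2norm_ge0 ?(ltW t0)//.
  rewrite sqr_l2norm dotE; congr (_ <= _).
  by apply: eq_bigr => i _; rewrite !mxE expr2.
split=> [[k [hk k0]]|[I IT [h1 h2 h3]]].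
  rewrite l2P => kt.
  have [lam hlam] := excess_exists hx.
  pose I := [set i | x 0 i < lam]%SET.
  have h1 i : i \in I -> x 0 i < lam by rewrite inE.
  have h2 i : i \notin I -> lam <= x 0 i by rewrite inE -leNgt.
  have IT : I != [set: 'I_n.+1]%SET.
    apply/eqP => e; have : excess x lam = 0.
      rewrite /excess big1// => i _; rewrite max_r// subr_le0 ltW// h1//.
      by rewrite e inE.
    by rewrite hlam => /eqP; rewrite gt_eqF.
  have lE : level I x = lam.
    apply: (mulfI (card_compl_neq0 IT)); rewrite level_eq//.
    have := hlam; rewrite /excess (bigID (mem I))/= big1 ?add0r; last first.
      by move=> i /h1 hi; rewrite max_r// subr_le0 ltW.
    rewrite (eq_bigr (fun i => x 0 i - lam)); last first.
      by move=> i /h2 hi; rewrite max_l// subr_ge0.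
    rewrite sumrB sum_notin_const -hx [in X in _ = X -> _](bigID (mem I))/= => e.
    lra.
  exists I => //; split; rewrite ?lE//.
  rewrite -(sqr_dist_piece h1 h2); apply: le_trans kt.
  pose p := \row_i Num.max (x 0 i - lam) 0.
  have pE i : p 0 i = Num.max (x 0 i - lam) 0 by rewrite mxE.
  under eq_bigr do rewrite -pE.
  apply: (sqr_dist_ge pE) => //.
  by rewrite -[RHS]hlam; apply: eq_bigr => i _; rewrite mxE.
exists (\row_i Num.max (x 0 i - level I x) 0).
  split; last by move=> i; rewrite mxE le_max lexx orbT.
  rewrite -[RHS](excess_level IT hx h1 h2); apply: eq_bigr => i _; rewrite mxE.
  by [].
rewrite l2P; apply: le_trans h3; rewrite -(sqr_dist_piece h1 h2).
by under eq_bigr do rewrite mxE.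
Qed.

End projection.

(** * The volume of a single piece *)

Section piece_volume.
Variables (R : realType) (k l : nat).

(** The index 0 stays outside, since [hyper_lift] eliminates that coordinate; the [l] truncated
    coordinates are then the first block of the remaining [l + k]. *)
Definition first_set : {set 'I_(l + k).+1} := [set i : 'I_(l + k).+1 | (0 < i
  <= l)%N]%SET.

Lemma first_set0 : (ord0 \in first_set) = false.
Proof. by rewrite inE. Qed.

Lemma first_setl (i : 'I_l) : lift ord0 (lshift k i) \in first_set.
Proof. by rewrite inE /= /bump /= add1n ltn_ord. Qed.

Lemma first_setr (i : 'I_k) : (lift ord0 (rshift l i) \in first_set) = false.
Proof. by rewrite inE /= /bump /= add1n; apply/negbTE; rewrite -ltnNge ltnS leq_addr. Qed.

Lemma big_first_set (T : Type) (idx : T) (op : Monoid.com_law idx)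
    (F : 'I_(l + k).+1 -> T) :
  \big[op/idx]_(i in first_set) F i = \big[op/idx]_(i < l) F (lift ord0 (lshift k i)).
Proof.
rewrite big_mkcond big_ord_recl first_set0 Monoid.mul1m big_split_ord /=.
rewrite [X in op _ X]big1 ?Monoid.mulm1 => [|i _]; last by rewrite first_setr.
by apply: eq_bigr => i _; rewrite first_setl.
Qed.

Lemma card_first_set : #|first_set| = l.
Proof. by rewrite -sum1_card big_first_set sum1_card card_ord. Qed.

Definition cone_level (w : 'rV[R]_l) : R := - (\sum_i w 0 i) / k.+1%:R.

(** The displacement from the projection to the point has the entries of [w] at the truncated
    indices and [cone_level w] at the [k + 1] others; the second condition bounds its squared
    norm. *)
Definition cone_ball (t : R) : set 'rV[R]_l :=
  [set w : 'rV[R]_l | (forall i, w 0 i < cone_level w) /\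
     \sum_i w 0 i ^+ 2 + k.+1%:R * cone_level w ^+ 2 <= t ^+ 2].

Lemma measurable_cone_level : measurable_fun setT cone_level.
Proof.
apply: measurable_funM => //; apply: measurableT_comp => //.
exact: measurable_sum_coord.
Qed.

Lemma measurable_cone_ball t : measurable (cone_ball t).
Proof.
apply: measurableI.
  apply: measurable_forall => i; apply: measurable_lt_set.
    exact: measurable_coord.
  exact: measurable_cone_level.
apply: measurable_le_set => //; apply: measurable_funD.
  exact: measurable_sumsq_coord.
by apply: measurable_funM => //; apply: measurable_funX; exact: measurable_cone_level.
Qed.

Lemma vol_cone_ball_le : (vol (cone_ball 1) <= (2 ^+ l)%:E)%E.
Proof.
apply: (@le_trans _ _ (vol (box (const_mx (-1) : 'rV[R]_l) (const_mx 1)))).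
  apply: le_vol => w [_ h] i; rewrite !mxE -ler_norml.
  rewrite -(@ler_pXn2r _ 2)// ?nnegrE// real_normK ?num_real//.
  apply: le_trans h; rewrite (bigD1 i)//= -addrA lerDl addr_ge0 ?sumr_ge0//.
    by move=> j _; exact: sqr_ge0.
  by rewrite mulr_ge0// sqr_ge0.
rewrite vol_box; last by move=> i; rewrite !mxE; lra.
rewrite lee_fin /box_vol (eq_bigr (fun=> 2)); last by move=> i _; rewrite !mxE; lra.
by rewrite prodr_const card_ord.
Qed.

Lemma vol_cone_ball_fin : vol (cone_ball 1) \is a fin_num.
Proof. by rewrite ge0_fin_numE ?vol_ge0// (le_lt_trans vol_cone_ball_le)// ltry. Qed.

Lemma vol_cone_ball_scale t : 0 < t ->
  vol (cone_ball t) = ((t ^+ l)%:E * vol (cone_ball 1))%E.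
Proof.
move=> t0; have ti : 0 < t^-1 by rewrite invr_gt0.
rewrite -[X in X ^+ l]invrK exprVn -vol_scale//; last exact: measurable_cone_ball.
congr vol; rewrite /cone_ball.
have cl (w : 'rV[R]_l) : cone_level (t^-1 *: w) = t^-1 * cone_level w.
  rewrite /cone_level; under eq_bigr do rewrite mxE.
  by rewrite -mulr_sumr mulrA mulrN.
apply/seteqP; split=> w /=; rewrite cl => -[w1 w2]; split.
- by move=> i; rewrite mxE ltr_pM2l.
- under eq_bigr do rewrite mxE exprMn.
  rewrite -mulr_sumr exprMn mulrCA -mulrDr expr1n exprVn mulrC.
  by rewrite ler_pdivrMr ?exprn_gt0// mul1r.
- by move=> i; have := w1 i; rewrite mxE ltr_pM2l.
- move: w2; under eq_bigr do rewrite mxE exprMn.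
  rewrite -mulr_sumr exprMn mulrCA -mulrDr expr1n exprVn mulrC.
  by rewrite ler_pdivrMr ?exprn_gt0// mul1r.
Qed.

Variable rho : R.
Hypothesis rho_gt0 : 0 < rho.

(** Lowered by the level, the [k + 1] kept coordinates are nonnegative with sum [rho]. Coordinate 0
    being eliminated, its sign condition becomes the inequality on the sum in [corner_simplex]. For
    fixed [w] the section is thus a translated simplex, of constant volume. *)
Lemma normal_piece_hyper_lift t (w : 'rV[R]_l) (q : 'rV[R]_k) :
  normal_piece t first_set (hyper_lift rho (row_mx w q)) <->
  cone_ball t w /\ corner_simplex rho (q + const_mx (- cone_level w)).
Proof.
have xl i : hyper_lift rho (row_mx w q) 0 (lift ord0 (lshift k i)) = w 0 i.
  by rewrite cons_rowS row_mxEl.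
have xr i : hyper_lift rho (row_mx w q) 0 (lift ord0 (rshift l i)) = q 0 i.
  by rewrite cons_rowS row_mxEr.
have x0 : hyper_lift rho (row_mx w q) 0 ord0 = rho - (\sum_i w 0 i + \sum_i q 0 i).
  rewrite cons_row0 big_split_ord /=; congr (_ - (_ + _));
    by apply: eq_bigr => i _; rewrite ?row_mxEl ?row_mxEr.
have lE : level first_set (hyper_lift rho (row_mx w q)) = cone_level w.
  rewrite /level /cone_level big_first_set; under eq_bigr do rewrite xl.
  by rewrite card_first_set -addnS addKn.
have cE : k.+1%:R * cone_level w = - \sum_i w 0 i.
  by rewrite /cone_level mulrC divfK// pnatr_eq0.
have kE : ((l + k).+1 - l)%N = k.+1 by lia.
rewrite /normal_piece /= lE card_first_set kE big_first_set.
under [X in [/\ _, _ & X + _ <= _]]eq_bigr do rewrite xl.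
have sE : \sum_i (q + const_mx (- cone_level w)) 0 i = \sum_i q 0 i - k%:R * cone_level w.
  under eq_bigr do rewrite !mxE.
  by rewrite big_split /= sumr_const card_ord mulr_natl mulNrn.
split=> [[h1 h2 h3]|[[h1 h3] [h2 h4]]].
  split; [split=> //|split].
  - by move=> i; have := h1 _ (first_setl i); rewrite xl.
  - by move=> i; rewrite !mxE subr_ge0 -xr h2// first_setr.
  - rewrite sE; have := h2 ord0; rewrite first_set0 x0 => /(_ isT).
    by move: cE; rewrite -natr1 mulrDl mul1r => cE h; lra.
split=> // i; case: (unliftP ord0 i) => [j|] ->; rewrite ?first_set0//.
- by case: (split_ordP j) => m ->; rewrite ?first_setr// xl.
- by case: (split_ordP j) => m ->; rewrite ?first_setl// xr => _; have := h2 m;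
  rewrite !mxE subr_ge0.
- by move: h4 cE; rewrite sE x0 -natr1 mulrDl mul1r => h cE _; lra.
Qed.

Lemma measurable_normal_piece n t (I : {set 'I_n.+1}) :
  measurable (@normal_piece R n t I).
Proof.
have ms : measurable_fun setT (fun x : 'rV[R]_n.+1 => level I x).
  apply: measurable_funM => //; apply: measurableT_comp => //.
  under eq_fun do rewrite -big_enum.
  by apply: measurable_sum => i; exact: measurable_coord.
rewrite (_ : normal_piece t I =
  [set x : 'rV[R]_n.+1 | forall i, (i \in I -> x 0 i < level I x)] `&`
  [set x : 'rV[R]_n.+1 | forall i, (i \notin I -> level I x <= x 0 i)] `&`
  [set x : 'rV[R]_n.+1 | \sum_(i in I) x 0 i ^+ 2 + (n.+1 - #|I|)%:R * level I
    x ^+ 2 <= t ^+ 2]); last first.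
  by apply/seteqP; split=> x; [move=> [h1 h2 h3]|move=> [[h1 h2] h3]].
apply: measurableI; first apply: measurableI.
- apply: measurable_forall => i; have [iI|iI] := boolP (i \in I).
    rewrite (_ : (fun x : 'rV[R]_n.+1 => _) = [set x : 'rV[R]_n.+1 | x 0 i < level I x]).
      by apply: measurable_lt_set => //; exact: measurable_coord.
    by apply/seteqP; split=> x //=; exact.
  by rewrite (_ : (fun x : 'rV[R]_n.+1 => _) = setT)//; apply/seteqP; split.
- apply: measurable_forall => i; have [iI|iI] := boolP (i \notin I).
    rewrite (_ : (fun x : 'rV[R]_n.+1 => _) = [set x : 'rV[R]_n.+1 | level I x <= x 0 i]).
      by apply: measurable_le_set => //; exact: measurable_coord.
    by apply/seteqP; split=> x //=; exact.
  by rewrite (_ : (fun x : 'rV[R]_n.+1 => _) = setT)//; apply/seteqP; split.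
- apply: measurable_le_set => //; apply: measurable_funD.
    under eq_fun do rewrite -big_enum.
    by apply: measurable_sum => i; apply: measurable_funX; exact: measurable_coord.
  by apply: measurable_funM => //; exact: measurable_funX.
Qed.

Lemma vol_first_piece t :
  vol (@hyper_lift R rho (l + k) @^-1` normal_piece t first_set) =
  ((rho ^+ k / k`!%:R)%:E * vol (cone_ball t))%E.
Proof.
have mE : measurable (@hyper_lift R rho (l + k) @^-1` normal_piece t first_set).
  apply: (measurable_preimage_setT (@measurable_hyper_lift R rho _)).
  exact: measurable_normal_piece.
rewrite (vol_section1 mE) -[X in vol X]setIT -(integral_indic (@vol R l))//;
  last exact: measurable_cone_ball.
rewrite -ge0_integralZl//; last 2 first.
- by apply/measurable_EFinP; apply: measurable_indic; exact: measurable_cone_ball.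
- by rewrite lee_fin divr_ge0// exprn_ge0// ltW.
apply: eq_integral => w _; rewrite indicE.
have [cw|cw] := pselect (cone_ball t w).
  rewrite mem_set// mule1 -vol_corner_simplex ?ltW//.
  rewrite -[RHS](vol_translate (const_mx (- cone_level w)));
    last exact: measurable_corner_simplex.
  by congr vol; apply/seteqP; split=> q /= => [/normal_piece_hyper_lift[]|h]
    //; apply/normal_piece_hyper_lift.
rewrite memNset// mule0 (_ : [set y | _] = set0) ?measure0//.
by apply/seteqP; split=> // q /normal_piece_hyper_lift[].
Qed.

End piece_volume.

(** * The Steiner polynomial of the simplex *)

Section steiner.
Variables (R : realType) (rho : R).
Hypothesis rho_gt0 : 0 < rho.

Lemma normal_piece_perm n t (I J : {set 'I_n.+1}) (s : 'S_n.+1) (x : 'rV[R]_n.+1) :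
  (forall i, (s i \in J) = (i \in I)) ->
  normal_piece t I (col_perm s x) <-> normal_piece t J x.
Proof.
move=> sIJ.
have sumE (F : R -> R) : \sum_(i in I) F (col_perm s x 0 i) = \sum_(i in J) F (x 0 i).
  rewrite [RHS](reindex_inj (@perm_inj _ s)); apply: eq_big => i; first by rewrite sIJ.
  by rewrite mxE.
have cE : #|I| = #|J|.
  by rewrite -!sum1_card [RHS](reindex_inj (@perm_inj _ s));
    apply: eq_bigl => i; rewrite sIJ.
have lE : level I (col_perm s x) = level J x by rewrite /level (sumE id) cE.
rewrite /normal_piece /= lE (sumE (fun y => y ^+ 2)) cE.
split=> -[h1 h2 h3]; split=> // i hi.
- by have := h1 (s^-1%g i); rewrite -sIJ mxE permKV; exact.
- by have := h2 (s^-1%g i); rewrite -sIJ mxE permKV; exact.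
- by rewrite mxE h1// sIJ.
- by rewrite mxE h2// sIJ.
Qed.

Lemma vol_normal_piece n k l t (phi : 'rV[R]_n -> 'rV[R]_n.+1) (I : {set 'I_n.+1}) :
  n = (l + k)%N -> #|I| = l -> 0 < t ->
  isometric_chart (@simplex_space R rho n) phi ->
  vol (phi @^-1` normal_piece t I) =
  (Num.sqrt n.+1%:R * (rho ^+ k / k`!%:R) * (t ^+ l * fine (vol (@cone_ball R k
    l 1))))%:E.
Proof.
move=> nE; subst n => cI t0 phiP.
have [s sP] := perm_onto_set (etrans (card_first_set k l) (esym cI)).
rewrite (_ : phi @^-1` _ = (fun x => col_perm s (phi x)) @^-1` normal_piece t
  (first_set k l)).
  rewrite (vol_chart (chart_perm s phiP)); last exact: measurable_normal_piece.
  rewrite vol_first_piece// vol_cone_ball_scale// -(fineK (vol_cone_ball_fin R k l)).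
  by rewrite -!EFinM /=; congr EFin; ring.
by apply/seteqP; split=> x /= /(normal_piece_perm t _ sP).
Qed.

Lemma minkowski_chart n (phi : 'rV[R]_n -> 'rV[R]_n.+1) t : 0 < t ->
  isometric_chart (@simplex_space R rho n) phi ->
  minkowski_sum (phi @^-1` @regular_simplex R rho n) (@l2ball R n t) =
  [set y | exists2 I : {set 'I_n.+1}, I != [set: 'I_n.+1]%SET &
     (phi @^-1` normal_piece t I) y].
Proof.
move=> t0 phiP; apply/seteqP; split=> [_ [a aS [b bt <-]]|y].
  apply/(neighborhood_decomposition rho_gt0 t0 (chart_sum phiP _)).
  by exists (phi a) => //; rewrite phiP.1 addrAC subrr add0r.
move=> /(neighborhood_decomposition rho_gt0 t0 (chart_sum phiP _)) [p pS pt].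
have [x xp] := chart_surj phiP (proj1 pS).
exists x; first by rewrite /preimage /= xp.
exists (y - x); last by rewrite addrCA subrr addr0.
by rewrite /l2ball /= -phiP.1 xp.
Qed.

Definition steiner_coef n l : R :=
  'C(n.+1, l)%:R * (Num.sqrt n.+1%:R * (rho ^+ (n - l) / (n - l)`!%:R) *
     fine (vol (@cone_ball R (n - l) l 1))).

Lemma sum_card_sets n (f : nat -> R) :
  \sum_(I : {set 'I_n.+1} | I != [set: 'I_n.+1]%SET) f #|I| =
  \sum_(l < n.+1) 'C(n.+1, l)%:R * f l.
Proof.
rewrite (partition_big (fun I : {set 'I_n.+1} => inord #|I| : 'I_n.+1) xpredT)//=.
apply: eq_bigr => l _.
rewrite (eq_bigl (fun I : {set 'I_n.+1} => #|I| == l)); last first.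
  move=> I /=; apply/andP/eqP => [[IT /eqP <-]|e].
    by rewrite inordK// card_proper.
  split; last by rewrite e inord_val.
  by apply/eqP => h; have := ltn_ord l; rewrite -e h cardsT card_ord ltnn.
rewrite (eq_bigr (fun=> f l)); last by move=> I /eqP ->.
rewrite sumr_const mulr_natl; congr (_ *+ _).
by rewrite -[X in 'C(X, _)]card_ord -card_draws cardsE.
Qed.

Lemma vol_simplex_neighborhood n (phi : 'rV[R]_n -> 'rV[R]_n.+1) t : 0 < t ->
  isometric_chart (@simplex_space R rho n) phi ->
  vol (minkowski_sum (phi @^-1` @regular_simplex R rho n) (@l2ball R n t)) =
  ((\poly_(l < n.+1) steiner_coef n l).[t])%:E.
Proof.
move=> t0 phiP; rewrite minkowski_chart//.
rewrite (measure_finite_union (@vol R n) (P := fun I => I != [set: 'I_n.+1]%SET)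
  (F := fun I => phi @^-1` normal_piece t I)); last 2 first.
- move=> I; apply: (measurable_preimage_setT (measurable_chart phiP)).
  exact: measurable_normal_piece.
- move=> I J x IT JT; apply: (normal_piece_disjoint rho_gt0) => //.
  exact: chart_sum phiP x.
pose f l := Num.sqrt n.+1%:R * (rho ^+ (n - l) / (n - l)`!%:R) *
  (t ^+ l * fine (vol (@cone_ball R (n - l) l 1))).
rewrite (eq_bigr (fun I : {set 'I_n.+1} => (f #|I|)%:E)); last first.
  move=> I IT; apply: vol_normal_piece => //.
  by rewrite subnKC// -ltnS card_proper.
rewrite sumEFin sum_card_sets horner_poly; congr EFin.
by apply: eq_bigr => l _; rewrite /steiner_coef /f; ring.
Qed.

(** [xget] may return any Steiner polynomial [p]; its difference with [P] vanishes at 1, 2, ...,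
    [size (p - P)], more roots than its degree allows. *)
Lemma steiner_poly_simplex n (phi : 'rV[R]_n -> 'rV[R]_n.+1) :
  isometric_chart (@simplex_space R rho n) phi ->
  steiner_poly (phi @^-1` @regular_simplex R rho n) = \poly_(l < n.+1) steiner_coef n l.
Proof.
move=> phiP; set P := \poly_(l < n.+1) _.
have hP : is_steiner_poly (phi @^-1` @regular_simplex R rho n) P.
  by move=> t t0; exact: vol_simplex_neighborhood.
rewrite /steiner_poly; case: xgetP => [p _ hp|/(_ P)]; last by [].
apply/eqP; rewrite -subr_eq0; apply/eqP;
  apply: (@roots_geq_poly_eq0 _ _ [seq (i.+1%:R : R) | i <- iota 0 (size (p - P))]).
- apply/allP => _ /mapP[i _ ->]; rewrite rootE hornerD hornerN.
  have i0 : 0 < i.+1%:R :> R by rewrite ltr0n.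
  by have := hp _ i0; rewrite hP// => -[->]; rewrite subrr.
- by rewrite map_inj_uniq ?iota_uniq// => i j /eqP; rewrite eqr_nat => /eqP[].
- by rewrite size_map size_iota.
Qed.

(** Lowering all coordinates by [e] gives the simplex of parameter [rho - (n + 1) e]. The case
    [e = 0] is the volume of the simplex; [e > 0] serves for the shrunken facets. *)
Lemma vol_truncated_simplex n (phi : 'rV[R]_n -> 'rV[R]_n.+1) (e : R) :
  0 <= e -> n.+1%:R * e <= rho ->
  isometric_chart (@simplex_space R rho n) phi ->
  vol (phi @^-1` [set z | forall i, e <= z 0 i]) =
  (Num.sqrt n.+1%:R * ((rho - n.+1%:R * e) ^+ n / n`!%:R))%:E.
Proof.
move=> e0 er phiP.
have mE : measurable [set z : 'rV[R]_n.+1 | forall i, e <= z 0 i].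
  apply: measurable_forall => i; apply: measurable_le_set => //.
  exact: measurable_coord.
rewrite (vol_chart phiP mE) EFinM -vol_corner_simplex ?subr_ge0//.
congr (_ * _)%E; rewrite -[RHS](vol_translate (const_mx (- e)));
  last exact: measurable_corner_simplex.
congr vol; rewrite /corner_simplex; apply/seteqP; split=> y /=.
  rewrite forall_ordS cons_row0 => -[h0 h]; split=> [i|].
    by rewrite !mxE subr_ge0; have := h i; rewrite cons_rowS.
  under eq_bigr do rewrite !mxE.
  by rewrite sumrB sumr_const card_ord -natr1 mulrDl mul1r mulr_natl; lra.
move=> [h]; under eq_bigr do rewrite !mxE.
rewrite sumrB sumr_const card_ord -natr1 mulrDl mul1r mulr_natl => h'.
rewrite forall_ordS cons_row0; split=> [|i]; first by lra.
by rewrite cons_rowS; have := h i; rewrite !mxE subr_ge0.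
Qed.

End steiner.

(** * Hausdorff measure *)

Section hausdorff_measure.
Variable R : realType.

Lemma diam_ge (n : nat) (C : set 'rV[R]_n) x y : C x -> C y ->
  ((l2norm (x - y))%:E <= diam C)%E.
Proof. by move=> Cx Cy; apply: ereal_sup_ubound; exists x => //; exists y. Qed.

Lemma l2norm0 n : l2norm (0 : 'rV[R]_n) = 0.
Proof. by rewrite /l2norm big1 ?sqrtr0// => i _; rewrite mxE expr0n. Qed.

Lemma diam_ge0 (n : nat) (C : set 'rV[R]_n) x : C x -> (0 <= diam C)%E.
Proof. by move=> Cx; have := diam_ge Cx Cx; rewrite subrr l2norm0. Qed.

Lemma diam_le (n : nat) (C : set 'rV[R]_n) (d : R) :
  (forall x y, C x -> C y -> l2norm (x - y) <= d) -> (diam C <= d%:E)%E.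
Proof.
by move=> h; apply: ge_ereal_sup => _ [x Cx [y Cy <-]]; rewrite lee_fin h.
Qed.

Lemma diam_set0_le (n : nat) (d : R) : (diam (set0 : set 'rV[R]_n) <= d%:E)%E.
Proof. exact: diam_le. Qed.

Lemma diam_fin (n : nat) (C : set 'rV[R]_n) x (d : R) : C x -> (diam C <= d%:E)%E ->
  exists2 r, 0 <= r <= d & diam C = r%:E.
Proof.
move=> Cx; have := diam_ge0 Cx; case: (diam C) => // r r0 rd.
by exists r => //; rewrite -!lee_fin r0.
Qed.

Lemma gauge_set0 n m : hausdorff_gauge m (set0 : set 'rV[R]_n) = 0%E.
Proof. by rewrite /hausdorff_gauge eqxx. Qed.

Lemma gaugeE n m (C : set 'rV[R]_n) x : C x -> hausdorff_gauge m C = (diam C ^+ m)%E.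
Proof.
move=> Cx; rewrite /hausdorff_gauge ifF//; apply/eqP => C0.
by move: Cx; rewrite C0.
Qed.

Lemma gauge_ge0 n m (C : set 'rV[R]_n) : (0 <= hausdorff_gauge m C)%E.
Proof.
have [->|/set0P[x Cx]] := eqVneq C set0; first by rewrite gauge_set0.
by rewrite (gaugeE _ Cx) expe_ge0// (diam_ge0 Cx).
Qed.

Lemma gauge_le n m (C : set 'rV[R]_n) (d : R) : 0 <= d ->
  (diam C <= d%:E)%E -> (hausdorff_gauge m C <= (d ^+ m)%:E)%E.
Proof.
move=> d0 Cd; have [->|/set0P[x Cx]] := eqVneq C set0.
  by rewrite gauge_set0 lee_fin exprn_ge0.
have [r /andP[r0 rd] Cr] := diam_fin Cx Cd.
by rewrite (gaugeE _ Cx) Cr -EFin_expe lee_fin lerXn2r// nnegrE.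
Qed.

(** Comparing pairs of points, instead of taking [C'] to be an image, covers both Lipschitz images
    and subsets ([s = 1]). *)
Lemma gauge_scale n n' m (C : set 'rV[R]_n) (C' : set 'rV[R]_n') (s d : R) : 0 <= s ->
  (diam C <= d%:E)%E ->
  (forall x' y', C' x' -> C' y' -> exists x y,
     [/\ C x, C y & l2norm (x' - y') <= s * l2norm (x - y)]) ->
  (diam C' <= (s * d)%:E)%E /\
  (hausdorff_gauge m C' <= (s ^+ m)%:E * hausdorff_gauge m C)%E.
Proof.
move=> s0 Cd h.
have [->|/set0P[x' C'x']] := eqVneq C' set0.
  by rewrite gauge_set0 diam_set0_le mule_ge0 ?gauge_ge0// lee_fin exprn_ge0.
have [x [y [Cx _ _]]] := h x' x' C'x' C'x'.
have [r /andP[r0 rd] Cr] := diam_fin Cx Cd.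
have C'r : (diam C' <= (s * r)%:E)%E.
  apply: diam_le => u' v' Cu Cv; have [u [v [Cu' Cv' /le_trans]]] := h _ _ Cu Cv.
  by apply; rewrite ler_wpM2l// -lee_fin -Cr diam_ge.
split; first by apply: le_trans C'r _; rewrite lee_fin ler_wpM2l.
rewrite (gaugeE _ Cx) Cr -EFin_expe -EFinM -exprMn.
by apply: gauge_le => //; rewrite mulr_ge0.
Qed.

Lemma gauge_sub n m (C C' : set 'rV[R]_n) (d : R) : C' `<=` C -> (diam C <= d%:E)%E ->
  (diam C' <= d%:E)%E /\ (hausdorff_gauge m C' <= hausdorff_gauge m C)%E.
Proof.
move=> CC' Cd; have := @gauge_scale n n m C C' 1 d ler01 Cd.
rewrite mul1r expr1n mul1e; apply=> x y Cx Cy; exists x, y.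
by rewrite mul1r; split=> //; exact: CC'.
Qed.

Lemma hausdorff_pre_ge0 n m d (A : set 'rV[R]_n) : (0 <= hausdorff_pre m d A)%E.
Proof.
apply: le_ereal_inf_tmp => _ [C _ <-].
by apply: nneseries_ge0 => k _ _; exact: gauge_ge0.
Qed.

Lemma hausdorff_pre_le n m d (A : set 'rV[R]_n) : 0 < d ->
  (hausdorff_pre m d A <= hausdorff m A)%E.
Proof. by move=> d0; apply: ereal_sup_ubound; exists d. Qed.

Lemma hausdorff_le n m (A : set 'rV[R]_n) x :
  (forall d : R, 0 < d -> (hausdorff_pre m d A <= x)%E) -> (hausdorff m A <= x)%E.
Proof. by move=> h; apply: ge_ereal_sup => _ [d d0 <-]; exact: h. Qed.

Lemma hausdorff_ge0 n m (A : set 'rV[R]_n) : (0 <= hausdorff m A)%E.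
Proof. exact: le_trans (hausdorff_pre_ge0 m 1 A) (hausdorff_pre_le m A ltr01). Qed.

Lemma hausdorff_pre_esum n m d (I : countType) (D : set I) (C : I -> set 'rV[R]_n) A :
  (forall i, D i -> (diam (C i) <= d%:E)%E) -> A `<=` \bigcup_(i in D) C i ->
  (hausdorff_pre m d A <= \esum_(i in D) hausdorff_gauge m (C i))%E.
Proof.
move=> Cd cov.
pose C' k := if @pickle_inv I k is Some i then if i \in D then C i else set0 else set0.
rewrite (_ : esum _ _ = \sum_(0 <= k <oo) hausdorff_gauge m (C' k))%E.
  apply: ereal_inf_lbound; exists C' => //; split.
    move=> k; rewrite /C'; case: pickle_inv => [j|]; last exact: diam_set0_le.
    by case: ifPn => [|_]; [rewrite inE; exact: Cd|exact: diam_set0_le].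
  move=> x /cov [i Di Cix]; exists (pickle i) => //.
  by rewrite /C' pickleK_inv mem_set.
rewrite nneseries_esumT; last by move=> k; exact: gauge_ge0.
transitivity (\esum_(k in pickle @` D) hausdorff_gauge m (C' k)).
  rewrite (@reindex_esum _ _ _ D (pickle @` D) pickle).
    by apply: eq_esum => i Di; rewrite /C' pickleK_inv mem_set.
  by split=> // i j _ _; exact: (pcan_inj pickleK).
rewrite esum_mkcond; apply: eq_esum => k _; case: ifPn => // /negP kD.
rewrite /C'; case E: (@pickle_inv I k) => [i|]; last by rewrite gauge_set0.
case: ifPn => [Di|_]; last by rewrite gauge_set0.
exfalso; apply: kD; rewrite inE; exists i; first by rewrite inE in Di.
by have := @pickle_invK I k; rewrite E.
Qed.

Lemma hausdorff_pre_adherent n m d (e : R) (A : set 'rV[R]_n) : 0 < e ->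
  (hausdorff_pre m d A < +oo)%E ->
  exists C : nat -> set 'rV[R]_n, [/\ forall k, (diam (C k) <= d%:E)%E,
    A `<=` \bigcup_k C k &
    (\esum_(k in setT) hausdorff_gauge m (C k) <= hausdorff_pre m d A + e%:E)%E].
Proof.
move=> e0 Aoo.
have Af : hausdorff_pre m d A \is a fin_num by rewrite ge0_fin_numE// hausdorff_pre_ge0.
have [_ [C [Cd cov] <-] xe] := lb_ereal_inf_adherent e0 Af.
exists C; split=> //; rewrite -nneseries_esumT; first exact: ltW.
by move=> k; exact: gauge_ge0.
Qed.

Lemma le_hausdorff n m (A B : set 'rV[R]_n) : A `<=` B -> (hausdorff m A <=
  hausdorff m B)%E.
Proof.
move=> AB; apply: hausdorff_le => d d0; apply: le_trans (hausdorff_pre_le m B d0).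
apply: le_ereal_inf_tmp => _ [C [Cd cov] <-]; apply: ereal_inf_lbound.
by exists C => //; split => //; exact: subset_trans cov.
Qed.

Lemma hausdorff_sigma_subadditive n m : sigma_subadditive (fun A : set 'rV[R]_n
  => hausdorff m A).
Proof.
move=> F; apply: hausdorff_le => d d0.
apply: (@le_trans _ _ (\sum_(0 <= k <oo) hausdorff_pre m d (F k))%E); last first.
  by apply: lee_nneseries => k _ *; [exact: hausdorff_pre_ge0|exact: hausdorff_pre_le].
have [[k Fk]|Fk] := pselect (exists k, hausdorff_pre m d (F k) = +oo%E).
  by rewrite (eseries_pinfty _ _ Fk) ?leey// => j _;
    rewrite -ltNye (lt_le_trans _ (hausdorff_pre_ge0 _ _ _)).
have Foo k : (hausdorff_pre m d (F k) < +oo)%E.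
  by rewrite ltey; apply/eqP => h; apply: Fk; exists k.
apply/lee_addgt0Pr => e e0.
apply: le_trans (epsilon_trick _ _ (ltW e0)); last by move=> k; exact: hausdorff_pre_ge0.
have e2 k : 0 < e / (2 ^ k.+1)%:R by rewrite divr_gt0// ltr0n expn_gt0.
have /choice [C CP] := fun k => hausdorff_pre_adherent (e2 k) (Foo k).
apply: (le_trans (@hausdorff_pre_esum n m d (nat * nat)%type
  (setT `*`` (fun=> setT)) (fun p => C p.1 p.2) _ _ _)).
- by move=> [k j] _ /=; have [+ _ _] := CP k; exact.
- move=> x [k _ Fkx]; have [_ + _] := CP k => /(_ x Fkx) [j Dj jx].
  by exists (k, j).
rewrite -(@esum_esum _ _ _ _ _ (fun k j => hausdorff_gauge m (C k j))).
  rewrite nneseries_esumT; last first.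
    by move=> k; rewrite adde_ge0 ?hausdorff_pre_ge0// lee_fin ltW.
  by apply: le_esum => k _; have [] := CP k.
by move=> k j _ _; exact: gauge_ge0.
Qed.

Lemma hausdorff_set0 n m : hausdorff m (set0 : set 'rV[R]_n) = 0%E.
Proof.
apply/eqP; rewrite eq_le hausdorff_ge0 andbT; apply: hausdorff_le => d d0.
have := @hausdorff_pre_esum n m d nat set0 (fun=> set0) set0.
by rewrite esum_set0; apply.
Qed.

HB.instance Definition _ n m := isOuterMeasure.Build R 'rV[R]_n (@hausdorff R n m)
  (hausdorff_set0 n m) (@hausdorff_ge0 n m) (@le_hausdorff n m)
  (@hausdorff_sigma_subadditive n m).

(** Covers of mesh [d / s] are pushed to covers of mesh [d], after intersection with [E], where the
    Lipschitz bound holds. *)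
Lemma hausdorff_lipschitz a b m (f : 'rV[R]_a -> 'rV[R]_b) (E : set 'rV[R]_a) (s : R) :
  0 < s -> (forall x y, E x -> E y -> l2norm (f x - f y) <= s * l2norm (x - y)) ->
  (hausdorff m (f @` E) <= (s ^+ m)%:E * hausdorff m E)%E.
Proof.
move=> s0 fs; apply: hausdorff_le => d d0.
have ds : 0 < d / s by rewrite divr_gt0.
apply: (@le_trans _ _ ((s ^+ m)%:E * hausdorff_pre m (d / s) E)%E); last first.
  by apply: lee_wpmul2l; [rewrite lee_fin exprn_ge0// ltW|exact: hausdorff_pre_le].
rewrite -lee_pdivrMl ?exprn_gt0//.
apply: le_ereal_inf_tmp => _ [C [Cd cov] <-].
rewrite lee_pdivrMl ?exprn_gt0// -nneseriesZl; last by move=> k _; exact: gauge_ge0.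
have hC k := @gauge_scale a b m (C k) (f @` (C k `&` E)) s (d / s) (ltW s0) (Cd k).
have {}hC k : (diam (f @` (C k `&` E)) <= d%:E)%E /\
    (hausdorff_gauge m (f @` (C k `&` E)) <= (s ^+ m)%:E * hausdorff_gauge m (C k))%E.
  have := hC k; rewrite mulrC divfK ?gt_eqF//; apply=> _ _ [x [Cx Ex] <-] [y [Cy Ey] <-].
  by exists x, y; split=> //; exact: fs.
apply: (@le_trans _ _ (\sum_(0 <= k <oo) hausdorff_gauge m (f @` (C k `&` E)))%E).
  apply: ereal_inf_lbound; exists (fun k => f @` (C k `&` E)) => //; split.
    by move=> k; exact: (hC k).1.
  by move=> _ [x Ex <-]; have [k _ Ckx] := cov x Ex; exists k => //; exists x.
apply: lee_nneseries => k _ *; first exact: gauge_ge0.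
exact: (hC k).2.
Qed.

Lemma l2norm_eq0 n (u : 'rV[R]_n) : l2norm u = 0 -> u = 0.
Proof. by move=> h; apply: dot_eq0; rewrite -sqr_l2norm h expr0n. Qed.

Lemma hausdorff_isometry a b m (f : 'rV[R]_a -> 'rV[R]_b) (E : set 'rV[R]_a) :
  (forall x y, E x -> E y -> l2norm (f x - f y) = l2norm (x - y)) ->
  hausdorff m (f @` E) = hausdorff m E.
Proof.
move=> fE; apply/eqP; rewrite eq_le; apply/andP; split.
  have := @hausdorff_lipschitz a b m f E 1 ltr01; rewrite expr1n mul1e; apply.
  by move=> x y Ex Ey; rewrite mul1r fE.
(* The inverse of [f] on the image of [E], with an arbitrary value elsewhere; [f] is injective on
   [E] because it preserves distances. *)
pose g z : 'rV[R]_a := if pselect (exists2 x, E x & f x = z) is left h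
  then projT1 (cid2 h) else 0.
have gf x : E x -> g (f x) = x.
  move=> Ex; rewrite /g; case: pselect => [h|[]]; last by exists x.
  case: cid2 => y Ey fy /=; apply/eqP; rewrite -subr_eq0; apply/eqP.
  by apply: l2norm_eq0; rewrite -fE// fy subrr l2norm0.
have := @hausdorff_lipschitz b a m g (f @` E) 1 ltr01; rewrite expr1n mul1e => h.
suff Eg : E = g @` (f @` E).
  rewrite {1}Eg; apply: h => _ _ [x Ex <-] [y Ey <-].
  by rewrite mul1r !gf// fE.
apply/seteqP; split=> [x Ex|_ [_ [x Ex <-] <-]]; last by rewrite gf.
by exists (f x); [exists x|exact: gf].
Qed.

Lemma coord_le_l2norm n (u : 'rV[R]_n) i : `|u 0 i| <= l2norm u.
Proof.
rewrite -(@ler_pXn2r _ 2)// ?nnegrE ?l2norm_ge0// real_normK ?num_real//.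
rewrite sqr_sqrtr ?sumr_ge0// => [|j _]; last exact: sqr_ge0.
by rewrite (bigD1 i)//= lerDl sumr_ge0// => j _; exact: sqr_ge0.
Qed.

(** A set of diameter [r] lies in a cube of side [2 r]. The crude constant suffices, as the purpose
    is the positivity of the Hausdorff measure of the unit cube. *)
Lemma vol_le_hausdorff n (A : set 'rV[R]_n) :
  (vol A <= (2 ^+ n)%:E * hausdorff n A)%E.
Proof.
apply: (@le_trans _ _ ((2 ^+ n)%:E * hausdorff_pre n 1 A)%E); last first.
  by rewrite lee_wpmul2l// ?lee_fin ?exprn_ge0//; exact: hausdorff_pre_le.
rewrite -lee_pdivrMl ?exprn_gt0//.
apply: le_ereal_inf_tmp => _ [C [Cd cov] <-].
rewrite lee_pdivrMl ?exprn_gt0// -nneseriesZl; last by move=> k _; exact: gauge_ge0.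
apply: (le_trans (le_vol cov)); apply: (le_trans (vol_sigma_subadditive _)).
apply: lee_nneseries => k *; first exact: vol_ge0.
have [->|/set0P[x Cx]] := eqVneq (C k) set0.
  by rewrite gauge_set0 mule0 vol_set0.
have [r /andP[r0 r1] Cr] := diam_fin Cx (Cd k).
rewrite (gaugeE _ Cx) Cr -EFin_expe -EFinM -exprMn.
apply: (@le_trans _ _ (vol (box (x - const_mx r) (x + const_mx r)))).
  apply: le_vol => y Cy i; rewrite !mxE lerBlDr -lerBlDl andbC -lerBlDl.
  have : `|(y - x) 0 i| <= r.
    by apply: le_trans (coord_le_l2norm _ _) _; rewrite -lee_fin -Cr diam_ge.
  by rewrite !mxE ler_norml => /andP[h1 h2]; apply/andP; split; lra.
rewrite vol_box; last by move=> i; rewrite !mxE; lra.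
rewrite lee_fin /box_vol (eq_bigr (fun=> 2 * r)); last by move=> i _; rewrite !mxE; lra.
by rewrite prodr_const card_ord.
Qed.

End hausdorff_measure.

(** * Hausdorff measure and volume in full dimension *)

Section hausdorff_lebesgue.
Variables (R : realType) (m : nat).
Implicit Types (a b : 'rV[R]_m).

(** Enough intervals of length [s] to cover side [i], at least one even when the side is a point;
    they exceed it by at most [s]. *)
Definition grid_size (s : R) a b (i : 'I_m) : nat := (Num.trunc ((b 0 i - a 0 i) / s)).+1.

Lemma grid_cover (s : R) a b : 0 < s -> le_row a b ->
  exists v : nat -> 'rV[R]_m, box a b `<=`
    \bigcup_(k in `I_(\prod_i grid_size s a b i)) box (v k) (v k + const_mx s).
Proof.
move=> s0 ab.
(* Grid cells; the functions are dependent because the number of intervals varies with the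
   coordinate. *)
pose I : finType := {dffun forall i : 'I_m, 'I_(grid_size s a b i)}.
have cI : #|I| = (\prod_i grid_size s a b i)%N.
  by rewrite card_dep_ffun foldrE big_map big_enum /=; apply: eq_bigr => i _;
    rewrite card_ord.
pose v (f : I) : 'rV[R]_m := a + s *: \row_i (f i)%:R.
exists (fun k => if (insub k : option 'I_#|I|) is Some j then v (enum_val j) else 0).
rewrite -cI => x xab.
have h i : (Num.trunc ((x 0%R i - a 0%R i) / s) < grid_size s a b i)%N.
  rewrite ltnS; apply: le_truncn; rewrite ler_pM2r ?invr_gt0// lerD2r.
  by have /andP[] := xab i.
pose f : I := [ffun i => Ordinal (h i)].
exists (enum_rank f) => /=; first exact: ltn_ord.
rewrite valK enum_rankK => i; rewrite !mxE ffunE /=.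
have /andP[ax xb] := xab i.
have q0 : 0 <= (x 0 i - a 0 i) / s by rewrite divr_ge0 ?subr_ge0// ltW.
have /andP[h1 h2] := truncn_itv q0.
move: h1; rewrite ler_pdivlMr// => h1.
move: h2; rewrite ltr_pdivrMr// -natr1 mulrDl mul1r => h2.
apply/andP; split; first by rewrite -lerBrDl mulrC.
by rewrite -addrA -lerBlDl mulrC ltW.
Qed.

Lemma l2norm_box_le (a : 'rV[R]_m) (s : R) x y : 0 <= s ->
  box a (a + const_mx s) x -> box a (a + const_mx s) y ->
  l2norm (x - y) <= Num.sqrt m%:R * s.
Proof.
move=> s0 xs ys.
rewrite -(@ler_pXn2r _ 2)// ?nnegrE ?l2norm_ge0 ?mulr_ge0 ?sqrtr_ge0//.
rewrite sqr_l2norm dotE exprMn sqr_sqrtr//.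
apply: (@le_trans _ _ (\sum_(i < m) s ^+ 2)); last first.
  by rewrite sumr_const card_ord mulr_natl.
apply: ler_sum => i _; rewrite !mxE -expr2 -[X in X <= _]real_normK ?num_real//.
rewrite ler_pXn2r ?nnegrE// ler_norml.
by have := xs i; have := ys i; rewrite !mxE => /andP[h1 h2] /andP[h3 h4]; lra.
Qed.

Definition unit_cube : set 'rV[R]_m := box 0 (const_mx 1).

Lemma grid_size_le (s : R) a b i : 0 < s -> le_row a b ->
  s * (grid_size s a b i)%:R <= b 0 i - a 0 i + s.
Proof.
move=> s0 ab; rewrite /grid_size -natr1 mulrDr mulr1 lerD2r mulrC -ler_pdivlMr//.
have q0 : 0 <= (b 0 i - a 0 i) / s by rewrite divr_ge0 ?subr_ge0// ltW.
by have /andP[] := truncn_itv q0.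
Qed.

(** A grid of step [s = 1 / (N + 1)] has cells of diameter at most [sqrt m * s]. The total length of
    its intervals along each axis is at most [1 + s <= 2], hence the 2, which is independent of the
    mesh. *)
Lemma hausdorff_unit_cube_le :
  (hausdorff m unit_cube <= (((Num.sqrt m%:R) * 2) ^+ m)%:E)%E.
Proof.
apply: hausdorff_le => d d0.
have [N Nd] : exists N : nat, Num.sqrt m%:R * N.+1%:R^-1 <= d.
  exists (Num.trunc (Num.sqrt m%:R / d)).
  by rewrite ler_pdivrMr// mulrC -ler_pdivrMr// ltW// truncnS_gt.
pose s : R := N.+1%:R^-1.
have s0 : 0 < s by rewrite invr_gt0.
have l01 : le_row (0 : 'rV[R]_m) (const_mx 1) by move=> i; rewrite !mxE.
have [v cov] := grid_cover s0 l01.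
set M := (\prod_i _)%N in cov.
have dv k : (diam (box (v k) (v k + const_mx s)) <= (Num.sqrt m%:R * s)%:E)%E.
  by apply: diam_le => x y; apply: l2norm_box_le; exact: ltW.
apply: (le_trans (@hausdorff_pre_esum R m m d nat `I_M (fun i => box (v i) (v i
  + const_mx s)) _ _ _)) => //.
  by move=> i _; apply: le_trans (dv i) _; rewrite lee_fin.
rewrite esum_fset//; last by move=> i _; exact: gauge_ge0.
rewrite -fsbig_ord.
have sm0 : 0 <= Num.sqrt m%:R * s by rewrite mulr_ge0 ?sqrtr_ge0// ltW.
apply: (@le_trans _ _ (\sum_(i < M) ((Num.sqrt m%:R * s) ^+ m)%:E)%E).
  by apply: lee_sum => i _; apply: gauge_le.
rewrite sumEFin lee_fin sumr_const card_ord -[X in X <= _]mulr_natl /M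
  natr_prod !exprMn mulrCA.
rewrite ler_wpM2l ?exprn_ge0 ?sqrtr_ge0// -[X in s ^+ X]card_ord -[X in 2 ^+ X]card_ord.
rewrite -!prodr_const -big_split /=; apply: ler_prod => i _.
rewrite mulr_ge0 ?ler0n ?(ltW s0)//= mulrC.
apply: (le_trans (grid_size_le i s0 l01)); rewrite !mxE subr0.
have : s <= 1 by rewrite invf_le1// ler1n.
lra.
Qed.

Lemma vol_unit_cube : vol unit_cube = 1%E.
Proof.
rewrite vol_box; last by move=> i; rewrite !mxE.
by rewrite /box_vol big1// => i _; rewrite !mxE subr0.
Qed.

(** The normalizing constant of [mvol]. It is bounded above and below but never evaluated, and
    cancels in the surface area. *)
Definition cube_hausdorff : R := fine (hausdorff m unit_cube).

Lemma cube_hausdorffK : hausdorff m unit_cube = cube_hausdorff%:E.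
Proof.
by rewrite /cube_hausdorff fineK// ge0_fin_numE ?hausdorff_ge0// (le_lt_trans
  hausdorff_unit_cube_le)// ltry.
Qed.

Lemma cube_hausdorff_gt0 : 0 < cube_hausdorff.
Proof.
have := vol_le_hausdorff unit_cube;
  rewrite vol_unit_cube cube_hausdorffK -EFinM lee_fin => h.
have : 0 < 2 ^+ m * cube_hausdorff by apply: lt_le_trans h.
by rewrite pmulr_rgt0// exprn_gt0.
Qed.

Lemma hausdorff_cube (v : 'rV[R]_m) (s : R) : 0 < s ->
  hausdorff m (box v (v + const_mx s)) = (s ^+ m * cube_hausdorff)%:E.
Proof.
move=> s0; have s0' := ltW s0.
have l2Z (t : R) (u : 'rV[R]_m) : 0 <= t -> l2norm (t *: u) = t * l2norm u.
  move=> t0; rewrite /l2norm; under eq_bigr do rewrite mxE exprMn.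
  by rewrite -mulr_sumr sqrtrM ?sqr_ge0// sqrtr_sqr ger0_norm.
have E1 : box v (v + const_mx s) = (fun x => v + s *: x) @` unit_cube.
  apply/seteqP; split=> [x h|_ [x h <-] i].
    exists (s^-1 *: (x - v)); last by rewrite scalerA mulfV ?gt_eqF// scale1r
      addrCA subrr addr0.
    move=> i; rewrite !mxE; have := h i; rewrite !mxE => /andP[h1 h2].
    rewrite mulr_ge0 ?invr_ge0 ?subr_ge0//= mulrC ler_pdivrMr// mul1r.
    by rewrite lerBlDl.
  have := h i; rewrite !mxE => /andP[h1 h2].
  by rewrite lerDl mulr_ge0//= lerD2l ler_piMr.
have E2 : unit_cube = (fun x => s^-1 *: (x - v)) @` box v (v + const_mx s).
  rewrite E1; apply/seteqP; split=> [x h|_ [_ [x h <-] <-]].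
    exists (v + s *: x); first by exists x.
    by rewrite addrAC subrr add0r scalerA mulVf ?gt_eqF// scale1r.
  by rewrite addrAC subrr add0r scalerA mulVf ?gt_eqF// scale1r.
apply/eqP; rewrite eq_le; apply/andP; split.
  rewrite E1 EFinM -cube_hausdorffK; apply: hausdorff_lipschitz => // x y _ _.
  by rewrite opprD addrACA subrr add0r -scalerBr l2Z.
rewrite EFinM -cube_hausdorffK -lee_pdivlMl ?exprn_gt0//.
rewrite {1}E2 -exprVn; apply: hausdorff_lipschitz => [|x y _ _];
  first by rewrite invr_gt0.
by rewrite -scalerBr opprB addrA subrK l2Z// invr_ge0.
Qed.

(** A grid of cubes of side [s], whose measure is known exactly by scaling; the overshoot of each
    side by at most [s] disappears in the limit taken in [hausdorff_box_le]. *)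
Lemma hausdorff_box_le_approx a b (s : R) : 0 < s -> le_row a b ->
  (hausdorff m (box a b) <= (cube_hausdorff * \prod_i (b 0 i - a 0 i + s))%:E)%E.
Proof.
move=> s0 ab; have [v cov] := grid_cover s0 ab.
set M := (\prod_i _)%N in cov.
apply: (le_trans (le_hausdorff m cov)).
rewrite bigcup_mkord.
apply: (le_trans (outer_measure_subadditive (@hausdorff R m m) (fun k => box (v
  k) (v k + const_mx s)) M)).
rewrite (eq_bigr (fun=> (s ^+ m * cube_hausdorff)%:E)) => [|k _];
  last exact: hausdorff_cube.
rewrite sumEFin lee_fin sumr_const card_ord -mulr_natl mulrCA mulrA mulrC.
rewrite ler_pM2l ?cube_hausdorff_gt0// /M natr_prod.
rewrite -[X in s ^+ X]card_ord -prodr_const -big_split /=.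
apply: ler_prod => i _; rewrite mulr_ge0 ?ler0n ?(ltW s0)//=.
exact: grid_size_le.
Qed.

Lemma hausdorff_box_le a b : le_row a b ->
  (hausdorff m (box a b) <= (cube_hausdorff * box_vol a b)%:E)%E.
Proof.
move=> ab.
have hfin : hausdorff m (box a b) \is a fin_num.
  rewrite ge0_fin_numE ?hausdorff_ge0//.
  by apply: le_lt_trans (hausdorff_box_le_approx ltr01 ab) _; rewrite ltry.
rewrite -(fineK hfin) lee_fin.
have cv : (fun k : nat => cube_hausdorff * \prod_i (b 0 i - a 0 i + harmonic
  k)) @ \oo --> cube_hausdorff * box_vol a b.
  apply: cvgM; first exact: cvg_cst.
  apply: (@cvg_big R 'I_m ( *%R) 1 xpredT (@mul_continuous R)) => i _.
  rewrite -[X in _ --> X]addr0; apply: cvgD; first exact: cvg_cst.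
  exact: cvg_harmonic.
apply: (cvgr_to_ge cv); apply: nearW => k.
by rewrite -lee_fin fineK// hausdorff_box_le_approx// /harmonic invr_gt0.
Qed.

Lemma hausdorff_le_vol (A : set 'rV[R]_m) :
  (hausdorff m A <= cube_hausdorff%:E * vol A)%E.
Proof.
have c0 := cube_hausdorff_gt0.
rewrite -lee_pdivrMl//; apply: le_ereal_inf_tmp => _ [D [a [b [ab cov ->]]]].
rewrite lee_pdivrMl//.
pose F k := if k \in D then box (a k) (b k) else set0.
have AF : A `<=` \bigcup_k F k.
  by move=> x /cov [k Dk kx]; exists k => //; rewrite /F mem_set.
apply: (le_trans (le_hausdorff m AF));
  apply: (le_trans (hausdorff_sigma_subadditive m F)).
rewrite [X in (_ <= _ * X)%E]esum_mkcond -nneseries_esumT; last first.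
  by move=> k; case: ifP => // _; rewrite lee_fin box_vol_ge0.
rewrite -nneseriesZl; last first.
  by move=> k _; case: ifP => // _; rewrite lee_fin box_vol_ge0.
apply: lee_nneseries => k *; first exact: hausdorff_ge0.
rewrite /F; case: ifP => _; last by rewrite hausdorff_set0 mule0.
by rewrite -EFinM hausdorff_box_le.
Qed.

(* The inequality [hausdorff_le_vol] for the complement of [A] in a cube, where
   equality holds, gives the reverse inequality for [A]. *)
Lemma hausdorff_eq_vol (A : set 'rV[R]_m) (v : 'rV[R]_m) (s : R) :
  measurable A -> 0 < s -> A `<=` box v (v + const_mx s) ->
  hausdorff m A = (cube_hausdorff%:E * vol A)%E.
Proof.
move=> mA s0 As; set Q := box _ _ in As.
have mQ : measurable Q by exact: measurable_box.
have volQ : vol Q = (s ^+ m)%:E.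
  rewrite vol_box; last by move=> i; rewrite !mxE lerDl ltW.
  rewrite /box_vol (eq_bigr (fun=> s)); last by move=> i _;
    rewrite !mxE addrAC subrr add0r.
  by rewrite prodr_const card_ord.
apply/eqP; rewrite eq_le hausdorff_le_vol /=.
have fA : vol A \is a fin_num.
  by rewrite ge0_fin_numE ?vol_ge0// (le_lt_trans (le_vol As))// volQ ltry.
have fD : vol (Q `\` A) \is a fin_num.
  by rewrite ge0_fin_numE ?vol_ge0// (le_lt_trans (le_vol (@subDsetl _ Q A)))// volQ ltry.
have eQ : vol Q = (vol A + vol (Q `\` A))%E.
  rewrite -measureU//; last by rewrite setDE setICA setICr setI0.
    by rewrite setDUK.
  exact: measurableD.
have hQ : (hausdorff m Q <= hausdorff m A + hausdorff m (Q `\` A))%E.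
  by rewrite -{1}(setDUK As); exact: (outer_measureU2 (@hausdorff R m m)).
have := le_trans hQ (leeD2l _ (hausdorff_le_vol (Q `\` A))).
rewrite hausdorff_cube// -/Q mulrC EFinM -volQ eQ -(fineK fA) -(fineK fD).
rewrite -EFinD -!EFinM; have := hausdorff_ge0 m A; case: (hausdorff m A) => [r _| _|] //.
  by rewrite -EFinD !lee_fin mulrDr lerD2r.
by move=> _; rewrite leey.
Qed.

End hausdorff_lebesgue.

Section separated.
Variable R : realType.

Lemma hausdorff_pre_anti n m (d d' : R) (A : set 'rV[R]_n) : d <= d' ->
  (hausdorff_pre m d' A <= hausdorff_pre m d A)%E.
Proof.
move=> dd; apply: le_ereal_inf_tmp => _ [C [Cd cov] <-]; apply: ereal_inf_lbound.
exists C => //; split=> // k; apply: le_trans (Cd k) _; by rewrite lee_fin.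
Qed.

(** A set of diameter at most [d < e] cannot meet both [A] and [B], so every admissible cover splits
    into one of [A] and one of [B]. *)
Lemma hausdorff_pre_separated n m (A B : set 'rV[R]_n) (d e : R) : d < e ->
  (forall x y, A x -> B y -> e <= l2norm (x - y)) ->
  (hausdorff_pre m d A + hausdorff_pre m d B <= hausdorff_pre m d (A `|` B))%E.
Proof.
move=> de sep; apply: le_ereal_inf_tmp => _ [C [Cd cov] <-].
have hA k := @gauge_sub R n m (C k) (C k `&` A) d (@subIsetl _ _ _) (Cd k).
have hB k := @gauge_sub R n m (C k) (C k `&` B) d (@subIsetl _ _ _) (Cd k).
apply: (@le_trans _ _ (\sum_(0 <= k <oo) hausdorff_gauge m (C k `&` A) +
                       \sum_(0 <= k <oo) hausdorff_gauge m (C k `&` B))%E).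
  apply: leeD; apply: ereal_inf_lbound.
    exists (fun k => C k `&` A) => //; split=> [k|x Ax]; first exact: (hA k).1.
    by have [k _ Ckx] := cov x (or_introl Ax); exists k.
  exists (fun k => C k `&` B) => //; split=> [k|x Bx]; first exact: (hB k).1.
  by have [k _ Ckx] := cov x (or_intror Bx); exists k.
rewrite -nneseriesD; try by move=> k *; exact: gauge_ge0.
apply: lee_nneseries => k *; first by rewrite adde_ge0// gauge_ge0.
have [->|/set0P[x [Cx Ax]]] := eqVneq (C k `&` A) set0.
  by rewrite gauge_set0 add0e; exact: (hB k).2.
have [->|/set0P[y [Cy By]]] := eqVneq (C k `&` B) set0.
  by rewrite gauge_set0 adde0; exact: (hA k).2.
have := le_trans (diam_ge Cx Cy) (Cd k); rewrite lee_fin => h.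
by have := le_lt_trans (le_trans (sep _ _ Ax By) h) de; rewrite ltxx.
Qed.

Lemma hausdorff_separatedU n m (A B : set 'rV[R]_n) (e : R) : 0 < e ->
  (forall x y, A x -> B y -> e <= l2norm (x - y)) ->
  (hausdorff m A + hausdorff m B <= hausdorff m (A `|` B))%E.
Proof.
move=> e0 sep.
have [->|foo] := eqVneq (hausdorff m (A `|` B)) +oo%E; first by rewrite leey.
have fAB : hausdorff m (A `|` B) \is a fin_num.
  by rewrite ge0_fin_numE ?hausdorff_ge0// ltey.
have fA : hausdorff m A \is a fin_num.
  rewrite ge0_fin_numE ?hausdorff_ge0// (le_lt_trans _ (_ : hausdorff m (A `|`
    B) < _)%E) ?ltey//.
  by apply: le_hausdorff => x; left.
(* Independent meshes for [A] and [B], so that the two suprema can be taken one after the other.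
   Both are refined to a common mesh [c < e]. *)
have core d d' : 0 < d -> 0 < d' ->
    (hausdorff_pre m d A + hausdorff_pre m d' B <= hausdorff m (A `|` B))%E.
  move=> d0 d'0; pose c := Num.min (e / 2) (Num.min d d').
  have c0 : 0 < c by rewrite !lt_min d0 d'0 divr_gt0.
  have cd : c <= d by rewrite !ge_min lexx ?orbT.
  have cd' : c <= d' by rewrite !ge_min lexx ?orbT.
  have ce : c < e by rewrite gt_min ltr_pdivrMr// mulr_natr mulr2n ltrDl e0.
  apply: le_trans (leeD (hausdorff_pre_anti m A cd) (hausdorff_pre_anti m B cd')) _.
  by apply: le_trans (hausdorff_pre_separated m ce sep) _; exact: hausdorff_pre_le.
rewrite addeC -leeBrDr//; apply: hausdorff_le => d' d'0.
rewrite leeBrDr// addeC -leeBrDr; last first.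
  rewrite ge0_fin_numE ?hausdorff_pre_ge0//;
    apply: le_lt_trans (_ : _ <= hausdorff m (A `|` B))%E _; last by rewrite ltey.
  by apply: le_trans (core 1 d' ltr01 d'0); rewrite leeDr// hausdorff_pre_ge0.
apply: hausdorff_le => d d0; rewrite leeBrDr; first exact: core.
rewrite ge0_fin_numE ?hausdorff_pre_ge0//;
  apply: le_lt_trans (_ : _ <= hausdorff m (A `|` B))%E _; last by rewrite ltey.
by apply: le_trans (core 1 d' ltr01 d'0); rewrite leeDr// hausdorff_pre_ge0.
Qed.

Lemma hausdorff_separated n m (F : nat -> set 'rV[R]_n) (e : R) k : 0 < e ->
  (forall i j x y, (i < j < k)%N -> F i x -> F j y -> e <= l2norm (x - y)) ->
  (\sum_(i < k) hausdorff m (F i) <= hausdorff m (\big[setU/set0]_(i < k) F i))%E.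
Proof.
move=> e0; elim: k => [|k IH] sep; first by rewrite !big_ord0 hausdorff_ge0.
rewrite !big_ord_recr /=.
apply: (@le_trans _ _ (hausdorff m (\big[setU/set0]_(i < k) F i) + hausdorff m (F k))%E).
  apply: leeD2r; apply: IH => i j x y /andP[ij jk]; apply: sep.
  by rewrite ij ltnW.
apply: (hausdorff_separatedU _ e0) => x y; rewrite -bigcup_mkord => -[i /= ik Fix] Fky.
by apply: sep Fix Fky; rewrite ik /=.
Qed.

End separated.

(** * The surface area of the simplex *)

Section facets.
Variables (R : realType) (rho : R) (m : nat).
Variable phi : 'rV[R]_m.+1 -> 'rV[R]_m.+2.
Variable psi : 'rV[R]_m -> 'rV[R]_m.+1.
Hypothesis rho0 : 0 < rho.
Hypothesis phiP : isometric_chart (@simplex_space R rho m.+1) phi.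
Hypothesis psiP : isometric_chart (@simplex_space R rho m) psi.

Definition insert0 (i : 'I_m.+2) (w : 'rV[R]_m.+1) : 'rV[R]_m.+2 :=
  \row_j (if unlift i j is Some j' then w 0 j' else 0).

Lemma insert0_lift i w j : insert0 i w 0 (lift i j) = w 0 j.
Proof. by rewrite mxE liftK. Qed.

Lemma insert0_same i w : insert0 i w 0 i = 0.
Proof. by rewrite mxE unlift_none. Qed.

Lemma l2norm_insert0 i v w : l2norm (insert0 i v - insert0 i w) = l2norm (v - w).
Proof.
rewrite /l2norm (bigD1_ord i)//= !mxE unlift_none subrr expr0n add0r.
by congr Num.sqrt; apply: eq_bigr => j _; rewrite !mxE liftK.
Qed.

Lemma sum_insert0 i w : \sum_j insert0 i w 0 j = \sum_j w 0 j.
Proof.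
rewrite (bigD1_ord i)//= insert0_same add0r.
by apply: eq_bigr => j _; exact: insert0_lift.
Qed.

(** A facet read in the chart; a positive [e] shrinks it away from the other facets. *)
Definition facet (e : R) (i : 'I_m.+2) : set 'rV[R]_m.+1 :=
  [set y | phi y 0 i = 0 /\ forall j, j != i -> e <= phi y 0 j].

Lemma facet_insert0 e i :
  phi @` facet e i = insert0 i @` (psi @` (psi @^-1` [set w | forall j, e <= w 0 j])).
Proof.
apply/seteqP; split=> [_ [y [yi ye] <-]|_ [_ [x xe <-] <-]].
  pose w : 'rV[R]_m.+1 := \row_j phi y 0 (lift i j).
  have iw : insert0 i w = phi y.
    apply/rowP => j; case: (unliftP i j) => [j'|] ->.
      by rewrite insert0_lift mxE.
    by rewrite insert0_same yi.
  have [x xw] : exists x, psi x = w.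
    by apply: (chart_surj psiP); rewrite -(sum_insert0 i) iw (chart_sum phiP).
  exists w; last exact: iw.
  exists x; last exact: xw.
  by move=> j /=; rewrite xw mxE ye// eq_sym neq_lift.
have [y yE] : exists y, phi y = insert0 i (psi x).
  by apply: (chart_surj phiP); rewrite sum_insert0 (chart_sum psiP).
exists y; last exact: yE.
split=> [|j ji]; rewrite yE; first by rewrite insert0_same.
by case: (unliftP i j) ji => [j'|] ->; rewrite ?eqxx// insert0_lift.
Qed.

Lemma truncated_simplex_bounded (e : R) : 0 <= e ->
  exists v s, 0 < s /\ psi @^-1` [set w | forall j, e <= w 0 j] `<=` box v (v +
    const_mx s).
Proof.
move=> e0.
(* The coordinates of [psi y] lie between 0 and [rho], so the square root bounds the distance from
   [psi y] to [psi 0], which is the norm of [y]; the 1 makes the side of the cube positive. *)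
pose D := Num.sqrt (\sum_j (rho + `|psi 0 0 j|) ^+ 2) + 1.
exists (const_mx (- D)), (2 * D).
have D1 : 1 <= D by rewrite lerDr sqrtr_ge0.
split; first lra.
move=> y ye; suff h i : `|y 0 i| <= D.
  by move=> i; rewrite !mxE; have := h i; rewrite ler_norml => /andP[]; lra.
apply: (le_trans (coord_le_l2norm y i)).
rewrite -[y]subr0 -psiP.1; apply: (@le_trans _ _ (D - 1)); last lra.
rewrite addrK ler_wsqrtr//; apply: ler_sum => j _; rewrite !mxE.
rewrite -[X in X <= _]real_normK ?num_real// ler_pXn2r ?nnegrE// ?addr_ge0 ?(ltW rho0)//.
apply: (le_trans (ler_normB _ _)); rewrite lerD2r ger0_norm; last exact: le_trans (ye j).
rewrite -(chart_sum psiP y) (bigD1 j)//= lerDl sumr_ge0// => k _.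
exact: le_trans (ye k).
Qed.

(** The isometries [phi], [insert0 i] and [psi] carry the facet to a full-dimensional bounded set of
    R^m, where Hausdorff measure is proportional to volume. *)
Lemma hausdorff_facet (e : R) i : 0 <= e -> m.+1%:R * e <= rho ->
  hausdorff m (facet e i) = (cube_hausdorff R m *
    (Num.sqrt m.+1%:R * ((rho - m.+1%:R * e) ^+ m / m`!%:R)))%:E.
Proof.
move=> e0 er.
rewrite -(@hausdorff_isometry R _ _ m phi); last by move=> *; exact: phiP.1.
rewrite facet_insert0 hausdorff_isometry; last by move=> *; exact: l2norm_insert0.
rewrite hausdorff_isometry; last by move=> *; exact: psiP.1.
have [v [s [s0 sub]]] := truncated_simplex_bounded e0.
rewrite (hausdorff_eq_vol _ s0 sub).
  by rewrite (vol_truncated_simplex e0 er psiP) EFinM.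
apply: measurable_preimage_setT; first exact: (measurable_chart psiP).
apply: measurable_forall => j.
exact: measurable_le_set (measurable_cst _) (measurable_coord _).
Qed.

Lemma continuous_chart_coord i : continuous (fun y => phi y 0 i).
Proof.
have [A _ hA] := isometry_affine phiP.1.
rewrite (_ : (fun y => _) = (fun y : 'rV[R]_m.+1 => phi 0 0 i + \sum_j y 0 j *
  A j i)); last first.
  by apply/funext => z; rewrite hA !mxE.
have key (T : Type) (F : set_system T) (FF : Filter F) (g : 'I_m.+1 -> T -> R)
  (l : 'I_m.+1 -> R) :
    (forall j, g j @ F --> l j) ->
    (fun t => phi 0 0 i + \sum_j g j t * A j i) @ F --> phi 0 0 i + \sum_j l j * A j i.
  move=> gl; apply: cvgD; first exact: cvg_cst.
  apply: (@cvg_big R 'I_m.+1 +%R 0 xpredT (@add_continuous R)) => j _.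
  by apply: cvgMl; exact: gl.
move=> y; apply: (key _ _ (nbhs_filter (y : 'rV[R]_m.+1)) (fun j z => z 0 j)) => j.
exact: coord_continuous.
Qed.

Let K := phi @^-1` @regular_simplex R rho m.+1.

Lemma simplex_chartE : K = \bigcap_(i in setT) [set y | 0 <= phi y 0 i].
Proof.
apply/seteqP; split=> [y [_ h] i _|y h]; first exact: h.
by split=> [|i]; [exact: (chart_sum phiP)|exact: h].
Qed.

Lemma closed_simplex_chart : closed K.
Proof.
rewrite simplex_chartE; apply: closed_bigI => i _.
apply: (@closed_comp _ _ _ [set x : R | 0 <= x]); last exact: closed_ge.
by move=> y _; exact: continuous_chart_coord.
Qed.

Lemma interior_simplex_chart : interior K = [set y | forall i, 0 < phi y 0 i].
Proof.
apply/seteqP; split=> [y Ky i|y yi]; last first.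
  have : \forall z \near y, forall i, 0 < phi z 0 i.
    have FF : Filter (nbhs (y : 'rV[R]_m.+1)) by exact: nbhs_filter.
    apply: (@filter_forall _ _ (fun i z => 0 < phi z 0 i) _ FF) => i /=.
    have := @continuous_chart_coord i y; move=> /cvgr_gt /(_ _ (yi i)).
    by apply: filterS => z.
  apply: filterS => z zi; rewrite simplex_chartE => i _ /=.
  by apply: ltW; exact: zi.
have yi0 : 0 <= phi y 0 i by have [_ ] := interior_subset Ky; exact.
rewrite lt_neqAle yi0 andbT; apply/eqP => yi.
(* If coordinate [i] vanished at an interior point, a small move in the direction [e_j - e_i], which
   stays in the hyperplane, would make it negative inside the simplex. *)
pose j := lift i (0 : 'I_m.+1).
have ji : j != i by rewrite eq_sym neq_lift.
pose d : 'rV[R]_m.+2 := delta_mx 0 j - delta_mx 0 i.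
have [A _ hA] := isometry_affine phiP.1.
have [y' y'E] : exists y', phi y' = phi y + d.
  apply: (chart_surj phiP); under eq_bigr do rewrite !mxE /=.
  rewrite !big_split/= (chart_sum phiP) sumrN.
  have dd k : \sum_(l < m.+2) (l == k)%:R = 1 :> R.
    by rewrite (bigD1 k)//= eqxx big1 ?addr0// => l /negbTE ->.
  by rewrite !dd subrr addr0.
have uE t : phi (y + t *: (y' - y)) = phi y + t *: d.
  rewrite hA mulmxDl addrA -hA -scalemxAl mulmxBl; congr (_ + _ *: _).
  have -> : d = phi y' - phi y by rewrite y'E addrAC subrr add0r.
  by rewrite (hA y') (hA y) opprD addrACA subrr add0r.
have cv : (fun t : R => y + t *: (y' - y)) @ nbhs (0 : R) --> y.
  suff : (fun t : R => y + t *: (y' - y)) @ nbhs (0 : R) --> y + 0 *: (y' - y).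
    by rewrite scale0r addr0.
  by apply: cvgD; [exact: cvg_cst|apply: cvgZr_tmp; exact: cvg_id].
have /nbhs_ballP[r /= r0 rK] := cv _ Ky.
have : K (y + (r / 2) *: (y' - y)).
  apply: rK; rewrite /ball /= sub0r normrN ger0_norm; last by rewrite divr_ge0 ?ltW.
  by rewrite ltr_pdivrMr// mulr_natr mulr2n ltrDl.
move=> [_ /(_ i)]; rewrite /= uE !mxE -yi eqxx /= (negbTE (_ : i != j)) 1?eq_sym//.
by rewrite eqxx add0r sub0r mulrN1 oppr_ge0 leNgt divr_gt0.
Qed.

Lemma boundary_simplex_chart : boundary K = \bigcup_(i in setT) facet 0 i.
Proof.
rewrite /boundary -(closure_id _).1; last exact: closed_simplex_chart.
rewrite interior_simplex_chart simplex_chartE; apply/seteqP;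
  split=> [y [h]|y [i _ [yi h]]].
  move=> hn; have [i /negP] : exists i, ~ 0 < phi y 0 i by apply/existsNP.
  rewrite -leNgt => yi; exists i => //; split.
    by apply/eqP; rewrite eq_le yi (h i).
  by move=> j _; exact: h.
split=> [j _ /=|/(_ i)]; last by rewrite yi ltxx.
by have [->|/h//] := eqVneq j i; rewrite yi.
Qed.

(* Facets shrunk by [e] are at distance at least [e] from each other, so their
   measures add up; the lower bound follows by letting [e] tend to 0. *)
Lemma hausdorff_boundary_simplex : hausdorff m (boundary K) =
  (m.+2%:R * (cube_hausdorff R m * (Num.sqrt m.+1%:R * (rho ^+ m / m`!%:R))))%:E.
Proof.
have bE : boundary K = \big[setU/set0]_(i < m.+2) facet 0 (inord i).
  rewrite boundary_simplex_chart -(bigcup_mkord m.+2 (fun i => facet 0 (inord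
    i))); apply/seteqP; split=> [y [i _ h]|y [i _ h]].
    by exists i => /=; [exact: ltn_ord|rewrite inord_val].
  by exists (inord i).
have up : (hausdorff m (boundary K) <=
    (m.+2%:R * (cube_hausdorff R m * (Num.sqrt m.+1%:R * (rho ^+ m / m`!%:R))))%:E)%E.
  rewrite bE; apply: (le_trans (outer_measure_subadditive (@hausdorff R m.+1 m)
    (fun i => facet 0 (inord i)) m.+2)).
  rewrite (eq_bigr (fun=> (cube_hausdorff R m * (Num.sqrt m.+1%:R * (rho ^+ m /
    m`!%:R)))%:E)).
    by rewrite sumEFin lee_fin sumr_const card_ord mulr_natl.
  by move=> i _; rewrite [LHS]hausdorff_facet// ?mulr0 ?subr0// ltW.
apply/eqP; rewrite eq_le up /=.
have fb : hausdorff m (boundary K) \is a fin_num.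
  by rewrite ge0_fin_numE ?hausdorff_ge0// (le_lt_trans up)// ltry.
rewrite -(fineK fb) lee_fin.
pose c (e : R) := m.+2%:R * (cube_hausdorff R m * (Num.sqrt m.+1%:R * ((rho -
  m.+1%:R * e) ^+ m / m`!%:R))).
have cc : {for 0, continuous c}.
  rewrite /c; apply: cvgMr; apply: cvgMr; apply: cvgMr; apply: cvgMl.
  apply: (@cvg_comp _ _ _ (fun e => rho - m.+1%:R * e) (fun x : R => x ^+ m));
    last exact: exprn_continuous.
  by apply: cvgB; [exact: cvg_cst|apply: cvgMr; exact: cvg_id].
have c0 : c 0 = m.+2%:R * (cube_hausdorff R m * (Num.sqrt m.+1%:R * (rho ^+ m / m`!%:R))).
  by rewrite /c mulr0 subr0.
rewrite -c0; apply: (@cvgr_to_le _ (0^'+)%classic _ _ c).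
  by apply: cvg_at_right_filter; exact: cc.
have r1 : 0 < rho / m.+1%:R by rewrite divr_gt0.
near=> e.
have e0 : 0 < e by near: e; exact: nbhs_right_gt.
have er : m.+1%:R * e <= rho.
  rewrite mulrC -ler_pdivlMr//; apply: ltW; near: e; exact: nbhs_right_lt.
rewrite -lee_fin fineK//.
have sub : \big[setU/set0]_(i < m.+2) facet e (inord i) `<=` boundary K.
  rewrite bE -(bigcup_mkord m.+2 (fun i => facet 0 (inord i))) -(bigcup_mkord
    m.+2 (fun i => facet e (inord i))) => y [i im [yi ye]]; exists i => //;
      split=> // j ji.
  by apply: le_trans (ye _ ji); exact: ltW.
apply: (le_trans _ (le_hausdorff m sub)).
apply: (le_trans _ (hausdorff_separated (F := fun i => facet e (inord i)) (k :=
  m.+2) m e0 _)).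
  rewrite (eq_bigr (fun=> (cube_hausdorff R m * (Num.sqrt m.+1%:R * ((rho -
    m.+1%:R * e) ^+ m / m`!%:R)))%:E)).
    by rewrite sumEFin lee_fin sumr_const card_ord /c mulr_natl.
  by move=> i _; rewrite hausdorff_facet// ltW.
move=> i j x y /andP[ij jm] [xi _] [_ yj].
have im := ltn_trans ij jm.
have nij : (inord i : 'I_m.+2) != inord j.
  by rewrite -(inj_eq val_inj) /= !inordK// ltn_eqF.
rewrite -phiP.1; apply: le_trans (coord_le_l2norm _ (inord i)).
by rewrite !mxE xi sub0r normrN; apply: le_trans (yj _ nij) (ler_norm _).
Unshelve. all: by end_near.
Qed.

Lemma surface_area_simplex : surface_area K = m.+2%:R * (Num.sqrt m.+1%:R *
  (rho ^+ m / m`!%:R)).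
Proof.
rewrite /surface_area /mvol /= hausdorff_boundary_simplex /= -/(cube_hausdorff R m).
by rewrite mulrCA mulrAC mulfV ?mul1r// gt_eqF// cube_hausdorff_gt0.
Qed.

End facets.

(** * Asymptotics of the coefficients *)

Section tannery.
Variable R : realType.

(** Dominated convergence for series cut off at [K m]. An [N] is fixed for which the tails of [g]
    and of [B] are within [e / 3]; the first [N] terms converge one by one, and the terms of [f m]
    between [N] and [K m] are bounded by the tail of [B]. *)
Lemma tannery (f : nat -> nat -> R) (g B : nat -> R) (K : nat -> nat) :
  (forall m l, `|f m l| <= B l) -> cvgn (series B) ->
  (forall l, f m l @[m --> \oo] --> g l) -> (forall m, (m <= K m)%N) ->
  cvgn (series g) /\ series (f m) (K m) @[m --> \oo] --> limn (series g).
Proof.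
move=> fB cB fg mK.
have gB l : `|g l| <= B l.
  apply: (cvgr_to_le (cvg_norm (fg l))); apply: nearW => m; exact: fB.
have B0 l : 0 <= B l by apply: le_trans (gB l).
have cg : cvgn (series g).
  by apply: normed_cvg; apply: (series_le_cvg _ B0 gB cB) => l; exact: normr_ge0.
split=> //; apply/cvgrPdist_le => e e0.
have e3 : 0 < e / 3 by rewrite divr_gt0.
have /cvgrPdist_le /(_ _ e3) nB := cB.
have /cvgrPdist_le /(_ _ e3) ng := cg.
have [N [SB SG]] : exists N, `|limn (series B) - series B N| <= e / 3 /\
    `|limn (series g) - series g N| <= e / 3.
  by have [N [h1 h2]] := filter_ex (filterI nB ng); exists N.
have cN : series (f m) N @[m --> \oo] --> series g N.
  rewrite /series /= big_mkord.
  under eq_fun do rewrite big_mkord.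
  by apply: (@cvg_big R 'I_N +%R 0 xpredT (@add_continuous R)) => j _; exact: fg.
have /cvgrPdist_le /(_ _ e3) nN := cN.
near=> m.
have Nm : (N <= K m)%N by apply: leq_trans (mK m); near: m; exact: nbhs_infty_ge.
have h1 : `|series g N - series (f m) N| <= e / 3 by near: m.
have -> : limn (series g) - series (f m) (K m) =
   (limn (series g) - series g N) + (series g N - series (f m) N) -
   \sum_(N <= l < K m) f m l.
    have -> : series (f m) (K m) = series (f m) N + \sum_(N <= l < K m) f m l.
    by rewrite /series /= -big_cat_nat.
  ring.
rewrite (_ : e = e / 3 + e / 3 + e / 3); last by field.
apply: (le_trans (ler_normB _ _)); apply: lerD.
  by apply: (le_trans (ler_normD _ _)); exact: lerD.
apply: le_trans SB.
apply: (@le_trans _ _ (\sum_(N <= l < K m) B l)).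
  by apply: (le_trans (ler_norm_sum _ _ _)); apply: ler_sum => l _; exact: fB.
apply: le_trans (ler_norm _); rewrite lerBrDr addrC.
rewrite (_ : _ + _ = series B (K m)); last by rewrite /series /= -big_cat_nat.
apply: nondecreasing_cvgn_le => // a b ab.
rewrite /series /= (big_cat_nat _ ab)//= lerDl; apply: sumr_ge0 => i _; exact: B0.
Unshelve. all: by end_near.
Qed.

End tannery.

Section cone_limit.
Variable R : realType.

(** Each coordinate is at most 1 in absolute value. The bound is crude but independent of [k], so
    dividing it by [k + 1] makes the level tend to 0. *)
Lemma sum_sq_le1 l (u : 'rV[R]_l) : \sum_i u 0 i ^+ 2 <= 1 -> `|\sum_i u 0 i| <= l%:R.
Proof.
move=> u1; apply: (le_trans (ler_norm_sum _ _ _)).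
rewrite -[l in l%:R]card_ord -sumr_const; apply: ler_sum => i _.
rewrite -(@ler_pXn2r _ 2)// ?nnegrE// expr1n real_normK ?num_real//.
apply: le_trans u1; rewrite (bigD1 i)//= lerDl sumr_ge0// => j _; exact: sqr_ge0.
Qed.

(** For large [k] the cone is close to the negative orthant; the reflection brings it next to
    [orthant_ball]. *)
Lemma vol_cone_ball_opp k l :
  vol (@cone_ball R k l 1) = vol [set u : 'rV[R]_l | cone_ball k 1 (- u)].
Proof.
have u1 : (- 1%:M : 'M[R]_l) \in unitmx by rewrite unitmxE -scaleN1r detZ det1
  mulr1 unitrX// unitrN1.
have := vol_linear u1 (@measurable_cone_ball R k l 1).
have -> : [set x : 'rV[R]_l | cone_ball k 1 (x *m - 1%:M)] = [set u | cone_ball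
  k 1 (- u)].
  by apply/seteqP; split=> x /=; rewrite mulmxN mulmx1.
by move=> ->; rewrite -scaleN1r detZ det1 mulr1 normrX normrN1 expr1n invr1 mul1e.
Qed.

(** An inclusion: on the positive orthant the reflected cone conditions are automatic, and the level
    term of the squared norm is at most [l ^ 2 / (k + 1)], the amount taken off the squared
    radius. *)
Lemma vol_cone_ball_ge k l : 0 < 1 - l%:R ^+ 2 * k.+1%:R^-1 :> R ->
  Num.sqrt (1 - l%:R ^+ 2 * k.+1%:R^-1) ^+ l * fine (vol (@orthant_ball R l 1)) <=
  fine (vol (@cone_ball R k l 1)).
Proof.
set s := (X in 0 < X) => s0.
rewrite -lee_fin EFinM !fineK ?vol_cone_ball_fin//; last first.
  by rewrite ge0_fin_numE ?vol_ge0// vol_orthant_ball_lty.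
rewrite -vol_orthant_ball_scale// vol_cone_ball_opp; apply: le_vol => u [u0 us].
have s1 : s <= 1 by rewrite gerBl mulr_ge0 ?sqr_ge0// invr_ge0.
have := sum_sq_le1 (le_trans us s1).
have su0 : 0 <= \sum_i u 0 i by apply: sumr_ge0 => i _; exact: ltW.
have cl : cone_level k (- u) = (\sum_i u 0 i) / k.+1%:R.
  rewrite /cone_level; under eq_bigr do rewrite mxE.
  by rewrite sumrN opprK.
rewrite ger0_norm// => sl; split=> [i|].
  rewrite cl mxE; apply: (@lt_le_trans _ _ 0); first by rewrite oppr_lt0.
  by rewrite divr_ge0.
under eq_bigr do rewrite mxE sqrrN.
rewrite cl expr1n -lerBrDr; apply: le_trans us _; rewrite lerD2l lerN2.
have -> : k.+1%:R * ((\sum_i u 0 i) / k.+1%:R) ^+ 2 = (\sum_i u 0 i) ^+ 2 / k.+1%:R :> R.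
  by field; rewrite nat1r pnatr_eq0.
by rewrite ler_wpM2r ?invr_ge0// lerXn2r// nnegrE.
Qed.

(** In the reflected cone every coordinate exceeds [- c], with [c = l / (k + 1)], so a translation
    by [c] in each coordinate moves the cone into the orthant. The squared norm becomes at most
    [1 + 2 c l + l c ^ 2], the argument of the square root. *)
Lemma vol_cone_ball_le_orthant k l :
  fine (vol (@cone_ball R k l 1)) <=
  Num.sqrt (1 + 2 * l%:R ^+ 2 * k.+1%:R^-1 + l%:R ^+ 3 * k.+1%:R^-1 ^+ 2) ^+ l *
  fine (vol (@orthant_ball R l 1)).
Proof.
set s := (X in Num.sqrt X).
have x0 : 0 <= k.+1%:R^-1 :> R by rewrite invr_ge0.
have s0 : 0 < s by rewrite /s -addrA ltr_pwDl// addr_ge0// !mulr_ge0// ?exprn_ge0.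
rewrite -lee_fin EFinM !fineK ?vol_cone_ball_fin//; last first.
  by rewrite ge0_fin_numE ?vol_ge0// vol_orthant_ball_lty.
rewrite -vol_orthant_ball_scale// -[X in (_ <= X)%E](vol_translate (const_mx
  (l%:R / k.+1%:R))); last exact: measurable_orthant_ball.
rewrite vol_cone_ball_opp; apply: le_vol => u [].
have cl : cone_level k (- u) = (\sum_i u 0 i) / k.+1%:R.
  rewrite /cone_level; under eq_bigr do rewrite mxE.
  by rewrite sumrN opprK.
rewrite cl expr1n => ui us.
have {}us : \sum_i u 0 i ^+ 2 + k.+1%:R * ((\sum_i u 0 i) / k.+1%:R) ^+ 2 <= 1.
  by apply: le_trans us; rewrite lerD2r; apply: ler_sum => i _; rewrite mxE sqrrN.
have u1 : \sum_i u 0 i ^+ 2 <= 1.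
  by apply: le_trans us; rewrite lerDl mulr_ge0// sqr_ge0.
have := sum_sq_le1 u1; rewrite ler_norml => /andP[_ sl].
split=> [i|].
  have := ui i; rewrite !mxE ltrNl => h; rewrite -ltrBlDr sub0r.
  apply: le_lt_trans h; rewrite lerN2; exact: ler_wpM2r.
rewrite (eq_bigr (fun i => u 0 i ^+ 2 + (2 * (l%:R / k.+1%:R) * u 0 i + (l%:R /
  k.+1%:R) ^+ 2))); last first.
  by move=> i _; rewrite !mxE; ring.
rewrite big_split big_split /= -mulr_sumr sumr_const card_ord /s -addrA.
apply: lerD => //; apply: lerD.
  rewrite expr2 !mulrA -[X in X <= _]mulrA [X in X <= _](_ : _ = 2 * l%:R *
    k.+1%:R^-1 * \sum_i u 0 i); last by ring.
  by rewrite -[X in _ <= X]mulrA [l%:R / _]mulrC mulrA ler_wpM2l// !mulr_ge0.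
by rewrite -[X in X <= _]mulr_natl exprMn [_ ^+ 3]exprS mulrA.
Qed.

Lemma cvg_vol_cone_ball l :
  fine (vol (@cone_ball R k l 1)) @[k --> \oo] --> fine (vol (@orthant_ball R l 1)).
Proof.
set V := fine (vol (@orthant_ball R l 1)).
have hx : (k.+1%:R^-1 : R) @[k --> \oo] --> (0 : R) by exact: cvg_harmonic.
have lim (h : R -> R) : {for 0, continuous h} -> h 0 = 1 ->
    Num.sqrt (h k.+1%:R^-1) ^+ l * V @[k --> \oo] --> V.
  move=> hc h0; rewrite [X in _ --> X](_ : V = Num.sqrt (h 0) ^+ l * V);
    last by rewrite h0 sqrtr1 expr1n mul1r.
  apply: cvgMl.
  apply: (@cvg_comp _ _ _ (fun k : nat => Num.sqrt (h k.+1%:R^-1)) (fun x : R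
    => x ^+ l)); last exact: exprn_continuous.
  apply: (@cvg_comp _ _ _ (fun k : nat => h k.+1%:R^-1) (@Num.sqrt R));
    last exact: sqrt_continuous.
  by apply: (@cvg_comp _ _ _ (fun k : nat => k.+1%:R^-1) h); [exact: hx|exact: hc].
pose h1 (x : R) := 1 - l%:R ^+ 2 * x.
pose h2 (x : R) := 1 + 2 * l%:R ^+ 2 * x + l%:R ^+ 3 * x ^+ 2.
have ch1 : {for 0, continuous h1}.
  by apply: cvgB; [exact: cvg_cst|apply: cvgMr; exact: cvg_id].
have ch2 : {for 0, continuous h2}.
  apply: cvgD; last by apply: cvgMr; exact: exprn_continuous.
  by apply: cvgD; [exact: cvg_cst|apply: cvgMr; exact: cvg_id].
have h10 : h1 0 = 1 by rewrite /h1 mulr0 subr0.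
have h20 : h2 0 = 1 by rewrite /h2 expr0n !mulr0 !addr0.
apply: (squeeze_cvgr _ (lim h1 ch1 h10) (lim h2 ch2 h20)).
have ch1' : h1 k.+1%:R^-1 @[k --> \oo] --> (1 : R).
  by rewrite -[X in _ --> X]h10; apply: (@cvg_comp _ _ _ (fun k : nat =>
    k.+1%:R^-1) h1); [exact: hx|exact: ch1].
near=> k; apply/andP; split; last exact: vol_cone_ball_le_orthant.
apply: vol_cone_ball_ge; near: k.
by have := ch1'; move=> /cvgr_gt /(_ _ ltr01).
Unshelve. all: by end_near.
Qed.

End cone_limit.

Section coefficients.
Variable R : realType.

(** The dimension is [m.+1], whence the facets of dimension [m] and the [m.+2] coordinates. The
    powers of [rho] have cancelled. *)
Definition simplex_coef (m l : nat) : R :=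
  'C(m.+2, l)%:R * (m.+1 ^_ l)%:R / (m.+1%:R * Num.sqrt (m.+1%:R * m.+2%:R)) ^+ l *
  fine (vol (@cone_ball R (m.+1 - l) l 1)).

Definition limit_coef (l : nat) : R :=
  (Num.sqrt pi / 2) ^+ l / (Gamma (l%:R / 2 + 1) * Gamma (l%:R + 1)).

Let D m : R := m.+1%:R * Num.sqrt (m.+1%:R * m.+2%:R).

Let D_gt0 m : 0 < D m.
Proof. by rewrite mulr_gt0// sqrtr_gt0 mulr_gt0. Qed.

(** Distributes the power in the denominator over [l] quotients, each at most 2 and tending to 1 as
    [m] grows: the form used both for the majorant and for the limit. *)
Lemma simplex_coefE m l : simplex_coef m l =
  l`!%:R^-1 * (\prod_(i < l) ((m.+2 - i)%:R * (m.+1 - i)%:R / D m)) *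
  fine (vol (@cone_ball R (m.+1 - l) l 1)).
Proof.
rewrite /simplex_coef -/(D m); congr (_ * _).
rewrite big_split /= prodr_const card_ord exprVn mulrA; congr (_ / _).
rewrite big_split /= -!natr_prod -!ffact_prod mulrA; congr (_ * _).
by rewrite -bin_ffact natrM mulrCA mulVf ?mulr1// pnatr_eq0 -lt0n fact_gt0.
Qed.

Lemma simplex_coef_ge0 m l : 0 <= simplex_coef m l.
Proof.
rewrite mulr_ge0 ?fine_ge0 ?vol_ge0// divr_ge0 ?mulr_ge0//.
Qed.

Lemma simplex_coef_le m l : simplex_coef m l <= 4 ^+ l / l`!%:R.
Proof.
(* From [m + 2 <= 2 (m + 1)] and the fact that [m + 1] is at most the square root of
   [(m + 1) (m + 2)]. *)
have D2 : m.+2%:R * m.+1%:R <= 2 * D m.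
  rewrite /D mulrCA mulrC ler_wpM2l//.
  apply: (@le_trans _ _ (2 * m.+1%:R)); first by rewrite -natrM ler_nat; lia.
  rewrite ler_wpM2l// -[X in X <= _]ger0_norm// -sqrtr_sqr ler_wsqrtr// expr2.
  by rewrite ler_wpM2l// ler_nat.
rewrite simplex_coefE mulrC [4 ^+ l / _]mulrC mulrCA ler_wpM2l ?invr_ge0//.
(* One factor 2 for each side of the cube around the cone ball, one for each quotient bounded by
   [D2]. *)
rewrite (_ : 4 = 2 * 2 :> R); last by rewrite -natrM.
rewrite exprMn; apply: ler_pM.
- by rewrite fine_ge0 ?vol_ge0.
- by apply: prodr_ge0 => i _; rewrite divr_ge0 ?mulr_ge0// ltW.
- by rewrite -lee_fin fineK ?vol_cone_ball_fin// vol_cone_ball_le.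
rewrite -[l in 2 ^+ l]card_ord -prodr_const; apply: ler_prod => i _.
rewrite divr_ge0 ?mulr_ge0 ?(ltW (D_gt0 m))//= ler_pdivrMr//.
by apply: le_trans D2; apply: ler_pM => //; rewrite ler_nat leq_subr.
Qed.

Lemma cvg_simplex_coef l : simplex_coef m l @[m --> \oo] --> limit_coef l.
Proof.
have -> : limit_coef l = l`!%:R^-1 * 1 * fine (vol (@orthant_ball R l 1)).
  by rewrite vol_orthant_ball /= /limit_coef Gamma_nat invfM mulr1 mulrA mulrC.
under eq_fun do rewrite simplex_coefE.
apply: cvgM; last first.
  have := @cvg_vol_cone_ball R l => h.
  apply/cvgrPdist_le => e e0; have /cvgrPdist_le /(_ _ e0) [N _ hN] := h.
  near=> m; apply: hN => /=.
  have : (N + l <= m)%N by near: m; exact: nbhs_infty_ge.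
  lia.
apply: cvgMr.
rewrite [X in _ --> X](_ : 1 = \prod_(i < l) (1 : R)); last by rewrite big1.
apply: (@cvg_big R 'I_l ( *%R) 1 xpredT (@mul_continuous R)) => i _.
(* The quotient of index [i] as a function of [x = 1 / (m + 1)]; the two agree once [i <= m], when
   the subtractions of naturals are those of reals. *)
pose h (x : R) := (1 + (1 - i%:R) * x) * (1 - i%:R * x) / Num.sqrt (1 + x).
have hx : (m.+1%:R^-1 : R) @[m --> \oo] --> (0 : R) by exact: cvg_harmonic.
have ch : {for 0, continuous h}.
  apply: cvgM.
    apply: cvgM.
      by apply: cvgD; [exact: cvg_cst|apply: cvgMr; exact: cvg_id].
    by apply: cvgB; [exact: cvg_cst|apply: cvgMr; exact: cvg_id].
  apply: cvgV; first by rewrite addr0 sqrtr1 oner_eq0.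
  apply: (@cvg_comp _ _ _ (fun x : R => 1 + x) (@Num.sqrt R));
    last exact: sqrt_continuous.
  by apply: cvgD; [exact: cvg_cst|exact: cvg_id].
have h0 : h 0 = 1 by rewrite /h !mulr0 subr0 !addr0 sqrtr1 invr1 !mulr1.
have : h m.+1%:R^-1 @[m --> \oo] --> (1 : R).
  by rewrite -[X in _ --> X]h0; apply: (@cvg_comp _ _ _ (fun k : nat =>
    k.+1%:R^-1) h); [exact: hx|exact: ch].
apply: cvg_trans; apply: near_eq_cvg; near=> m.
have im : (i <= m)%N by near: m; exact: nbhs_infty_ge.
rewrite /h /D !natrB; try by lia.
set x : R := m.+1%:R.
have x0 : 0 < x by rewrite ltr0n.
have -> : m.+2%:R = x + 1 :> R by rewrite -natr1.
have -> : x * (x + 1) = x ^+ 2 * (1 + x^-1) by field; rewrite gt_eqF.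
rewrite sqrtrM ?sqr_ge0// sqrtr_sqr gtr0_norm//.
have q0 : 0 < Num.sqrt (1 + x^-1) by rewrite sqrtr_gt0 addr_gt0// invr_gt0.
by field; rewrite !gt_eqF.
Unshelve. all: by end_near.
Qed.

End coefficients.

Section renormalized_simplex.
Variables (R : realType) (rho : R) (m : nat).
Variable phi : 'rV[R]_m.+1 -> 'rV[R]_m.+2.
Variable psi : 'rV[R]_m -> 'rV[R]_m.+1.
Hypothesis rho0 : 0 < rho.
Hypothesis phiP : isometric_chart (@simplex_space R rho m.+1) phi.
Hypothesis psiP : isometric_chart (@simplex_space R rho m) psi.

Let K := phi @^-1` @regular_simplex R rho m.+1.

Lemma vol_simplex : vol K = (Num.sqrt m.+2%:R * (rho ^+ m.+1 / m.+1`!%:R))%:E.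
Proof.
have -> : K = phi @^-1` [set z | forall i, 0 <= z 0 i].
  apply/seteqP; split=> [y [_ h]|y h]; first exact: h.
  by split; [exact: (chart_sum phiP)|exact: h].
by rewrite (vol_truncated_simplex (lexx 0) _ phiP) ?mulr0 ?subr0// ltW.
Qed.

Lemma shape_factor_simplex :
  (shape_factor K)^-1 = rho / (m.+1%:R * Num.sqrt (m.+1%:R * m.+2%:R)).
Proof.
rewrite /shape_factor (surface_area_simplex rho0 phiP psiP) vol_simplex /= sqrtrM//.
have q1 : 0 < Num.sqrt m.+1%:R :> R by rewrite sqrtr_gt0.
have q2 : 0 < Num.sqrt m.+2%:R :> R by rewrite sqrtr_gt0.
have : Num.sqrt m.+2%:R * Num.sqrt m.+2%:R = m.+2%:R :> R by rewrite -expr2 sqr_sqrtr.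
rewrite factS natrM exprS.
have f0 : 0 < m`!%:R :> R by rewrite ltr0n fact_gt0.
have r0 : 0 < rho ^+ m by rewrite exprn_gt0.
have m0 : 0 < m.+1%:R :> R by rewrite ltr0n.
move: q1 q2 f0 r0 m0; move: (Num.sqrt m.+2%:R) (Num.sqrt _) => b a;
  move: m`!%:R (rho ^+ m) (m.+1%:R) => c d e.
move=> a0 b0 c0 d0 e0 <-.
by field; rewrite ?gt_eqF.
Qed.

Lemma poly_comp_scale n (c : nat -> R) (s : R) :
  (\poly_(l < n) c l) \Po (s *: 'X) = \poly_(l < n) (c l * s ^+ l).
Proof.
rewrite !poly_def raddf_sum; apply: eq_bigr => i _ /=.
by rewrite comp_polyZ comp_Xn_poly exprZn scalerA.
Qed.

Lemma renorm_steiner_poly_simplex :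
  renorm_steiner_poly K = \poly_(l < m.+2) simplex_coef R m l.
Proof.
rewrite /renorm_steiner_poly shape_factor_simplex (steiner_poly_simplex rho0
  phiP) vol_simplex /=.
rewrite poly_comp_scale; apply/polyP => l; rewrite coefZ !coef_poly.
case: ltnP => [lm|_]; last by rewrite mulr0.
(* The quotient of the two factorials is the falling factorial of [simplex_coef]. *)
rewrite /steiner_coef /simplex_coef -(@ffact_fact m.+1 l lm) natrM.
have -> : rho ^+ m.+1 = rho ^+ (m.+1 - l) * rho ^+ l by rewrite -exprD subnK.
rewrite expr_div_n.
have q2 : 0 < Num.sqrt m.+2%:R :> R by rewrite sqrtr_gt0.
have f0 : 0 < (m.+1 - l)`!%:R :> R by rewrite ltr0n fact_gt0.
have g0 : 0 < (m.+1 ^_ l)%:R :> R by rewrite ltr0n ffact_gt0.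
have r0 : 0 < rho ^+ l by rewrite exprn_gt0.
have r1 : 0 < rho ^+ (m.+1 - l) by rewrite exprn_gt0.
have D0 : 0 < (m.+1%:R * Num.sqrt (m.+1%:R * m.+2%:R)) ^+ l :> R.
  by rewrite exprn_gt0// mulr_gt0// sqrtr_gt0 mulr_gt0.
move: q2 f0 g0 r0 r1 D0; set a := Num.sqrt _; set b := _`!%:R; set c := (_ ^_ _)%:R.
set d := rho ^+ l; set e := rho ^+ _; set D := _ ^+ l; set v := fine _;
  set w := 'C(_, _)%:R.
move=> *; by field; rewrite ?gt_eqF.
Qed.

End renormalized_simplex.

(** * Convergence at complex arguments and the conclusion *)

Section complex_convergence.
Variable R : realType.
Local Notation C := (complexes R).

Lemma horner_complex_poly n (c : nat -> R) (z : C) :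
  horner_complex (\poly_(l < n) c l) z = \sum_(l < n) (c l)%:C%C * z ^+ l.
Proof.
rewrite /horner_complex poly_def raddf_sum horner_sum; apply: eq_bigr => i _ /=.
by rewrite map_polyZ map_polyXn hornerZ hornerXn.
Qed.

Lemma cvg_real_complex (u : nat -> R) (x : R) : u @ \oo --> x ->
  ((u n)%:C%C : C) @[n --> \oo] --> (x%:C%C : C).
Proof.
move=> ux; apply/cvgrPdist_lt => -[a b].
rewrite (ltcE (0 : R[i])) /= => /andP[/eqP -> a0].
have /cvgrPdist_lt /(_ _ a0) := ux; apply: filterS => n h.
rewrite -rmorphB /= normc_def /= expr0n addr0 sqrtr_sqr.
by rewrite ltcR.
Qed.

(** The sum of the absolute values of the real and imaginary parts is submultiplicative; it provides
    geometric bounds in [R] for both parts of the powers. *)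
Lemma complex_pow_le (z : R[i]) l :
  `|complex.Re (z ^+ l)| + `|complex.Im (z ^+ l)| <= (`|complex.Re z| +
    `|complex.Im z|) ^+ l.
Proof.
elim: l => [|l IH]; first by rewrite !expr0 /= normr1 normr0 addr0.
rewrite !exprS; case: z IH => a b; set w := _ ^+ l; case: w => c d /= IH.
apply: (@le_trans _ _ ((`|a| + `|b|) * (`|c| + `|d|)));
  last by rewrite ler_wpM2l// addr_ge0.
rewrite (_ : _ * _ = (`|a| * `|c| + `|b| * `|d|) + (`|a| * `|d| + `|b| *
  `|c|)); last by ring.
rewrite -!normrM; apply: lerD; first exact: ler_normB.
exact: ler_normD.
Qed.

Lemma Re_sum_scale n (c : nat -> R) (w : nat -> R[i]) :
  \sum_(l < n) (c l)%:C%C * w l =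
  ((\sum_(l < n) c l * complex.Re (w l))%:C + 'i * (\sum_(l < n) c l *
    complex.Im (w l))%:C)%C.
Proof.
rewrite !rmorph_sum mulr_sumr -big_split /=; apply: eq_bigr => l _.
case: (w l) => p q; apply/eqP; rewrite eq_complex /=.
by apply/andP; split; apply/eqP; ring.
Qed.

(** The coefficients are real, so [tannery] applies to the real and imaginary parts separately, with
    the exponential series at [r * s] as majorant, where [s] is the base of the bound in
    [complex_pow_le]. *)
Lemma complex_tannery (c : nat -> nat -> R) (b : nat -> R) (r : R) (z : C) (K :
  nat -> nat) :
  (forall m l, `|c m l| <= r ^+ l / l`!%:R) ->
  (forall l, c m l @[m --> \oo] --> b l) -> (forall m, (m <= K m)%N) ->
  cvgn (series (fun l => (b l)%:C%C * z ^+ l : C)) /\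
  (\sum_(l < K m) (c m l)%:C%C * z ^+ l : C) @[m --> \oo] -->
    limn (series (fun l => (b l)%:C%C * z ^+ l : C)).
Proof.
move=> cb cl mK.
pose s := `|complex.Re z| + `|complex.Im z|.
have real_part (p : C -> R) : (forall l, `|p (z ^+ l)| <= s ^+ l) ->
    cvgn (series (fun l => b l * p (z ^+ l))) /\
    \sum_(l < K m) c m l * p (z ^+ l) @[m --> \oo] --> limn (series (fun l => b
      l * p (z ^+ l))).
  move=> ps.
  have [|||c1 c2] := @tannery R (fun m l => c m l * p (z ^+ l)) (fun l => b l *
    p (z ^+ l))
    (exp_coeff (r * s)) K _ _ _ mK.
  - move=> m l; rewrite normrM /exp_coeff /= exprMn mulrAC; exact: ler_pM.
  - exact: is_cvg_series_exp_coeff.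
  - by move=> l; apply: cvgMl; exact: cl.
  - split=> //; under eq_fun do rewrite -(big_mkord xpredT (fun l => c _ l * p (z ^+ l))).
    exact: c2.
have [reC reL] : _ /\ _ := real_part (@complex.Re R) (fun l => le_trans
  (ler_wpDr (normr_ge0 _) (lexx _)) (complex_pow_le z l)).
have [imC imL] : _ /\ _ := real_part (@complex.Im R) (fun l => le_trans
  (ler_wpDl (normr_ge0 _) (lexx _)) (complex_pow_le z l)).
set X := limn _ in reL; set Y := limn _ in imL.
pose L : C := (X%:C + 'i * Y%:C)%C.
have toL (u v : nat -> R) : u @ \oo --> X -> v @ \oo --> Y ->
    (((u n)%:C + 'i * (v n)%:C)%C : C) @[n --> \oo] --> L.
  move=> uX vY; apply: cvgD; first exact: cvg_real_complex.
  by apply: cvgMr; exact: cvg_real_complex.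
have sE : series (fun l => (b l)%:C%C * z ^+ l : C) =
    (fun n => ((series (fun l => b l * complex.Re (z ^+ l)) n)%:C +
      'i * (series (fun l => b l * complex.Im (z ^+ l)) n)%:C)%C).
  by apply/funext => n; rewrite /series /= !big_mkord Re_sum_scale.
have sL := toL _ _ reC imC.
have cs : cvgn (series (fun l => (b l)%:C%C * z ^+ l : C)) by rewrite sE;
  apply/cvg_ex; exists L.
split; first exact: cs.
have -> : limn (series (fun l => (b l)%:C%C * z ^+ l : C)) = L.
  by rewrite sE; exact: (cvg_lim (@norm_hausdorff _ _) sL).
have fE : (fun m => \sum_(l < K m) (c m l)%:C%C * z ^+ l : C) =
    (fun m => ((\sum_(l < K m) c m l * complex.Re (z ^+ l))%:C +
      'i * (\sum_(l < K m) c m l * complex.Im (z ^+ l))%:C)%C).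
  by apply/funext => m; exact: Re_sum_scale.
rewrite fE; exact: (toL _ _ reL imL).
Qed.

End complex_convergence.

Theorem mainTheorem7 (R : realType) (rho : R) (rho_gt0 : 0 < rho)
    (phi : forall n : nat, 'rV[R]_n -> 'rV[R]_n.+1)
    (phi_chart : forall n : nat, (0 < n)%N ->
       isometric_chart (@simplex_space R rho n) (phi n))
    (tau : complexes R) :
  let M : nat -> complexes R := fun n =>
    horner_complex
      (renorm_steiner_poly (phi n @^-1` @regular_simplex R rho n)) tau in
  let a : nat -> complexes R := fun l =>
    ((Num.sqrt pi / 2) ^+ l)%:C%C *
      (tau ^+ l / (Gamma (l%:R / 2 + 1) * Gamma (l%:R + 1))%:C%C) in
  cvgn (series a) /\ M n @[n --> \oo] --> limn (series a).
Proof.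
move=> M a.
have div_scale (x y : R) (t : complexes R) :
    x%:C%C * (t / y%:C%C) = (x / y)%:C%C * t :> complexes R.
  by rewrite rmorphM fmorphV mulrA mulrAC.
have aE : a = fun l => (limit_coef R l)%:C%C * tau ^+ l.
  by apply/funext => l; exact: div_scale.
(* In dimension [m.+1] the polynomial has [m.+2] coefficients, and 4 is the base of the majorant in
   [simplex_coef_le]. *)
have [||ca cM] := @complex_tannery R (simplex_coef R) (limit_coef R) 4 tau (fun
  m => m.+2) _ (@cvg_simplex_coef R) _.
- by move=> m l; rewrite ger0_norm ?simplex_coef_ge0// simplex_coef_le.
- by move=> m; rewrite ltnW// ltnW.
rewrite aE; split; first exact: ca.
rewrite -(cvg_shiftS M).
apply: cvg_trans cM; apply: near_eq_cvg; near=> m.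
(* The facets of the simplex of dimension [m.+1] are measured with the chart of dimension [m], which
   is isometric for [m > 0]. *)
have m0 : (0 < m)%N by near: m; exact: nbhs_infty_gt.
rewrite /M -horner_complex_poly; congr horner_complex; apply/esym.
by apply: (@renorm_steiner_poly_simplex _ _ m _ (phi m)) => //; exact: phi_chart.
Unshelve. all: by end_near.
Qed.
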